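(* Let $\boldsymbol{\theta}\in\mathbb{R}^{m+2(p-1)}$ and $c>0$, let $\{\boldsymbol{\theta}^n\}_{n\ge1}$ be a sequence of parameters with $\boldsymbol{\theta}^n\in B_c(n,\boldsymbol{\theta})$, and let $\{\boldsymbol{h}^n\}_{n\ge1}$ be a sequence of random vectors with $\boldsymbol{h}^n\in R_c(n,\boldsymbol{\theta})$. Then, when the data $\mathbf{Y}^n$ are distributed according to $\mathbb{P}_{\boldsymbol{\theta}^n}$, $$\left(\tfrac{1}{\sqrt n}U^n(\boldsymbol{\theta}^n),\ \tfrac1nJ^n(\boldsymbol{h}^n)\right)\Rightarrow\left(H(\tilde{\boldsymbol{\theta}}),\,W(\tilde{\boldsymbol{\theta}})\right)\qquad (n\to\infty)$$ in distribution, where $H(\tilde{\boldsymbol{\theta}})=\left(\mathbf{0}_m^T,\ \big((\tilde W(\tilde{\boldsymbol{\theta}}))^{1/2}\mathbf{z}\big)^T\right)^T$, $\mathbf{0}_m$ is the null vector of dimension $m$, and $\mathbf{z}$ is a standard normal random vector on $\mathbb{R}^{2(p-1)}$ independent of the random matrix $\tilde W(\tilde{\boldsymbol{\theta}})$. Furthermore, the random matrix $\tilde W(\tilde{\boldsymbol{\theta}})$ is positive definite with probability one and it depends only on the bias components $\tilde{\boldsymbol{\theta}}$ and the unobserved variables $(x_1,\dots,x_m)$.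
   Context: Model. Fix integers $p\ge2$ (laboratories; laboratory 1 is the reference) and $m\ge2$ (levels), and known positive constants $\sigma^2_{x_j}$ and $\sigma^2_{ij}$ ($i=1,\dots,p$, $j=1,\dots,m$). The parameter is $\boldsymbol{\theta}=(\mu_{x_1},\dots,\mu_{x_m},\alpha_2,\dots,\alpha_p,\beta_2,\dots,\beta_p)^T\in\mathbb{R}^{m+2(p-1)}$, with bias components $\tilde{\boldsymbol{\theta}}=(\alpha_2,\dots,\alpha_p,\beta_2,\dots,\beta_p)^T$; put $\alpha_1=0$, $\beta_1=1$. The unobserved variables $x_j\sim N(\mu_{x_j},\sigma^2_{x_j})$ and the errors $e_{ijk}\sim N(0,\sigma^2_{ij})$ are all mutually independent, and the observations are $Y_{ijk}=\alpha_i+\beta_i x_j+e_{ijk}$, $k=1,\dots,n_i$, $i=1,\dots,p$, $j=1,\dots,m$. Put $n=\sum_{i=1}^p n_i$, and let $\mathbf{Y}^n$ be the vector of all observations. The limit $n\to\infty$ means that $n_i\to\infty$ and $n_i/n\to w_i$ for every $i$, with $w_i>0$ constants. $\mathbb{P}_{\boldsymbol{\theta}}$ denotes the law of the observed data under parameter $\boldsymbol{\theta}$, and $\mathbb{P}_{(x_1,\dots,x_m)}$ the law of $(x_1,\dots,x_m)$ under $\boldsymbol{\theta}$ (the limit objects are taken under the latter, together with the independent $\mathbf z$). $L^n(\boldsymbol{\theta})=\log f_{\mathbf{Y}^n}(\mathbf{Y}^n,\boldsymbol{\theta})$ is the log-likelihood of the observed data (the marginal normal density of $\mathbf{Y}^n$,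 with $x_1,\dots,x_m$ integrated out), $U^n(\boldsymbol{\theta})=\frac{\partial L^n(\boldsymbol{\theta})}{\partial\boldsymbol{\theta}}$ and $J^n(\boldsymbol{\theta})=-\frac{\partial^2L^n(\boldsymbol{\theta})}{\partial\boldsymbol{\theta}\,\partial\boldsymbol{\theta}^T}$. With $|\mathbf v|=\max_h|v_h|$ and $c>0$: $B_c(n,\boldsymbol{\theta})$ is the set of vectors $\boldsymbol{\psi}\in\mathbb{R}^{m+2(p-1)}$ with $\sqrt n\,|\boldsymbol{\psi}-\boldsymbol{\theta}|\le c$; $R_c(n,\boldsymbol{\theta})$ is the set of random vectors $\boldsymbol{\phi}$ in $\mathbb{R}^{m+2(p-1)}$, functions of $\mathbf{Y}^n$, with $\sqrt n\,|\boldsymbol{\phi}-\boldsymbol{\theta}|\le c$. The random matrix $W(\tilde{\boldsymbol{\theta}})$, a symmetric matrix with rows and columns indexed by the components of $\boldsymbol{\theta}$, is defined as follows. Put $S_j=\sum_{q=1}^p w_q\beta_q^2/\sigma^2_{qj}$. All entries in a row or column associated with some $\mu_{x_j}$ are $0$; for $i,l\in\{2,\dots,p\}$, $i\ne l$, $$W_{\alpha_i\alpha_i}=\sum_{j=1}^m\kappa_{ij},\quad W_{\alpha_i\beta_i}=\sum_{j=1}^m x_j\kappa_{ij},\quad W_{\beta_i\beta_i}=\sum_{j=1}^m x_j^2\kappa_{ij},\qquad \kappa_{ij}=\frac{w_i}{\sigma^2_{ij}}\Big(1-\frac{w_i\beta_i^2}{\sigma^2_{ij}S_j}\Big),$$ $$W_{\alpha_i\alpha_l}=-\sum_{j=1}^m\kappa_{ilj},\quad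 W_{\alpha_i\beta_l}=-\sum_{j=1}^m x_j\kappa_{ilj},\quad W_{\beta_i\beta_l}=-\sum_{j=1}^m x_j^2\kappa_{ilj},\qquad \kappa_{ilj}=\frac{w_iw_l\beta_i\beta_l}{\sigma^2_{ij}\sigma^2_{lj}S_j}.$$ $\tilde W(\tilde{\boldsymbol{\theta}})$ is the $2(p-1)\times2(p-1)$ submatrix of $W(\tilde{\boldsymbol{\theta}})$ obtained by deleting the rows and columns associated with the $\mu_{x_j}$. For a positive definite matrix $A$, $A^{1/2}$ is its symmetric positive square root. *)

(* Defs.v *)
From HB Require Import structures.
From mathcomp Require Import all_boot all_order all_algebra.
From mathcomp Require Import all_classical all_reals all_analysis.

Set Implicit Arguments.
Unset Strict Implicit.
Unset Printing Implicit Defensive.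

Import Order.TTheory GRing.Theory Num.Theory.
Import numFieldNormedType.Exports.

Local Open Scope classical_set_scope.
Local Open Scope ring_scope.

Section probability.
Context {R : realType}.

(* For a finite family, the product rule over all Borel sets contains the rule
   for every subfamily (take [set: R] at the other indices). *)
Definition mutually_independent d (T : measurableType d) (P : probability T R)
    (I : finType) (X : I -> T -> R) : Prop :=
  forall B : I -> set R, (forall i, measurable (B i)) ->
    P [set t | forall i, B i (X i t)]
    = (\prod_(i : I) P (X i @^-1` B i))%E.

(* [s] is the standard deviation. *)
Definition has_normal_law d (T : measurableType d) (P : probability T R)
    (X : {RV P >-> R}) (mu s : R) : Prop :=
  forall B : set R, measurable B -> distribution P X B = normal_prob mu s B.

Definition borel_measurable d (T : measurableType d) (E : topologicalType)
    (X : T -> E) : Prop :=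
  forall U : set E, open U -> measurable (X @^-1` U).

Definition cvg_in_distribution (E : topologicalType)
    (d : nat -> measure_display) (T : forall nu, measurableType (d nu))
    (P : forall nu, probability (T nu) R) (X : forall nu, T nu -> E)
    (d' : measure_display) (T' : measurableType d') (P' : probability T' R)
    (X' : T' -> E) : Prop :=
  [/\ forall nu, borel_measurable (X nu),
      borel_measurable X'
    & forall f : E -> R, continuous f -> (exists M, forall x, `|f x| <= M) ->
        'E_(P nu)[fun t => f (X nu t)]%E @[nu --> \oo]
          --> 'E_P'[fun t => f (X' t)]%E].

End probability.

Section matrices.
Context {R : realType}.

Definition posdefmx k (A : 'M[R]_k) : Prop :=
  A^T = A /\ forall v : 'cV[R]_k, v != 0 -> 0 < (v^T *m A *m v) 0 0.

(* The symmetric positive definite square root; junk value 0 when there is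
   none, that is, when [A] is not symmetric positive definite. *)
Definition mxsqrt k (A : 'M[R]_k) : 'M[R]_k :=
  xget 0 [set B | posdefmx B /\ B *m B = A].

End matrices.

Section calculus.
Context {R : realType}.

Definition partial_derivative k (f : 'rV[R]_k -> R) (h : 'I_k)
    (t : 'rV[R]_k) : R :=
  'D_(delta_mx 0 h) f t.

Definition gradient k (f : 'rV[R]_k -> R) (t : 'rV[R]_k) : 'rV[R]_k :=
  \row_h partial_derivative f h t.

Definition hessian k (f : 'rV[R]_k -> R) (t : 'rV[R]_k) : 'M[R]_k :=
  \matrix_(h, l) partial_derivative (partial_derivative f l) h t.

Definition vcons k (t : R) (v : 'I_k -> R) : 'I_k.+1 -> R :=
  fun j => if unlift ord0 j is Some j' then v j' else t.

(* Iterated Lebesgue integral of a function of [k] real variables over R^k. *)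
Fixpoint integral_Rn k : (('I_k -> R) -> R) -> R :=
  match k with
  | 0%N => fun g => g (fun=> 0)
  | k'.+1 => fun g =>
      \int[lebesgue_measure]_t integral_Rn (fun v => g (vcons t v))
  end.

End calculus.

(* There are p = q.+1 laboratories; index ord0 is the reference laboratory, and
   the others are the [lift ord0 i], i : 'I_q. A parameter is
   (mu_1, ..., mu_m, alpha_2, ..., alpha_p, beta_2, ..., beta_p). *)
Section parameters.
Context {R : realType} {q m : nat}.
Implicit Type theta : 'rV[R]_(m + (q + q)).

Definition par_mu theta (j : 'I_m) : R := theta 0 (lshift (q + q) j).

Definition par_alpha theta (i : 'I_q.+1) : R :=
  if unlift ord0 i is Some i' then theta 0 (rshift m (lshift q i')) else 0.

Definition par_beta theta (i : 'I_q.+1) : R :=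
  if unlift ord0 i is Some i' then theta 0 (rshift m (rshift q i')) else 1.

Definition par_bias theta : 'rV[R]_(q + q) := rsubmx theta.

End parameters.

(* The index (i, j, k) of the k-th replicate of laboratory i at level j, where
   laboratory i has [N i] replicates at each level. *)
Definition obs (q m : nat) (N : 'I_q.+1 -> nat) : finType :=
  {i : 'I_q.+1 & ('I_m * 'I_(N i))%type}.

Section observations.
Context {q m : nat} {N : 'I_q.+1 -> nat}.

Definition lab (o : obs m N) : 'I_q.+1 := tag o.
Definition level (o : obs m N) : 'I_m := (tagged o).1.

End observations.

Section model.
Context {R : realType} {q m : nat}.
(* [sx j] and [s i j] are the standard deviations of x_j and of e_ijk. *)
Variables (sx : 'I_m -> R) (s : 'I_q.+1 -> 'I_m -> R).
Variable (N : 'I_q.+1 -> nat).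
Implicit Type theta : 'rV[R]_(m + (q + q)).

Definition observation theta (x : 'I_m -> R) (e : obs m N -> R) :
    obs m N -> R :=
  fun o => par_alpha theta (lab o) + par_beta theta (lab o) * x (level o) + e o.

Definition joint_density theta (y : obs m N -> R) (x : 'I_m -> R) : R :=
  (\prod_(j < m) normal_pdf (par_mu theta j) (sx j) (x j)) *
  \prod_(o : obs m N)
     normal_pdf (par_alpha theta (lab o) + par_beta theta (lab o) * x (level o))
       (s (lab o) (level o)) (y o).

Definition marginal_density theta (y : obs m N -> R) : R :=
  integral_Rn (joint_density theta y).

Definition loglik (y : obs m N -> R) theta : R := ln (marginal_density theta y).

Definition score (y : obs m N -> R) theta : 'rV[R]_(m + (q + q)) :=
  gradient (loglik y) theta.

Definition observed_information (y : obs m N -> R) theta :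
    'M[R]_(m + (q + q)) :=
  - hessian (loglik y) theta.

Definition model_law theta d (T : measurableType d) (P : probability T R)
    (x : 'I_m -> {RV P >-> R}) (e : obs m N -> {RV P >-> R}) : Prop :=
  [/\ forall j, has_normal_law (x j) (par_mu theta j) (sx j),
      forall o, has_normal_law (e o) 0 (s (lab o) (level o))
    & mutually_independent P (fun k : ('I_m + obs m N)%type =>
        match k with inl j => x j : T -> R | inr o => e o : T -> R end)].

Definition total_size : nat := (\sum_(i < q.+1) N i)%N.

(* The norm of the normed module 'rV[R]_k is the maximum norm. *)
Definition Bset (c : R) theta : set 'rV[R]_(m + (q + q)) :=
  [set psi | Num.sqrt total_size%:R * `|psi - theta| <= c].

Definition Rset (c : R) theta d (T : measurableType d)
    (Y : T -> obs m N -> R) : set (T -> 'rV[R]_(m + (q + q))) :=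
  [set phi | [/\ borel_measurable phi,
                 exists g : (obs m N -> R) -> 'rV[R]_(m + (q + q)),
                   forall t, phi t = g (Y t)
               & forall t, Num.sqrt total_size%:R * `|phi t - theta| <= c]].

End model.

Section limit.
Context {R : realType} {q m : nat}.
Variables (s : 'I_q.+1 -> 'I_m -> R) (w : 'I_q.+1 -> R).
Implicit Types (theta : 'rV[R]_(m + (q + q))) (x : 'I_m -> R).

Definition Ssum theta (j : 'I_m) : R :=
  \sum_(l < q.+1) w l * par_beta theta l ^+ 2 / s l j ^+ 2.

Definition kappa1 theta (i : 'I_q.+1) (j : 'I_m) : R :=
  w i / s i j ^+ 2 *
  (1 - w i * par_beta theta i ^+ 2 / (s i j ^+ 2 * Ssum theta j)).

Definition kappa2 theta (i l : 'I_q.+1) (j : 'I_m) : R :=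
  w i * w l * par_beta theta i * par_beta theta l /
  (s i j ^+ 2 * s l j ^+ 2 * Ssum theta j).

(* a = 0, 1, 2 gives the (alpha, alpha), (alpha, beta), (beta, beta) block. *)
Definition Wblock theta x (a : nat) : 'M[R]_q :=
  \matrix_(i < q, l < q)
    if i == l then \sum_(j < m) x j ^+ a * kappa1 theta (lift ord0 i) j
    else - \sum_(j < m) x j ^+ a * kappa2 theta (lift ord0 i) (lift ord0 l) j.

Definition Wmx theta x : 'M[R]_(m + (q + q)) :=
  block_mx 0 0 0
    (block_mx (Wblock theta x 0) (Wblock theta x 1)
              (Wblock theta x 1)^T (Wblock theta x 2)).

Definition Wtilde theta x : 'M[R]_(q + q) := drsubmx (Wmx theta x).

Definition Hvec theta x (z : 'I_(q + q) -> R) : 'rV[R]_(m + (q + q)) :=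
  row_mx 0 (mxsqrt (Wtilde theta x) *m \col_h z h)^T.

Definition limit_law (sx : 'I_m -> R) theta d (T : measurableType d)
    (P : probability T R) (x : 'I_m -> {RV P >-> R})
    (z : 'I_(q + q) -> {RV P >-> R}) : Prop :=
  [/\ forall j, has_normal_law (x j) (par_mu theta j) (sx j),
      forall h, has_normal_law (z h) 0 1
    & mutually_independent P (fun k : ('I_m + 'I_(q + q))%type =>
        match k with inl j => x j : T -> R | inr h => z h : T -> R end)].

End limit.

(* Main.v *)
(* The posterior of x_j is Gaussian, so the log-likelihood is explicit in the
   sums of the observations: up to a constant it is
   -1/2 sum_j (ln G_j + A_j - B_j^2 / G_j) with G_j, A_j, B_j polynomial in the
   parameter. Let xi_j be the standardized x_j and zeta_ij the standardized sums
   of the errors. For every n these are independent standard normal variables,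
   and the normalized score and information are an expression in
   n^(-1/2), n_i / n, theta^n, h^n, xi and zeta which converges, uniformly for
   (xi, zeta) in a compact box and h near theta, to
   (sum_lj b_lj(x) zeta_lj, W(x)), where sum_lj b_lj(x) b_lj(x)^T = W(x). As the
   law of (xi, zeta) does not depend on n, nothing is lost in replacing the
   statistics by this limit. Finally, given x, the vector
   W~(x)^(-1/2) sum_lj b_lj(x) zeta_lj is the image of zeta under a matrix with
   orthonormal rows; hence it is standard normal and independent of x. It is
   defined almost surely, because W~(x) is positive definite as soon as the x_j
   are not all equal. *)

Require Import Defs.
From HB Require Import structures.
From mathcomp Require Import all_boot all_order all_algebra.
From mathcomp Require Import all_classical all_reals all_analysis.
From mathcomp Require Import measurable_realfun lebesgue_integral ring lra.
From mathcomp.real_closed Require Import complex.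

Set Implicit Arguments.
Unset Strict Implicit.
Unset Printing Implicit Defensive.

Import Order.TTheory GRing.Theory Num.Theory.
Import numFieldNormedType.Exports.

Local Open Scope classical_set_scope.
Local Open Scope ring_scope.

(** * Symmetric square roots of positive definite matrices *)

(** Every n has its own sample space, so nothing is coupled: only expectations of bounded continuous
    functions are compared, and each comparison takes place within one space. The vector h^n may
    depend on the data in any way. Its value is therefore a free argument of the expression, and
    uniformity in this argument replaces any knowledge of the joint law of h^n and the noise. The
    expression has to be regular at n^(-1/2) = 0. Two facts make it so: terms of order sqrt(n)
    cancel in the score because it is taken at the parameter that generates the data, and G_j / n
    stays away from 0 because the reference laboratory has beta = 1 and a positive weight. The
    matrix with orthonormal rows is itself random, being a function of x. Rotation invariance is
    thus applied for x fixed, on a product of two copies of the sample space. The square root of a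
    random matrix must also be measurable, which is obtained from its continuity on positive
    definite matrices. *)

Lemma poly_interpolation (F : fieldType) (g : F -> F) (d : seq F) :
  exists p : {poly F}, {in d, forall a, p.[a] = g a}.
Proof.
elim: d => [|a d [p pd]]; first by exists 0.
have [ad|ad] := boolP (a \in d).
  by exists p => b; rewrite inE => /predU1P[->|]; exact: pd.
pose r := \prod_(b <- d) ('X - b%:P).
have ra : r.[a] != 0 by rewrite -/(root r a) root_prod_XsubC.
exists (p + ((g a - p.[a]) / r.[a]) *: r) => b; rewrite inE => /predU1P[->|bd].
  by rewrite !hornerE divfK// addrC subrK.
have /eqP rb : root r b by rewrite root_prod_XsubC.
by rewrite !hornerE rb mulr0 addr0 pd.
Qed.

(** Over the complex numbers the matrix is Hermitian, hence unitarily diagonalizable with real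
    spectrum. Only the eigenvalues and the polynomial identities are brought back to the reals, by
    injectivity of the embedding. *)
Lemma symmetric_spectrum (R : realType) n (A : 'M[R]_n.+1) : A^T = A ->
  exists2 d : seq R, {in d, forall a, eigenvalue A a} &
    forall p q : {poly R}, {in d, forall a, p.[a] = q.[a]} ->
      horner_mx A p = horner_mx A q.
Proof.
move=> Asym; pose Ac : 'M[R[i]]_n.+1 := map_mx (real_complex R) A.
have Ach : Ac \is hermsymmx.
  apply: realsym_hermsym.
    apply/is_hermitianmxP; rewrite expr0 scale1r map_mx_id// /Ac map_trmx.
    by rewrite Asym.
  by apply/mxOverP => i j; rewrite mxE; apply/complex_realP; eexists.
have dr := hermitian_spectral_diag_real Ach.
have /hermitian_normalmx/orthomx_spectralP AcE := Ach.
set U := spectralmx Ac in AcE; set D := spectral_diag Ac in AcE dr.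
have Uu : U \is a GRing.unit := spectral_unit Ac.
have DE i : real_complex R (complex.Re (D 0 i)) = D 0 i.
  by rewrite RRe_real//; exact: (mxOverP dr).
exists [seq complex.Re (D 0 i) | i <- enum 'I_n.+1].
  move=> _ /mapP[i _ ->]; rewrite eigenvalue_root_char.
  have <- := fmorph_root (real_complex R); rewrite /= DE map_char_poly -/Ac.
  rewrite -eigenvalue_root_char; apply/eigenvalueP.
  exists (row i U).
    rewrite -row_mul [in LHS]AcE !mulmxA mulmxV// mul1mx row_mul.
    by rewrite row_diag_mx -scalemxAl -rowE.
  apply/eqP => Ui0; have : row i (U *m invmx U) = 0 by rewrite row_mul Ui0 mul0mx.
  rewrite mulmxV// => /rowP/(_ i); rewrite !mxE eqxx => /eqP.
  by rewrite oner_eq0.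
have hE (p : {poly R}) : map_mx (real_complex R) (horner_mx A p) =
    invmx U *m diag_mx (map_mx (horner (map_poly (real_complex R) p)) D) *m U.
  transitivity (horner_mx Ac (map_poly (real_complex R) p)).
    exact: map_horner_mx.
  rewrite [in LHS]AcE; apply: etrans; first exact: horner_mx_uconjC.
  by congr (_ *m _ *m _); exact: horner_mx_diag.
move=> p q pq; apply: (@map_mx_inj _ _ (real_complex R)).
rewrite [LHS]hE [RHS]hE; do 3 f_equal; apply/rowP => i.
rewrite [LHS]mxE [RHS]mxE -[D 0 i]DE.
apply: etrans; first exact: horner_map.
apply: etrans; last by apply/esym; exact: horner_map.
by rewrite /= pq//; apply/mapP; exists i => //; rewrite mem_enum.
Qed.

Section mxsqrt_theory.
Context {R : realType}.

Lemma sqnorm_gt0 k (v : 'cV[R]_k) : v != 0 -> 0 < (v^T *m v) 0 0.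
Proof.
move=> v0; rewrite mxE.
rewrite lt_neqAle eq_sym; apply/andP; split.
  apply: contra_neq v0 => /eqP; rewrite psumr_eq0; last first.
    by move=> i _; rewrite mxE -expr2 sqr_ge0.
  move=> /allP v0; apply/colP => i; rewrite mxE.
  by apply/eqP; have := v0 i (mem_index_enum i); rewrite mxE -expr2 sqrf_eq0.
by apply: sumr_ge0 => i _; rewrite mxE -expr2 sqr_ge0.
Qed.

Lemma posdefmx_gram k l (C : 'M[R]_(l, k)) :
  (forall v : 'cV_k, C *m v = 0 -> v = 0) -> posdefmx (C^T *m C).
Proof.
move=> Cinj; split=> [|v v0]; first by rewrite trmx_mul trmxK.
rewrite -mulmxA -mulmxA mulmxA -trmx_mul; apply: sqnorm_gt0.
by apply: contra_neq v0; exact: Cinj.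
Qed.

Lemma posdefmx_inj k (A : 'M[R]_k) (v : 'cV_k) :
  posdefmx A -> A *m v = 0 -> v = 0.
Proof.
move=> [_ Apos] Av0; apply/eqP; apply: contraT => /Apos.
by rewrite -mulmxA Av0 mulmx0 mxE ltxx.
Qed.

Lemma posdefmx_unit k (A : 'M[R]_k) : posdefmx A -> A \in unitmx.
Proof.
move=> Apos; rewrite -unitmx_tr -row_free_unit -kermx_eq0; apply/eqP/row_matrixP => i.
rewrite row0; apply: trmx_inj; rewrite trmx0; apply: (posdefmx_inj Apos).
by apply: trmx_inj; rewrite trmx_mul trmxK -row_mul mulmx_ker row0 trmx0.
Qed.

Lemma posdefmx_quad_ge0 k (A : 'M[R]_k) (v : 'cV_k) :
  posdefmx A -> 0 <= (v^T *m A *m v) 0 0.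
Proof.
move=> [_ Apos]; have [->|/Apos/ltW//] := eqVneq v 0.
by rewrite mulmx0 mxE.
Qed.

Lemma posdefmx_sqrt_exists k (A : 'M[R]_k) : posdefmx A ->
  exists B, posdefmx B /\ B *m B = A.
Proof.
case: k A => [|n] A Apos.
  exists 1%:M; split; last by apply/matrixP => -[].
  split=> [|v]; first exact: trmx1.
  by rewrite [v]flatmx0 eqxx.
have [Asym Ap] := Apos.
have [d dA dE] := symmetric_spectrum Asym.
have dpos a : a \in d -> 0 < a.
  move=> /dA/eigenvalueP[v vA v0].
  have vT0 : v^T != 0 by apply: contra_neq v0 => /(congr1 trmx); rewrite trmxK trmx0.
  have := Ap _ vT0; rewrite trmxK vA -scalemxAl mxE pmulr_lgt0//.
  by have := sqnorm_gt0 vT0; rewrite trmxK.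
(* Fourth roots are interpolated: the square root is then C C = C^T C, a Gram matrix, and its
   positivity follows from injectivity of C. *)
have [p pE] := poly_interpolation (fun a => Num.sqrt (Num.sqrt a)) d.
pose C := horner_mx A p.
have CT : C^T = C.
  rewrite /C; elim/poly_ind: (p) => [|r c IH]; first by rewrite rmorph0 trmx0.
  rewrite rmorphD rmorphM/= horner_mx_X horner_mx_C linearD/= tr_scalar_mx.
  congr (_ + _); rewrite [LHS]trmx_mul Asym IH.
  by rewrite (comm_mx_horner _ (comm_mx_refl A)).
have CA : (C *m C) *m (C *m C) = A.
  rewrite -[RHS](horner_mx_X A) -(dE (p * p * (p * p))) => [|a ad].
    by rewrite !rmorphM.
  rewrite !hornerM hornerX pE//; have sa (b : R) : 0 <= b -> Num.sqrt b * Num.sqrt b = b.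
    by move=> b0; rewrite -expr2 sqr_sqrtr.
  by rewrite sa ?sqrtr_ge0// sa// ltW// dpos.
exists (C *m C); split=> //.
rewrite -{1}CT; apply: posdefmx_gram => v Cv.
by apply: (posdefmx_inj Apos); rewrite -CA -!mulmxA Cv !mulmx0.
Qed.

(** The Frobenius inner product; all estimates on matrices are made in its norm. *)
Definition mxdot k l (A B : 'M[R]_(k, l)) : R := \sum_i \sum_j A i j * B i j.

Lemma mxdot_sqr_ge0 k l (A : 'M[R]_(k, l)) : 0 <= mxdot A A.
Proof. by do 2!(apply: sumr_ge0 => ? _); rewrite -expr2 sqr_ge0. Qed.

Lemma mxdot_cauchy k l (A B : 'M[R]_(k, l)) :
  mxdot A B ^+ 2 <= mxdot A A * mxdot B B.
Proof.
have q t : 0 <= mxdot A A - (mxdot A B * t) *+ 2 + mxdot B B * t ^+ 2.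
  have -> : mxdot A A - (mxdot A B * t) *+ 2 + mxdot B B * t ^+ 2
     = mxdot (A - t *: B) (A - t *: B).
    rewrite /mxdot -mulrnAl -sumrMnl !mulr_suml -sumrB -big_split/=.
    apply: eq_bigr => i _; rewrite -sumrMnl !mulr_suml -sumrB -big_split/=.
    by apply: eq_bigr => j _; rewrite !mxE; ring.
  exact: mxdot_sqr_ge0.
have := mxdot_sqr_ge0 B; rewrite le_eqVlt => /predU1P[B0|Bpos].
  (* If B has norm 0, the quadratic is affine in t, and this t would give it the value -1 unless
     [mxdot A B] vanishes. *)
  rewrite -B0 mulr0; have := q ((mxdot A A + 1) / (mxdot A B) / 2).
  rewrite -B0 mul0r addr0; have [->|AB0] := eqVneq (mxdot A B) 0.
    by rewrite expr0n.
  have -> : mxdot A A - mxdot A B * ((mxdot A A + 1) / mxdot A B / 2) *+ 2 = -1.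
    by rewrite -mulr_natr; field.
  lra.
have := q (mxdot A B / mxdot B B).
have -> : mxdot A A - mxdot A B * (mxdot A B / mxdot B B) *+ 2 +
   mxdot B B * (mxdot A B / mxdot B B) ^+ 2 =
   (mxdot A A * mxdot B B - mxdot A B ^+ 2) / mxdot B B.
  by rewrite -mulr_natr; field; rewrite gt_eqF.
by rewrite pmulr_lge0 ?invr_gt0// subr_ge0.
Qed.

Lemma mxdot_mul_le k l (M : 'M[R]_(k, l)) (v : 'cV[R]_l) :
  mxdot (M *m v) (M *m v) <= mxdot M M * mxdot v v.
Proof.
rewrite /mxdot mulr_suml; apply: ler_sum => i _.
rewrite big_ord1; have := mxdot_cauchy (row i M) v^T.
have -> : mxdot (row i M) v^T = (M *m v) i 0.
  by rewrite /mxdot big_ord1 !mxE; apply: eq_bigr => j _; rewrite !mxE.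
rewrite expr2 => /le_trans; apply; rewrite le_eqVlt; apply/orP; left; apply/eqP.
congr (_ * _); rewrite /mxdot big_ord1.
  by apply: eq_bigr => j _; rewrite !mxE.
by apply: eq_bigr => j _; rewrite !mxE big_ord1.
Qed.

Lemma mxdot_sqnorm k (v : 'cV[R]_k) : mxdot v v = (v^T *m v) 0 0.
Proof. by rewrite /mxdot mxE; apply: eq_bigr => i _; rewrite big_ord1 mxE. Qed.

(** With B = C C and C symmetric, v = C^-1 (C v) bounds |v|^2 by a multiple of |C v|^2 = v^T B v. *)
Lemma posdefmx_coercive k (B : 'M[R]_k) : posdefmx B ->
  exists2 a, 0 < a & forall v : 'cV[R]_k, a * mxdot v v <= (v^T *m B *m v) 0 0.
Proof.
move=> /posdefmx_sqrt_exists[C [Cpos <-]].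
(* The summand 1 keeps b positive in dimension 0. *)
have Cu := posdefmx_unit Cpos; pose b := mxdot (invmx C) (invmx C) + 1.
have b0 : 0 < b by rewrite ltr_wpDl// mxdot_sqr_ge0.
exists b^-1; rewrite ?invr_gt0// => v; rewrite mulrC ler_pdivrMr// mulrC.
have -> : (v^T *m (C *m C) *m v) 0 0 = mxdot (C *m v) (C *m v).
  by rewrite mxdot_sqnorm trmx_mul (proj1 Cpos) !mulmxA.
have := mxdot_mul_le (invmx C) (C *m v); rewrite mulKmx// => /le_trans; apply.
by rewrite ler_wpM2r ?mxdot_sqr_ge0// /b lerDl.
Qed.

Lemma mxdot_mulr k l (D : 'M[R]_(k, l)) (B : 'M[R]_l) :
  mxdot D (D *m B) = \sum_i ((row i D)^T^T *m B *m (row i D)^T) 0 0.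
Proof.
apply: eq_bigr => i _; rewrite trmxK -row_mul mxE; apply: eq_bigr => j _.
by rewrite !mxE mulrC; congr (_ * _); apply: eq_bigr => l' _; rewrite mxE.
Qed.

Lemma mxdot_tr k l (A B : 'M[R]_(k, l)) : mxdot A^T B^T = mxdot A B.
Proof.
by rewrite /mxdot exchange_big; do 2!apply: eq_bigr => ? _; rewrite !mxE.
Qed.

(* With D = B' - B one has B' D + D B = B'^2 - B^2; pair this with D. *)
Lemma posdefmx_sqrt_lipschitz k (B : 'M[R]_k) : posdefmx B ->
  exists2 a, 0 < a & forall B' : 'M[R]_k, posdefmx B' ->
    a * mxdot (B' - B) (B' - B)
      <= mxdot (B' *m B' - B *m B) (B' *m B' - B *m B).
Proof.
move=> Bpos; have [a a0 aB] := posdefmx_coercive Bpos.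
exists (a ^+ 2) => [|B' B'pos]; first by rewrite exprn_gt0.
set D := B' - B; set E := _ - _.
have EE : E = B' *m D + D *m B.
  by rewrite /D mulmxBr mulmxBl addrA subrK.
have dDE : a * mxdot D D <= mxdot D E.
  have -> : mxdot D E = mxdot D (B' *m D) + mxdot D (D *m B).
    rewrite EE /mxdot -big_split/=; apply: eq_bigr => i _.
    by rewrite -big_split/=; apply: eq_bigr => j _; rewrite [X in _ * X]mxE mulrDr.
  rewrite -[leLHS]add0r lerD//.
    rewrite -mxdot_tr trmx_mul mxdot_mulr; apply: sumr_ge0 => i _.
    by apply: posdefmx_quad_ge0; rewrite (proj1 B'pos).
  rewrite mxdot_mulr /mxdot mulr_sumr; apply: ler_sum => i _.
  apply: le_trans (aB _); rewrite /mxdot ler_pM2l//.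
  by apply: ler_sum => j _; rewrite big_ord1 !mxE.
have := mxdot_sqr_ge0 D; rewrite le_eqVlt => /predU1P[D0|D0].
  by rewrite -D0 mulr0 mxdot_sqr_ge0.
have := le_trans _ (mxdot_cauchy D E).
move=> /(_ ((a * mxdot D D) ^+ 2)); rewrite lerXn2r ?nnegrE.
- move=> /(_ isT) dE; rewrite -(ler_pM2l D0); apply: le_trans dE.
  by rewrite le_eqVlt; apply/orP; left; apply/eqP; ring.
- by rewrite mulr_ge0// ltW.
- by apply: le_trans dDE; rewrite mulr_ge0// ltW.
- exact: dDE.
Qed.

Lemma mxsqrtP k (A : 'M[R]_k) : posdefmx A ->
  posdefmx (mxsqrt A) /\ mxsqrt A *m mxsqrt A = A.
Proof.
move=> /posdefmx_sqrt_exists[B BA].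
exact: (@xgetPex _ 0 [set B | posdefmx B /\ B *m B = A] (ex_intro _ B BA)).
Qed.

(** The square of a symmetric injective matrix is a Gram matrix, so only positive definite matrices
    have a root of the required kind. *)
Lemma mxsqrt_junk k (A : 'M[R]_k) : ~ posdefmx A -> mxsqrt A = 0.
Proof.
move=> nA; rewrite /mxsqrt xgetPN// => B [Bpos BA]; apply: nA.
rewrite -BA -{1}(proj1 Bpos); apply: posdefmx_gram => v.
exact: posdefmx_inj.
Qed.

Lemma cvg_matrixP k l (T : Type) (F : set_system T) {FF : Filter F}
    (M : T -> 'M[R]_(k, l)) (A : 'M[R]_(k, l)) :
  M t @[t --> F] --> A <-> forall i j, M t i j @[t --> F] --> A i j.
Proof.
split=> [MA i j|MA].
  exact: (cvg_comp _ _ MA (@coord_continuous _ _ _ i j A)).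
apply/cvgrPdist_lt => eps eps0.
have [kl|] := altP (@existsP _ (fun ij : 'I_k * 'I_l => true)); last first.
  rewrite negb_exists => /forallP none; near=> t; rewrite (_ : A - M t = 0) ?normr0//.
  by apply/matrixP => i j; have := none (i, j).
have : \forall t \near F, forall i j, `|A i j - M t i j| < eps.
  by do 2!apply: filter_forall => ?; exact: cvgr_dist_lt (MA _ _) _ eps0.
apply: filterS => t At; rewrite /Num.norm/= mx_normrE; apply/bigmax_ltP; split=> //= ij _.
by rewrite !mxE.
Unshelve. all: by end_near.
Qed.

Lemma cvg_sumr (T I : Type) (F : set_system T) {FF : Filter F} (r : seq I)
    (P : pred I) (f : I -> T -> R) (a : I -> R) :
  (forall i, P i -> f i t @[t --> F] --> a i) ->
  \sum_(i <- r | P i) f i t @[t --> F] --> \sum_(i <- r | P i) a i.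
Proof.
move=> fa; elim: r => [|i r IH].
  by under eq_fun do rewrite big_nil; rewrite big_nil; exact: cvg_cst.
under eq_fun do rewrite big_cons; rewrite big_cons.
by case: ifPn => // Pi; apply: cvgD => //; exact: fa.
Qed.

Lemma cvg_mxdot k l (T : Type) (F : set_system T) {FF : Filter F}
    (M : T -> 'M[R]_(k, l)) (A : 'M[R]_(k, l)) :
  M t @[t --> F] --> A -> mxdot (M t - A) (M t - A) @[t --> F] --> (0 : R).
Proof.
move=> /cvg_matrixP MA.
have -> : (0 : R) = mxdot (A - A) (A - A).
  rewrite subrr /mxdot big1// => i _; rewrite big1// => j _.
  by rewrite !mxE mul0r.
apply: cvg_sumr => i _; apply: cvg_sumr => j _.
have MAij : M t i j - A i j @[t --> F] --> A i j - A i j.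
  by apply: cvgB; [exact: MA|exact: cvg_cst].
by under eq_fun do rewrite !mxE; rewrite !mxE; exact: cvgM.
Qed.

(** With E = M t - A, the number v^T E v is the Frobenius product of E with v v^T, a matrix of norm
    |v|^2. It cannot outweigh the coercivity bound a |v|^2 of A once the norm of E is below a. *)
Lemma near_posdefmx k (T : Type) (F : set_system T) {FF : Filter F}
    (M : T -> 'M[R]_k) (A : 'M[R]_k) : (forall t, (M t)^T = M t) ->
  posdefmx A -> M t @[t --> F] --> A -> \forall t \near F, posdefmx (M t).
Proof.
move=> Msym Apos /cvg_mxdot MA; have [a a0 aA] := posdefmx_coercive Apos.
have a20 : 0 < a ^+ 2 by rewrite exprn_gt0.
have /cvgrPdist_lt/(_ _ a20) := MA; apply: filterS => t.
rewrite sub0r normrN ger0_norm ?mxdot_sqr_ge0// => Mt; split=> // v v0.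
set E := M t - A in Mt *; have -> : M t = A + E by rewrite /E addrC subrK.
have vv : 0 < mxdot v v by rewrite mxdot_sqnorm sqnorm_gt0.
rewrite mulmxDr mulmxDl mxE; have vA := aA v.
have -> : (v^T *m E *m v) 0 0 = mxdot (v *m v^T) E.
  rewrite /mxdot exchange_big/= mxE; apply: eq_bigr => j _.
  by rewrite !mxE mulr_suml; apply: eq_bigr => i _; rewrite !mxE big_ord1 !mxE; ring.
have vvT : mxdot (v *m v^T) (v *m v^T) = mxdot v v ^+ 2.
  rewrite expr2 {2}/mxdot mulr_suml; apply: eq_bigr => i _.
  rewrite big_ord1 mulr_sumr; apply: eq_bigr => j _.
  by rewrite !mxE !big_ord1 !mxE; ring.
have := mxdot_cauchy (v *m v^T) E; rewrite vvT => C.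
have {}C : mxdot (v *m v^T) E ^+ 2 < (a * mxdot v v) ^+ 2.
  by rewrite (le_lt_trans C)// exprMn mulrC ltr_pM2r// exprn_gt0.
have nE : `|mxdot (v *m v^T) E| < a * mxdot v v.
  rewrite -[ltRHS]ger0_norm ?mulr_ge0 ?ltW//.
  by rewrite -ltr_sqr ?nnegrE// !real_normK ?num_real.
move: nE; rewrite ltr_norml => /andP[nE _].
by rewrite -ltrBlDr sub0r (lt_le_trans _ vA)// ltrNl.
Unshelve. all: by end_near.
Qed.

(** The Lipschitz bound holds at the fixed root of A against any other positive definite root. This
    continuity serves the measurability of [mxsqrt] ([measurable_mxsqrt]). *)
Lemma cvg_mxsqrt k (T : Type) (F : set_system T) {FF : Filter F}
    (M : T -> 'M[R]_k) (A : 'M[R]_k) : (forall t, (M t)^T = M t) ->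
  posdefmx A -> M t @[t --> F] --> A -> mxsqrt (M t) @[t --> F] --> mxsqrt A.
Proof.
move=> Msym Apos MA; have Mpos := near_posdefmx Msym Apos MA.
have [Bpos BA] := mxsqrtP Apos.
have [a a0 aB] := posdefmx_sqrt_lipschitz Bpos.
apply/cvg_matrixP => i j; apply/cvgrPdist_lt => eps eps0.
have aeps : 0 < a * eps ^+ 2 by rewrite mulr_gt0// exprn_gt0.
have MAlt : \forall t \near F, mxdot (M t - A) (M t - A) < a * eps ^+ 2.
  move: (MA) => /cvg_mxdot/cvgrPdist_lt MA0.
  have := MA0 _ aeps; apply: filterS => t.
  by rewrite sub0r normrN ger0_norm ?mxdot_sqr_ge0.
near=> t; have Mt : posdefmx (M t) by near: t; exact: Mpos.
have [Btpos BtM] := mxsqrtP Mt.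
have := aB _ Btpos; rewrite BtM BA => aBt.
set D := mxsqrt (M t) - mxsqrt A in aBt.
have Dlt : a * mxdot D D < a * eps ^+ 2.
  apply: le_lt_trans aBt _; by near: t; exact: MAlt.
rewrite -[ltRHS]ger0_norm ?ltW// -ltr_sqr ?nnegrE// !real_normK ?num_real//.
apply: le_lt_trans (_ : mxdot D D < _); last by move: Dlt; rewrite ltr_pM2l.
have -> : (mxsqrt A i j - mxsqrt (M t) i j) ^+ 2 = D i j * D i j.
  by rewrite /D !mxE; ring.
rewrite /mxdot (bigD1 i)//= (bigD1 j)//= -addrA lerDl addr_ge0//.
  by apply: sumr_ge0 => ? _; rewrite -expr2 sqr_ge0.
by do 2!(apply: sumr_ge0 => ? _); rewrite -expr2 sqr_ge0.
Unshelve. all: by end_near.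
Qed.

End mxsqrt_theory.

(** * Rotation invariance of independent standard normal variables *)

Section image_measure.
Context d d' (T : measurableType d) (T' : measurableType d') {R : realType}.
Variables (mu : {measure set T -> \bar R}) (f : T -> T').
Hypothesis mf : measurable_fun setT f.

(* [pushforward mu f] packed with its measure structure, whose canonical
   instance depends on the measurability proof. *)
Definition image_measure : {measure set T' -> \bar R}.
Proof. by unshelve refine (pushforward mu f : {measure set T' -> \bar R}). Defined.

Lemma image_measureE A : image_measure A = mu (f @^-1` A).
Proof. by []. Qed.

Lemma ge0_integral_image_measure (g : T' -> \bar R) :
  measurable_fun setT g -> (forall y, 0 <= g y)%E ->
  (\int[image_measure]_y g y = \int[mu]_x g (f x))%E.
Proof. by move=> mg g0; rewrite [LHS]ge0_integral_pushforward. Qed.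

End image_measure.

Section gaussian_plane.
Context {R : realType}.
Local Notation leb := (@lebesgue_measure R).

Lemma lebesgue_measure_affine (a b : R) (A : set R) : a != 0 -> measurable A ->
  (`|a|%:E * leb ((fun x => a * x + b)%R @^-1` A) = leb A)%E.
Proof.
move=> a0 mA; have mf : measurable_fun [set: measurableTypeR R]
    (fun x : measurableTypeR R => a * x + b : measurableTypeR R).
  by apply: measurable_funD => //; apply: measurable_funM.
pose f (x : R) := a * x + b.
pose m := mscale (NngNum (normr_ge0 a)) (image_measure leb mf).
rewrite [RHS](@lebesgue_measure_unique _ m)// => X [[u v] /= uv <-].
rewrite /m /mscale/= /pushforward/= -/f.
have [apos|aneg|/esym/eqP] := ltgtP 0 a; last by rewrite (negbTE a0).
- have -> : f @^-1` [set` `]u, v] ] = [set` `](u - b) / a, (v - b) / a] ].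
    apply/seteqP; split=> x /=; rewrite /f !in_itv/= => /andP[ux xv].
      by rewrite ltr_pdivrMr// ler_pdivlMr// ltrBlDr lerBrDr (mulrC x) ux xv.
    by move: ux xv; rewrite ltr_pdivrMr// ler_pdivlMr// ltrBlDr lerBrDr (mulrC x) => -> ->.
  rewrite !lebesgue_measure_itv/= !lte_fin.
  rewrite ltr_pM2r ?invr_gt0// ltrD2r; case: ifPn => _; last by rewrite mule0.
  by rewrite -!EFinB -EFinM gtr0_norm//; congr EFin; field.
(* A negative slope exchanges the open and the closed end; the length is the same. *)
- have -> : f @^-1` [set` `]u, v] ] = [set` `[(v - b) / a, (u - b) / a[ ].
    apply/seteqP; split=> x /=; rewrite /f !in_itv/= => /andP[ux xv].
      by rewrite ler_ndivrMr// ltr_ndivlMr// ltrBlDr lerBrDr (mulrC x) ux xv.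
    by move: ux xv; rewrite ler_ndivrMr// ltr_ndivlMr// ltrBlDr lerBrDr (mulrC x) => -> ->.
  rewrite !lebesgue_measure_itv/= !lte_fin.
  rewrite ltr_nM2r ?invr_lt0// ltrD2r; case: ifPn => _; last by rewrite mule0.
  by rewrite -!EFinB -EFinM ltr0_norm//; congr EFin; field.
Qed.

Lemma ge0_integral_affine (a b : R) (f : R -> \bar R) : a != 0 ->
  measurable_fun setT f -> (forall x, 0 <= f x)%E ->
  (`|a|%:E * \int[leb]_x f (a * x + b)%R = \int[leb]_x f x)%E.
Proof.
move=> a0 mf f0; have mg : measurable_fun [set: measurableTypeR R]
    (fun x : measurableTypeR R => a * x + b : measurableTypeR R).
  by apply: measurable_funD => //; apply: measurable_funM.
pose m := mscale (NngNum (normr_ge0 a)) (image_measure leb mg).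
transitivity (\int[m]_x f x)%E; last first.
  apply: eq_measure_integral => A mA _.
  exact: lebesgue_measure_affine.
by rewrite /m ge0_integral_mscale// ge0_integral_image_measure.
Qed.

Lemma measurable_normal_pdf_restrict (m s : R) (B : set R) : measurable B ->
  measurable_fun [set: R] ((fun x : R => (normal_pdf m s x)%:E) \_ B).
Proof.
move=> mB; apply/(measurable_restrictT _ mB)/measurable_EFinP/measurable_funTS.
exact: measurable_normal_pdf.
Qed.

Lemma normal_prob_affine (m s : R) (B : set R) : 0 < s -> measurable B ->
  normal_prob m s B = normal_prob 0 1 ((fun x => m + s * x) @^-1` B).
Proof.
move=> s0 mB; rewrite /normal_prob [LHS]integral_mkcond [RHS]integral_mkcond.
rewrite -[LHS](@ge0_integral_affine s m)//=; first last.
- by move=> x; apply: erestrict_ge0 => y _; rewrite lee_fin normal_pdf_ge0.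
- exact: measurable_normal_pdf_restrict.
- by rewrite gt_eqF.
rewrite -ge0_integralZl//=; first last.
- by move=> x _; apply: erestrict_ge0 => y _; rewrite lee_fin normal_pdf_ge0.
- apply: measurableT_comp => //; last first.
    by apply: measurable_funD => //; apply: measurable_funM.
  exact: measurable_normal_pdf_restrict.
apply: eq_integral => x _; rewrite !patchE.
have -> : (x \in (fun x : R => m + s * x) @^-1` B) = (s * x + m \in B).
  by apply/idP/idP; rewrite !inE/= addrC.
case: ifPn => _; last by rewrite mule0.
rewrite -EFinM !normal_pdfE ?gt_eqF ?oner_eq0// /normal_peak /normal_fun.
rewrite gtr0_norm// addrK subr0 expr1n mul1r -mulrnAr sqrtrM ?sqr_ge0// sqrtr_sqr gtr0_norm//.
rewrite invfM !mulrA mulfV ?gt_eqF// mul1r; congr (_ * expR _)%:E.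
by rewrite exprMn; field; rewrite gt_eqF.
Qed.

Lemma normal_prob_opp (B : set R) : measurable B ->
  normal_prob 0 1 (-%R @^-1` B) = normal_prob 0 1 B.
Proof.
move=> mB; rewrite /normal_prob [LHS]integral_mkcond [RHS]integral_mkcond.
rewrite -[RHS](@ge0_integral_affine (-1) 0)//=; first last.
- by move=> x; apply: erestrict_ge0 => y _; rewrite lee_fin normal_pdf_ge0.
- exact: measurable_normal_pdf_restrict.
rewrite normrN1 mul1e; apply: eq_integral => x _; rewrite !patchE addr0 mulN1r.
have -> : (x \in -%R @^-1` B) = (- x \in B) by apply/idP/idP; rewrite !inE.
case: ifPn => // _; rewrite !normal_pdfE ?oner_eq0// /normal_fun.
by rewrite !subr0 sqrrN.
Qed.

(** The Radon-Nikodym derivative of the normal law and the normal density have the same integrals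
    over measurable sets, hence agree almost everywhere. *)
Lemma integral_normal_prob (m s : R) (f : R -> \bar R) :
  measurable_fun setT f ->
  (\int[normal_prob m s]_x `|f x| < +oo)%E ->
  (\int[normal_prob m s]_x f x
   = \int[leb]_x (f x * (normal_pdf m s x)%:E))%E.
Proof.
move=> mf finf.
have dom := @normal_prob_dominates R m s.
rewrite -(Radon_Nikodym_change_of_variables dom)//=; last exact/integrableP.
have mpdf : measurable_fun setT (fun x => (normal_pdf m s x)%:E).
  by apply/measurable_EFinP; exact: measurable_normal_pdf.
apply: ae_eq_integral => //.
- exact: emeasurable_funM.
- exact: emeasurable_funM.
- apply: ae_eqe_mul2l => /=; rewrite Radon_NikodymE//=.
  case: cid => /= h [h1 h2 h3]; apply: integral_ae_eq => //= E E01 mE.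
  by rewrite -h3.
Qed.

Lemma measurable_shear1 (k : R) (f : R * R -> \bar R) : measurable_fun setT f ->
  measurable_fun setT (fun z : R * R => f (z.1, z.2 + k * z.1)%R).
Proof.
move=> mf; apply: measurableT_comp => //; apply: measurable_fun_pair => //.
by apply: measurable_funD => //; exact: measurable_funM.
Qed.

Lemma measurable_shear2 (k : R) (f : R * R -> \bar R) : measurable_fun setT f ->
  measurable_fun setT (fun z : R * R => f (z.1 + k * z.2, z.2)%R).
Proof.
move=> mf; apply: measurableT_comp => //; apply: measurable_fun_pair => //.
by apply: measurable_funD => //; exact: measurable_funM.
Qed.

Lemma shear1 (k : R) (f : R * R -> \bar R) : measurable_fun setT f ->
  (forall z, 0 <= f z)%E ->
  (\int[leb]_x \int[leb]_y f (x, y + k * x)%R = \int[leb]_x \int[leb]_y f (x, y))%E.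
Proof.
move=> mf f0; apply: eq_integral => x _.
rewrite -[RHS](@ge0_integral_affine 1 (k * x))//=; last exact/measurableT_comp.
rewrite normr1 mul1e; apply: eq_integral => ? _; rewrite mul1r//.
Qed.

Lemma shear2 (k : R) (f : R * R -> \bar R) : measurable_fun setT f ->
  (forall z, 0 <= f z)%E ->
  (\int[leb]_x \int[leb]_y f (x + k * y, y)%R = \int[leb]_x \int[leb]_y f (x, y))%E.
Proof.
move=> mf f0.
apply: etrans.
  exact: (fubini_tonelli (m1 := leb) (m2 := leb) _
    (measurable_shear2 k mf) (fun z => f0 _)).
apply: etrans; last exact/esym/(fubini_tonelli (m1 := leb) (m2 := leb) f mf f0).
apply: eq_integral => y _.
rewrite -[RHS](@ge0_integral_affine 1 (k * y))//=; last exact/measurableT_comp.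
rewrite normr1 mul1e; apply: eq_integral => ? _; rewrite mul1r//.
Qed.

(* A rotation other than the identity and the half turn is a product of three
   shears. *)
Lemma ge0_integral_rotation (c s : R) (f : R * R -> \bar R) :
  s != 0 -> c ^+ 2 + s ^+ 2 = 1 -> measurable_fun setT f ->
  (forall z, 0 <= f z)%E ->
  (\int[leb]_x \int[leb]_y f (c * x + s * y, - s * x + c * y)%R
   = \int[leb]_x \int[leb]_y f (x, y))%E.
Proof.
(* If c and s are the cosine and sine of an angle, k is the tangent of half of it; the shears with
   coefficients k, - s and k compose to the rotation. *)
move=> s0 cs mf f0; pose k := (1 - c) / s.
have mf2 := measurable_shear2 k mf; have mf1 := measurable_shear1 (- s) mf2.
apply: etrans; last exact: (shear2 k mf f0).
apply: etrans; last exact: (shear1 (- s) mf2 (fun z => f0 _)).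
apply: etrans; last exact: (shear2 k mf1 (fun z => f0 _)).
have s2 : s * s = 1 - c ^+ 2 by rewrite -expr2 -cs addrAC subrr add0r.
apply: eq_integral => x _; apply: eq_integral => y _; congr f.
have y1 : y + - s * (x + k * y) = - s * x + c * y by rewrite /k; field.
rewrite y1; congr pair; rewrite /k; apply: (mulIf s0).
have -> : (x + (1 - c) / s * y + (1 - c) / s * (- s * x + c * y)) * s
  = c * x * s + (1 - c ^+ 2) * y by field.
by rewrite -s2; ring.
Qed.

End gaussian_plane.

Section gaussian_families.
Context {R : realType}.
Local Notation gamma := (normal_prob (0 : R) 1).

Lemma measurable_forall d (T : measurableType d) (I : finType) (A : I -> set T) :
  (forall i, measurable (A i)) -> measurable [set t | forall i, A i t].
Proof.
move=> mA; rewrite (_ : [set _ | _] = \bigcap_(i in setT) A i).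
  by apply: fin_bigcap_measurable => // i _; exact: mA.
by apply/seteqP; split=> t /= h => [i _|i]; exact: h.
Qed.

Lemma measurable_preimage d d' (T : measurableType d) (T' : measurableType d')
    (f : T -> T') (B : set T') :
  measurable_fun setT f -> measurable B -> measurable (f @^-1` B).
Proof. by move=> mf mB; rewrite -[X in measurable X]setTI; exact: mf. Qed.

(** Stated for plain functions, so that families built pointwise from others fit. The values on
    boxes determine the whole joint law ([law_unique_set]). *)
Definition std_normal_family d (T : measurableType d) (P : probability T R)
    (I : finType) (V : I -> T -> R) : Prop :=
  (forall i, measurable_fun setT (V i)) /\
  forall B : I -> set R, (forall i, measurable (B i)) ->
    P [set t | forall i, B i (V i t)] = (\prod_i gamma (B i))%E.

(** The product density depends on x^2 + y^2 alone, and plane Lebesgue measure is invariant under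
    the rotation. *)
Lemma gauss_plane_rotation (c s : R) (S : set (R * R)) :
  s != 0 -> c ^+ 2 + s ^+ 2 = 1 -> measurable S ->
  (gamma \x gamma)%E [set z | S (c * z.1 + s * z.2, - s * z.1 + c * z.2)]
  = (gamma \x gamma)%E S.
Proof.
move=> s0 cs mS.
have mpdf : measurable_fun setT (normal_pdf (0 : R) 1) := measurable_normal_pdf _ _.
pose p (z : R * R) := (normal_pdf 0 1 z.1 * normal_pdf 0 1 z.2 : R).
have p0 z : 0 <= p z by rewrite mulr_ge0 ?normal_pdf_ge0.
have mp : measurable_fun setT p.
  by apply: measurable_funM; apply: measurableT_comp mpdf _.
have density (S' : set (R * R)) : measurable S' -> (gamma \x gamma)%E S' =
    (\int[lebesgue_measure]_x \int[lebesgue_measure]_y (\1_S' (x, y) * p (x, y))%:E)%E.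
  move=> mS'; rewrite /product_measure1.
  rewrite integral_normal_prob; first last.
  - apply: (@le_lt_trans _ _ (\int[gamma]_x cst 1%E x)%E); last first.
      rewrite integral_cst// mul1e.
      by apply: (le_lt_trans (probability_le1 gamma measurableT)); exact: ltry.
    apply: ge0_le_integral => //=.
    + by apply: measurableT_comp => //; exact: measurable_fun_xsection.
    + move=> x _; rewrite gee0_abs; last exact: measure_ge0.
      by apply: probability_le1; exact: measurable_xsection.
  - exact: measurable_fun_xsection.
  apply: eq_integral => x _.
  rewrite {1}/normal_prob -ge0_integralZr//; last first.
  - by rewrite lee_fin normal_pdf_ge0.
  - by move=> y _; rewrite lee_fin normal_pdf_ge0.
  - by apply/measurable_EFinP/measurable_funTS.
  - exact: measurable_xsection.
  rewrite [LHS]integral_mkcond; apply: eq_integral => y _.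
  rewrite patchE indicE mem_xsection.
  by case: ifPn => _; rewrite ?mul0e ?mul0r// mul1r /p/= -EFinM mulrC.
have mrot : measurable_fun setT (fun z : R * R => (c * z.1 + s * z.2, - s * z.1 + c * z.2)).
  apply: measurable_fun_pair; apply: measurable_funD;
    by apply: measurable_funM => //.
rewrite (density _ mS) (density _ (measurable_preimage mrot mS)).
pose g z : \bar R := (\1_S z * p z)%:E.
have g0 z : (0 <= g z)%E by rewrite lee_fin mulr_ge0.
have mg : measurable_fun setT g.
  by apply/measurable_EFinP/measurable_funM => //; exact: measurable_indic.
apply: etrans; last exact: (ge0_integral_rotation s0 cs mg g0).
apply: eq_integral => x _; apply: eq_integral => y _; rewrite /g.
congr (_ * _)%:E.
rewrite /p/= !normal_pdfE ?oner_neq0// /normal_fun !subr0.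
rewrite mulrACA [RHS]mulrACA -!expRD; congr (_ * expR _).
rewrite -!mulrDl -!opprD; congr (- _ / _).
have -> : x ^+ 2 + y ^+ 2 = (c ^+ 2 + s ^+ 2) * (x ^+ 2 + y ^+ 2) by rewrite cs mul1r.
ring.
Qed.

Section givens.
Context d (T : measurableType d) (P : probability T R) (I : finType).
Implicit Types V : I -> T -> R.

Definition givens (i j : I) (c s : R) V : I -> T -> R := fun k t =>
  if k == i then c * V i t + s * V j t
  else if k == j then - s * V i t + c * V j t else V k t.

(** Fix the event D on the coordinates other than i and j. Restricted to D, the law of (V i, V j)
    agrees on rectangles with a constant C times the product of two standard normal laws, hence
    everywhere, and that product is invariant under the rotation. *)
Lemma std_normal_family_givens V (i j : I) (c s : R) :
  i != j -> s != 0 -> c ^+ 2 + s ^+ 2 = 1 ->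
  std_normal_family P V -> std_normal_family P (givens i j c s V).
Proof.
move=> ij s0 cs [mV VP]; split.
  move=> k; rewrite /givens; case: eqP => _; last case: eqP => _ //.
    by apply: measurable_funD; apply: measurable_funM.
  by apply: measurable_funD; apply: measurable_funM.
move=> B mB.
pose B0 k := if (k == i) || (k == j) then setT else B k.
have mB0 k : measurable (B0 k) by rewrite /B0; case: ifP.
pose D := [set t | forall k, B0 k (V k t)].
have mD : measurable D.
  by apply: measurable_forall => k; exact: measurable_preimage (mB0 k).
have mVV : measurable_fun setT
    (fun t => (V i t, V j t) : measurableTypeR R * measurableTypeR R).
  by apply: measurable_fun_pair; exact: mV.
pose m := image_measure (mrestr P mD) mVV.
pose C := (\prod_(k | (k != i) && (k != j)) gamma (B k))%E.
have C0 : (0 <= C)%E by apply: prode_ge0 => k _; exact: measure_ge0.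
have mE (X Y : set R) : measurable X -> measurable Y ->
    m (X `*` Y) = (C * (gamma X * gamma Y))%E.
  move=> mX mY.
  pose B1 k := if k == i then X else if k == j then Y else B k.
  have mB1 k : measurable (B1 k) by rewrite /B1; case: ifP => // _; case: ifP.
  transitivity (P [set t | forall k, B1 k (V k t)]).
    rewrite /m image_measureE /mrestr; congr (P _); apply/seteqP; split=> t /=.
      move=> [[Xt Yt] Dt] k; have := Dt k; rewrite /B0 /B1.
      by case: eqP => [->//|_]; case: eqP => [->//|_].
    move=> B1t; split; first split.
    - by have := B1t i; rewrite /B1 eqxx.
    - by have := B1t j; rewrite /B1 eqxx eq_sym (negbTE ij).
    - move=> k; have := B1t k; rewrite /B0 /B1.
      by case: eqP => //= _; case: eqP.
  rewrite VP// (bigD1 i)//= (bigD1 j)/= 1?eq_sym//.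
  rewrite /B1 !eqxx eq_sym (negbTE ij) muleA [RHS]muleC; congr (_ * _)%E.
  rewrite /C; apply: eq_bigr => k /andP[/negbTE ki /negbTE kj].
  by rewrite ki kj.
have CE : C = (fine C)%:E.
  rewrite fineK// ge0_fin_numE//.
  apply: (@le_lt_trans _ _ 1%E); last exact: ltry.
  have := mE setT setT measurableT measurableT.
  rewrite !probability_setT !mule1 => <-.
  rewrite /m image_measureE /mrestr setXTT preimage_setT.
  exact: (probability_le1 P (measurableI _ _ measurableT mD)).
have mprod S : measurable S -> m S = (C * (gamma \x gamma) S)%E.
  (* Uniqueness of the product measure is applied to m / C; for C = 0 both sides vanish. *)
  move=> mS; have [C00|Cneq0] := eqVneq C 0%E.
    rewrite C00 mul0e; apply/eqP; rewrite eq_le measure_ge0 andbT.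
    have <- : m setT = 0%E.
      by rewrite -setXTT mE// !probability_setT C00 mul0e.
    by apply: le_measure; rewrite ?inE.
  have fC0 : 0 < fine C by rewrite -lte_fin -CE lt_neqAle eq_sym Cneq0.
  have fCi0 : 0 <= (fine C)^-1 by rewrite invr_ge0 ltW.
  pose m' := mscale (NngNum fCi0) m.
  have -> : ((gamma \x gamma) S = (fine C)^-1%:E * m S)%E.
    apply: (@product_measure_unique _ _ _ _ _ gamma gamma m') mS => X Y mX mY.
    transitivity ((fine C)^-1%:E * m (X `*` Y))%E; first by [].
    by rewrite mE// CE muleA -EFinM mulVf ?mul1e// gt_eqF.
  by rewrite CE muleA -EFinM mulfV ?mul1e// gt_eqF.
pose S := [set z : R * R | (B i `*` B j) (c * z.1 + s * z.2, - s * z.1 + c * z.2)].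
have mBij : measurable (B i `*` B j) by exact: measurableX.
have mS : measurable S.
  have mrot : measurable_fun setT (fun z : R * R => (c * z.1 + s * z.2, - s * z.1 + c * z.2)).
    apply: measurable_fun_pair; apply: measurable_funD;
      by apply: measurable_funM => //.
  exact: measurable_preimage mrot mBij.
transitivity (m S).
  rewrite /m image_measureE /mrestr; congr (P _); apply/seteqP; split=> t /=.
    move=> Bt; split; first split.
    - by have := Bt i; rewrite /givens eqxx.
    - by have := Bt j; rewrite /givens eqxx eq_sym (negbTE ij).
    - by move=> k; have := Bt k; rewrite /givens /B0; case: eqP => // _; case: eqP.
  move=> [[Bi Bj] Dt] k; rewrite /givens; have := Dt k; rewrite /B0.
  by case: eqP => [->//|_]; case: eqP => [->//|_].
rewrite mprod// gauss_plane_rotation// product_measure1E; [|exact: mB|exact: mB].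
by rewrite [RHS](bigD1 i)//= (bigD1 j)/= 1?eq_sym// muleC muleA.
Qed.

Lemma std_normal_family_flip V (i : I) : std_normal_family P V ->
  std_normal_family P (fun k t => if k == i then - V i t else V k t).
Proof.
move=> [mV VP]; split.
  by move=> k; case: eqP => _ //; exact: measurableT_comp.
move=> B mB; pose B1 k := if k == i then -%R @^-1` B i else B k.
have mB1 k : measurable (B1 k).
  by rewrite /B1; case: ifP => _ //; exact: measurable_preimage.
transitivity (P [set t | forall k, B1 k (V k t)]).
  congr (P _); apply/seteqP; split=> t /= Bt k; have := Bt k; rewrite /B1.
    by case: eqP => // ->.
  by case: eqP => // ->.
rewrite VP//; apply: eq_bigr => k _; rewrite /B1; case: eqP => // ->.
exact: normal_prob_opp.
Qed.

Lemma std_normal_family_sub (J : finType) (f : J -> I) V : injective f ->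
  std_normal_family P V -> std_normal_family P (fun j => V (f j)).
Proof.
move=> finj [mV VP]; split=> [j|B mB]; first exact: mV.
(* This is [B j] at the index f j and, vacuously, the whole line outside the image of f. *)
pose B1 i := [set x | forall j, f j = i -> B j x].
have B1f j : B1 (f j) = B j.
  by apply/seteqP; split=> x /= => [/(_ j erefl)//|Bjx j' /finj ->].
have B1n i : i \notin codom f -> B1 i = setT.
  move=> nif; apply/seteqP; split=> x //= _ j fji.
  by move: nif; rewrite -fji codom_f.
have mB1 i : measurable (B1 i).
  have [/codomP[j ->]|/B1n -> //] := boolP (i \in codom f).
  by rewrite B1f.
transitivity (P [set t | forall i, B1 i (V i t)]).
  congr (P _); apply/seteqP; split=> t /= Bt.
    by move=> i j <-; exact: Bt.
  by move=> j; rewrite -B1f; exact: Bt.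
rewrite VP// (bigID (mem (f @: [set: J]%SET)))/= [X in (_ * X)%E]big1 ?mule1; last first.
  move=> i fi; rewrite B1n; first exact: probability_setT.
  by apply: contra fi => /codomP[j ->]; rewrite imset_f.
rewrite big_imset/=; last by move=> ? ? _ _; exact: finj.
by apply: eq_big => [j|j _]; rewrite ?inE// B1f.
Qed.

End givens.

Lemma sum_eq2 (I : finType) (i j : I) (F G : I -> R) : i != j ->
  F i + F j = G i + G j -> (forall k, k != i -> k != j -> F k = G k) ->
  \sum_k F k = \sum_k G k.
Proof.
move=> ij FGij FG; have ji : j != i by rewrite eq_sym.
rewrite (bigD1 i)//= (bigD1 j)//= [RHS](bigD1 i)//= [in RHS](bigD1 j)//= !addrA.
by rewrite FGij; congr (_ + _); apply: eq_bigr => k /andP[]; exact: FG.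
Qed.

Section orthonormal_rows.
Context d (T : measurableType d) (P : probability T R) (l k : nat).
Implicit Types (O : 'M[R]_(l, k)) (V : 'I_k -> T -> R).

Lemma orthonormal_rowE O : O *m O^T = 1%:M ->
  forall p p', \sum_x O p x * O p' x = (p == p')%:R.
Proof.
move=> /matrixP OO p p'; have := OO p p'; rewrite !mxE => <-.
by apply: eq_bigr => x _; rewrite mxE.
Qed.

(** The rows of index less than n are unit vectors, so orthogonality clears row n to the left of the
    diagonal. Each plane rotation kills one entry to the right, by induction on the number of
    nonzero ones; the remaining diagonal entry is 1 or -1, and a sign change turns -1 into 1. The
    columns of O and the variables V are rotated together, which keeps the sums. *)
Lemma orthonormal_step (n : 'I_l) O V :
  O *m O^T = 1%:M -> std_normal_family P V ->
  (forall (i : 'I_l) (j : 'I_k), (i < n)%N -> O i j = (i == j :> nat)%:R) ->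
  exists O' V', [/\ O' *m O'^T = 1%:M, std_normal_family P V',
    forall (i : 'I_l) (j : 'I_k), (i <= n)%N -> O' i j = (i == j :> nat)%:R &
    forall i t, \sum_j O i j * V j t = \sum_j O' i j * V' j t].
Proof.
move: O V; have nk O : O *m O^T = 1%:M ->
    (forall (i : 'I_l) (j : 'I_k), (i < n)%N -> O i j = (i == j :> nat)%:R) ->
    (forall j : 'I_k, (j < n)%N -> O n j = 0).
  move=> /orthonormal_rowE OO On j jn.
  have jl : (j < l)%N := ltn_trans jn (ltn_ord n).
  have := OO n (Ordinal jl); rewrite -val_eqE/= gtn_eqF// => Enj; rewrite -[RHS]/(false%:R : R) -Enj.
  rewrite (bigD1 j)//= (On (Ordinal jl))//= eqxx mulr1 big1 ?addr0// => x xj.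
  by rewrite (On (Ordinal jl))//= eq_sym val_eqE (negbTE xj) mulr0.
move=> O V; have [N] := ubnP #|[pred j : 'I_k | (n < j)%N && (O n j != 0)]|.
elim: N O V => // N IH O V cardN OO Vstd On.
have nltk : (n < k)%N.
  rewrite ltnNge; apply/negP => kn.
  have := orthonormal_rowE OO n n; rewrite eqxx big1 => [/eqP|x _].
    by rewrite eq_sym oner_eq0.
  by rewrite (nk O)// ?mul0r//; exact: leq_trans (ltn_ord x) kn.
pose n' : 'I_k := Ordinal nltk.
have [[j]|] := altP (@existsP _ (fun j : 'I_k => (n < j)%N && (O n j != 0))).
  move=> /andP[nj Onj].
  have n'j : n' != j by rewrite -val_eqE/= ltn_eqF.
  pose a := O n n'; pose b := O n j; pose r := Num.sqrt (a ^+ 2 + b ^+ 2).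
  have r2 : r ^+ 2 = a ^+ 2 + b ^+ 2 by rewrite sqr_sqrtr// addr_ge0 ?sqr_ge0.
  have r0 : r != 0.
    apply: contra_neq Onj => r0; apply/eqP; rewrite -sqrf_eq0.
    by move/eqP: r2; rewrite r0 expr0n eq_sym paddr_eq0 ?sqr_ge0// => /andP[].
  (* This rotation moves the norm r of (a, b) into the diagonal and leaves 0 in column j. As b is
     nonzero, so is s, as the decomposition into shears demands. *)
  pose c := a / r; pose s := b / r.
  have cs : c ^+ 2 + s ^+ 2 = 1.
    by rewrite /c /s !expr_div_n -mulrDl -r2 mulfV// sqrf_eq0.
  have s0 : s != 0 by rewrite mulf_neq0// invr_eq0.
  pose O' : 'M[R]_(l, k) := \matrix_(p, x)
    if x == n' then c * O p n' + s * O p j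
    else if x == j then - s * O p n' + c * O p j else O p x.
  have jn' : (j == n') = false by rewrite eq_sym (negbTE n'j).
  have Ostable (i : 'I_l) x : (i < n)%N -> O' i x = O i x.
    move=> ilt; rewrite mxE !On//= (ltn_eqF ilt) (ltn_eqF (ltn_trans ilt nj)).
    rewrite !mulr0 addr0; case: eqP => [->|_]; first by rewrite /= (ltn_eqF ilt).
    by case: eqP => // ->; rewrite (ltn_eqF (ltn_trans ilt nj)).
  have [] := IH O' (givens n' j c s V).
  - rewrite -ltnS; apply: leq_trans cardN; rewrite ltnS; apply: proper_card.
    apply/properP; split.
      apply/fintype.subsetP => x; rewrite !inE mxE => /andP[nx]; rewrite nx/=.
      have /negbTE -> : x != n' by rewrite -val_eqE/= gtn_eqF.
      by have [->|//] := eqVneq x j; rewrite Onj.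
    exists j; rewrite !inE ?nj//= mxE jn' eqxx negbK /c /s -/a -/b.
    by apply/eqP; ring.
  - apply/matrixP => p p'; rewrite -[1%:M]OO !mxE.
    apply: (sum_eq2 n'j) => [|x /negbTE xn /negbTE xj]; last first.
      by rewrite !mxE xn xj.
    rewrite !mxE !eqxx jn'.
    transitivity ((c ^+ 2 + s ^+ 2) * (O p n' * O p' n' + O p j * O p' j)); first by ring.
    by rewrite cs mul1r.
  - exact: std_normal_family_givens.
  - by move=> i x ilt; rewrite Ostable// On.
  move=> O1 [V1 [? ? ? VE]]; exists O1, V1; split=> // i t.
  rewrite -VE; apply: (sum_eq2 n'j) => [|x /negbTE xn /negbTE xj]; last first.
    by rewrite mxE /givens xn xj.
  rewrite !mxE /givens !eqxx jn'.
  transitivity ((c ^+ 2 + s ^+ 2) * (O i n' * V n' t + O i j * V j t)); last by ring.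
  by rewrite cs mul1r.
rewrite negb_exists => /forallP Onull.
have Onz (x : 'I_k) : x != n' -> O n x = 0.
  rewrite -val_eqE/= neq_ltn => /orP[xn|nx]; first exact: (nk O).
  by apply/eqP; have := Onull x; rewrite nx/= negbK.
have /eqP : O n n' ^+ 2 = 1.
  have := orthonormal_rowE OO n n; rewrite eqxx (bigD1 n')//= big1 ?addr0// => x xn.
  by rewrite Onz// mul0r.
rewrite sqrf_eq1 => /orP[/eqP O1|/eqP O1].
  exists O, V; split=> // i x; rewrite leq_eqVlt => /orP[/eqP/val_inj ->|]; last exact: On.
  have [->|xn] := eqVneq x n'; first by rewrite O1 eqxx.
  by rewrite Onz// (_ : _ == _ = false)//; apply/negbTE; rewrite eq_sym -(inj_eq val_inj) in xn.
exists (\matrix_(p, x) if x == n' then - O p n' else O p x).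
exists (fun x t => if x == n' then - V n' t else V x t); split.
- apply/matrixP => p p'; rewrite -[1%:M]OO !mxE; apply: eq_bigr => x _.
  by rewrite !mxE; case: eqP => [->|//]; rewrite mulrNN.
- exact: std_normal_family_flip.
- move=> i x; rewrite mxE leq_eqVlt => /orP[/eqP/val_inj ->|ilt].
    case: eqP => [->|/eqP xn]; first by rewrite O1 opprK eqxx.
    by rewrite Onz// (_ : _ == _ = false)//; apply/negbTE; rewrite eq_sym -(inj_eq val_inj) in xn.
  rewrite !On//; case: eqP => // -> /=.
  by rewrite (ltn_eqF ilt) oppr0.
- move=> i t; apply: eq_bigr => x _; rewrite mxE; case: eqP => // ->.
  by rewrite mulrNN.
Qed.

(* Plane rotations reduce the rows one after the other to unit vectors. *)
Lemma std_normal_family_orthonormal O V :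
  O *m O^T = 1%:M -> std_normal_family P V ->
  std_normal_family P (fun i t => \sum_j O i j * V j t).
Proof.
move=> OO Vstd.
have step n : (n <= l)%N -> exists Of Vf,
    [/\ Of *m Of^T = 1%:M, std_normal_family P Vf,
    forall (i : 'I_l) (j : 'I_k), (i < n)%N -> Of i j = (i == j :> nat)%:R &
    forall i t, \sum_j O i j * V j t = \sum_j Of i j * Vf j t].
  elim: n => [|n IH] nl; first by exists O, V.
  have [ O1 [V1 [ OO1 V1std O1E VE1]]] := IH (ltnW nl).
  have := @orthonormal_step (Ordinal nl) _ _ OO1 V1std O1E.
  move=> [ O3 [V3 [ OO3 V3std O3E VE2]]].
  by exists O3, V3; split=> // i t; rewrite VE1.
have [ Of [Vf [ OOf Vfstd OfE VE]]] := step l (leqnn l).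
(* Otherwise row k of the reduced matrix would be the unit vector of a column that does not exist,
   that is, zero. *)
have kl : (l <= k)%N.
  rewrite leqNgt; apply/negP => kl.
  have := orthonormal_rowE OOf (Ordinal kl) (Ordinal kl).
  rewrite eqxx big1 => [/eqP|x _]; first by rewrite eq_sym oner_eq0.
  by rewrite OfE//= gtn_eqF// mul0r.
rewrite [X in std_normal_family _ X](_ : _ = fun i => Vf (widen_ord kl i)).
  apply: std_normal_family_sub => // i j /(congr1 val)/= ij; exact/val_inj.
apply/funext => i; apply/funext => t; rewrite VE (bigD1 (widen_ord kl i))//=.
rewrite OfE//= eqxx mul1r big1 ?addr0// => j ji.
rewrite OfE// (_ : _ == _ = false) ?mul0r//.
by apply/negbTE; rewrite eq_sym -(inj_eq val_inj)/= in ji.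
Qed.

End orthonormal_rows.
End gaussian_families.

(** * Laws of finite families and random orthogonal transformations *)

Section laws.
Context {R : realType}.
Local Notation gamma := (normal_prob (0 : R) 1).

Section law_uniqueness.
Context {I : finType}.

(** Functions on a finite type are read off tuples, which carry the product sigma-algebra. A set S
    or a function f of families is measurable when its composite with [untuple] is. *)
Definition untuple (tau : #|I|.-tuple R) : I -> R :=
  fun i => tnth tau (enum_rank i).

Definition family_tuple (T : Type) (V : I -> T -> R) (t : T) : #|I|.-tuple R :=
  [tuple V (enum_val i) t | i < #|I|].

Lemma family_tupleK (T : Type) (V : I -> T -> R) t :
  untuple (family_tuple V t) = V^~ t.
Proof.
by apply/funext => i; rewrite /untuple tnth_mktuple enum_rankK.
Qed.

Lemma preimage_family_tuple (T : Type) (V : I -> T -> R) (S : set (I -> R)) :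
  family_tuple V @^-1` [set tau | S (untuple tau)] = [set t | S (V^~ t)].
Proof. by apply/seteqP; split=> t /=; rewrite family_tupleK. Qed.

Lemma measurable_family_tuple d (T : measurableType d) (V : I -> T -> R) :
  (forall i, measurable_fun setT (V i)) ->
  measurable_fun setT (family_tuple V).
Proof.
move=> mV; apply/measurable_fun_tnthP => i.
rewrite (_ : _ \o _ = V (enum_val i))//; apply/funext => t /=.
by rewrite tnth_mktuple.
Qed.

Definition boxes : set (set (#|I|.-tuple R)) :=
  [set A | exists2 B : I -> set R, forall i, measurable (B i) &
     A = [set tau | forall i, B i (untuple tau i)]].

Lemma measurable_untuple i : measurable_fun setT (untuple^~ i).
Proof. exact: measurable_tnth. Qed.

Lemma measurable_boxes : measurable = <<s boxes >>.
Proof.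
apply/seteqP; split.
  apply: smallest_sub; first exact: smallest_sigma_algebra.
  rewrite -bigcup_seq => A [/= i _ [B mB <-{A}]].
  apply: sub_sigma_algebra.
  exists (fun k => if k == enum_val i then B else setT).
    by move=> k; case: ifP.
  rewrite setTI; apply/seteqP; split=> tau /=.
    by move=> Btau k; case: eqP => // ->; rewrite /untuple enum_valK.
  by move=> /(_ (enum_val i)); rewrite eqxx /untuple enum_valK.
apply: smallest_sub; first exact: sigma_algebra_measurable.
move=> _ [B mB ->]; apply: measurable_forall => i.
exact: measurable_preimage (measurable_untuple i) (mB i).
Qed.

Lemma measurable_family_comp d (T : measurableType d) (V : I -> T -> R)
    (f : (I -> R) -> R) : (forall i, measurable_fun setT (V i)) ->
  measurable_fun setT (fun tau => f (untuple tau)) ->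
  measurable_fun setT (fun t => f (V^~ t)).
Proof.
move=> mV mf.
rewrite (_ : (fun t => _) = (fun tau => f (untuple tau)) \o family_tuple V).
  by apply: measurableT_comp mf _; exact: measurable_family_tuple.
by apply/funext => t /=; rewrite family_tupleK.
Qed.

Lemma integral_family_tuple d (T : measurableType d) (P : {measure set T -> \bar R})
    (V : I -> T -> R) (mV : forall i, measurable_fun setT (V i))
    (f : (I -> R) -> R) (M : R) :
  measurable_fun setT (fun tau => f (untuple tau)) ->
  (forall v, `|f v| <= M) -> (P setT < +oo)%E ->
  (\int[P]_t (f (V^~ t))%:E
   = \int[image_measure P (measurable_family_tuple mV)]_tau (f (untuple tau))%:E)%E.
Proof.
move=> mf fM Pfin; have mfV := measurable_family_comp mV mf.
have fVE t : f (untuple (family_tuple V t)) = f (V^~ t) by rewrite family_tupleK.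
have intf : P.-integrable setT (EFin \o (fun t => f (V^~ t))).
  apply/integrableP; split; first exact/measurable_EFinP.
  apply: (@le_lt_trans _ _ (\int[P]_t (cst M%:E t))%E).
    apply: ge0_le_integral => //=.
    - by apply/measurable_EFinP; exact: (measurableT_comp (@normr_measurable R setT) mfV).
    - by move=> t _; rewrite lee_fin.
  rewrite integral_cst//; have /fineK <- : P setT \is a fin_num by rewrite ge0_fin_numE.
  by rewrite -EFinM ltry.
apply/esym; apply: etrans.
  apply: (@integral_pushforward _ _ _ _ _ _ (measurable_family_tuple mV) P setT
    (fun tau => (f (untuple tau))%:E)) => //.
  - exact/measurable_EFinP.
  - rewrite preimage_setT (_ : _ \o _ = EFin \o (fun t => f (V^~ t)))//.
    by apply/funext => t /=; rewrite fVE.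
by apply: eq_integral => t _; rewrite /= fVE.
Qed.

Context d d' (T : measurableType d) (T' : measurableType d').
Variables (P : {measure set T -> \bar R}) (P' : {measure set T' -> \bar R}).
Variables (V : I -> T -> R) (V' : I -> T' -> R).
Hypotheses (mV : forall i, measurable_fun setT (V i))
  (mV' : forall i, measurable_fun setT (V' i)) (Pfin : (P setT < +oo)%E).
Hypothesis boxE : forall B : I -> set R, (forall i, measurable (B i)) ->
  P [set t | forall i, B i (V i t)] = P' [set t | forall i, B i (V' i t)].

Let m := image_measure P (measurable_family_tuple mV).
Let m' := image_measure P' (measurable_family_tuple mV').

(** Boxes are stable under intersection, contain the whole space and generate the sigma-algebra;
    finite measures that agree on them coincide. *)
Lemma law_unique_tuple A : measurable A -> m A = m' A.
Proof.
apply: (measure_unique boxes (fun=> setT)).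
- exact: measurable_boxes.
- move=> _ _ [B mB ->] [C mC ->]; exists (fun i => B i `&` C i).
    by move=> i; exact: measurableI.
  apply/seteqP; split=> tau /= => [[Bt Ct] i|BC]; first by split.
  by split=> i; have [] := BC i.
- by move=> _; exists (fun=> setT) => //; apply/seteqP; split.
- by apply/seteqP; split=> // tau _; exists 0%N.
- move=> _ [B mB ->].
  change (P (family_tuple V @^-1` [set tau | forall i, B i (untuple tau i)]) =
          P' (family_tuple V' @^-1` [set tau | forall i, B i (untuple tau i)])).
  by rewrite !(preimage_family_tuple _ (fun v => forall i, B i (v i))) (boxE mB).
- by move=> _; change (P (family_tuple V @^-1` setT) < +oo)%E; rewrite preimage_setT.
Qed.

Lemma law_unique_set (S : set (I -> R)) : measurable [set tau | S (untuple tau)] ->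
  P [set t | S (V^~ t)] = P' [set t | S (V'^~ t)].
Proof.
move=> mS; have : P (family_tuple V @^-1` [set tau | S (untuple tau)]) =
  P' (family_tuple V' @^-1` [set tau | S (untuple tau)]) := law_unique_tuple mS.
by rewrite !preimage_family_tuple.
Qed.

Lemma law_unique_integral (f : (I -> R) -> R) :
  measurable_fun setT (fun tau => f (untuple tau)) ->
  (exists M, forall v, `|f v| <= M) ->
  (\int[P]_t (f (V^~ t))%:E = \int[P']_t (f (V'^~ t))%:E)%E.
Proof.
move=> mf [M fM].
have Pfin' : (P' setT < +oo)%E.
  have := law_unique_set (S := setT) measurableT.
  by rewrite (_ : [set t | _] = setT)// (_ : [set t | _] = setT)// => <-.
rewrite (integral_family_tuple mV mf fM Pfin) (integral_family_tuple mV' mf fM Pfin').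
by apply: eq_measure_integral => A mA _; exact: law_unique_tuple.
Qed.

End law_uniqueness.

End laws.

Section gaussian_transfer.
Context {R : realType}.
Local Notation gamma := (normal_prob (0 : R) 1).

Lemma std_normal_family_orth d (T : measurableType d) (P : probability T R)
    (L K : finType) (O : L -> K -> R) (V : K -> T -> R) :
  (forall i i', \sum_x O i x * O i' x = (i == i')%:R) ->
  std_normal_family P V ->
  std_normal_family P (fun i t => \sum_x O i x * V x t).
Proof.
move=> OO Vstd.
pose A : 'M[R]_(#|L|, #|K|) := \matrix_(i, j) O (enum_val i) (enum_val j).
have AA : A *m A^T = 1%:M.
  apply/matrixP => i j; rewrite !mxE -(inj_eq enum_val_inj) -OO.
  rewrite (reindex (@enum_val K predT))/=; last first.
    by apply: onW_bij; exact: enum_val_bij.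
  by apply: eq_bigr => x _; rewrite !mxE.
have := std_normal_family_orthonormal AA (std_normal_family_sub enum_val_inj Vstd).
move=> /(std_normal_family_sub (@enum_rank_inj L)).
congr (std_normal_family _ _); apply/funext => i; apply/funext => t.
rewrite [RHS](reindex (@enum_val K predT))/=; last first.
  by apply: onW_bij; exact: enum_val_bij.
by apply: eq_bigr => x _; rewrite mxE enum_rankK.
Qed.

Lemma std_normal_family_standardize d (T : measurableType d)
    (P : probability T R) (I : finType) (X : I -> {RV P >-> R}) (mu s : I -> R) :
  (forall i, 0 < s i) -> (forall i, has_normal_law (X i) (mu i) (s i)) ->
  mutually_independent P (fun i => X i : T -> R) ->
  std_normal_family P (fun i t => (X i t - mu i) / s i).
Proof.
move=> s0 Xlaw Xind; split.
  move=> i; apply: measurable_funM => //; apply: measurable_funB => //.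
move=> B mB; pose B1 i := [set x | B i ((x - mu i) / s i)].
have mB1 i : measurable (B1 i).
  apply: (@measurable_preimage _ _ _ _ (fun x : R => (x - mu i) / s i)) => //.
  by apply: measurable_funM => //; apply: measurable_funB.
transitivity (P [set t | forall i, B1 i (X i t)]); first by [].
rewrite (Xind _ mB1); apply: eq_bigr => i _.
have := Xlaw i (B1 i) (mB1 i); rewrite /distribution/= /pushforward => ->.
rewrite normal_prob_affine//; congr (normal_prob _ _ _).
apply/seteqP; split=> x; rewrite /B1/= addrC addKr mulrAC mulfV ?mul1r//;
  by rewrite gt_eqF.
Qed.

(* Replaying the second block of coordinates on an independent copy of the
   sample space does not change the law. *)
Lemma std_normal_family_decouple d (T : measurableType d) (P : probability T R)
    (I J : finType) (V : I + J -> T -> R) (S : set (I + J -> R)) :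
  std_normal_family P V -> measurable [set tau | S (untuple tau)] ->
  let F t := P [set t' | S (fun k => match k with
       | inl i => V (inl i) t | inr j => V (inr j) t' end)] in
  measurable_fun setT F /\ (P [set t | S (V^~ t)] = \int[P]_t F t)%E.
Proof.
move=> Vstd mS F; have [mV VP] := Vstd.
pose V' (k : I + J) (z : T * T) :=
  match k with inl i => V (inl i) z.1 | inr j => V (inr j) z.2 end.
have mV' k : measurable_fun setT (V' k).
  by case: k => k; exact: measurableT_comp.
pose X := [set z : T * T | S (V'^~ z)].
have mX : measurable X.
  rewrite /X -preimage_family_tuple.
  exact: measurable_preimage (measurable_family_tuple mV') mS.
have FE : F = P \o xsection X.
  apply/funext => t; rewrite /F/=; congr (P _).
  by apply/seteqP; split=> t' /=; rewrite /xsection/= inE.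
split; first by rewrite FE; exact: measurable_fun_xsection.
transitivity ((P \x P)%E X); last by rewrite FE.
apply: (@law_unique_set _ _ _ _ T (T * T)%type P (P \x P)%E V V' mV mV' _ _ S mS).
  by apply: (le_lt_trans (probability_le1 P measurableT)); exact: ltry.
move=> B mB.
pose A1 := [set t | forall i, B (inl i) (V (inl i) t)].
pose A2 := [set t | forall j, B (inr j) (V (inr j) t)].
have -> : [set z | forall k, B k (V' k z)] = A1 `*` A2.
  apply/seteqP; split=> [z /= Bz|z [A1z A2z] [i|j]]; last 2 first.
  - exact: A1z.
  - exact: A2z.
  by split=> [i|j]; [exact: (Bz (inl i))|exact: (Bz (inr j))].
have mA1 : measurable A1.
  by apply: measurable_forall => i; exact: measurable_preimage (mV _) (mB _).
have mA2 : measurable A2.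
  by apply: measurable_forall => i; exact: measurable_preimage (mV _) (mB _).
apply: (@etrans _ _ (P A1 * P A2)%E); last exact/esym/product_measure1E.
apply: (etrans (VP B mB)); rewrite big_sumType/=.
have inl_inj : injective (@inl I J) by move=> ? ? [].
have inr_inj : injective (@inr I J) by move=> ? ? [].
congr (_ * _)%E; apply/esym.
  exact: (proj2 (std_normal_family_sub inl_inj Vstd) (fun i => B (inl i)) (fun i => mB _)).
exact: (proj2 (std_normal_family_sub inr_inj Vstd) (fun i => B (inr i)) (fun i => mB _)).
Qed.

(** Once the second block is replayed on an independent copy, the matrix is constant in the variable
    of the copy, and the deterministic rotation gives the inner probability: a fixed product of
    normal probabilities on the event of the first block, 0 off it. It is the same for all matrices,
    hence the new block is independent of the first. *)
Lemma std_normal_family_random_orth d (T : measurableType d)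
    (P : probability T R) (I L K : finType) (V : I + K -> T -> R)
    (O : (I -> R) -> L -> K -> R) :
  (forall l k, measurable_fun setT (fun tau => O (untuple tau) l k)) ->
  std_normal_family P V ->
  {ae P, forall t, forall l l',
    \sum_k O (fun i => V (inl i) t) l k * O (fun i => V (inl i) t) l' k
    = (l == l')%:R} ->
  std_normal_family P (fun h : I + L => match h with
    | inl i => V (inl i)
    | inr l => fun t => \sum_k O (fun i => V (inl i) t) l k * V (inr k) t end).
Proof.
move=> mO Vstd OO; have [mV VP] := Vstd.
have mOV l k : measurable_fun setT (fun t => O (fun i => V (inl i) t) l k).
  apply: (measurable_family_comp (V := fun i => V (inl i)) (f := fun v => O v l k)) => // i.
split.
  case=> [i|l]; first exact: mV.
  apply: measurable_sum => k; apply: measurable_funM; [exact: mOV|exact: mV].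
move=> B mB.
pose S := [set v : I + K -> R | (forall i, B (inl i) (v (inl i))) /\
  forall l, B (inr l) (\sum_k O (fun i => v (inl i)) l k * v (inr k))].
have mS : measurable [set tau | S (untuple tau)].
  have -> : [set tau | S (untuple tau)] =
     [set tau | forall i, B (inl i) (untuple tau (inl i))] `&`
     [set tau | forall l, B (inr l) (\sum_k O (fun i => untuple tau (inl i)) l k * untuple tau (inr k))].
    by apply/seteqP; split.
  apply: measurableI; apply: measurable_forall => h.
    exact: measurable_preimage (measurable_untuple _) (mB _).
  apply: (@measurable_preimage _ _ _ _ (fun tau => \sum_k O (fun i => untuple tau (inl i)) h k * untuple tau (inr k))); last exact: mB.
  apply: measurable_sum => k; apply: measurable_funM; last exact: measurable_untuple.
  apply: (measurable_family_comp (V := fun i tau => untuple tau (inl i)) (f := fun v => O v h k)) => // i.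
  exact: measurable_untuple.
transitivity (P [set t | S (V^~ t)]).
  congr (P _); apply/seteqP; split=> t /= Bt.
    by split=> [i|l]; [exact: (Bt (inl i))|exact: (Bt (inr l))].
  by case=> h; [exact: (proj1 Bt)|exact: (proj2 Bt)].
have [mF ->] := std_normal_family_decouple Vstd mS.
pose A1 := [set t | forall i, B (inl i) (V (inl i) t)].
have mA1 : measurable A1.
  by apply: measurable_forall => i; exact: measurable_preimage (mV _) (mB _).
pose C := (\prod_l gamma (B (inr l)))%E.
have C0 : (0 <= C)%E by apply: prode_ge0 => l _; exact: measure_ge0.
have inl_inj : injective (@inl I K) by move=> ? ? [].
have inr_inj : injective (@inr I K) by move=> ? ? [].
have m1 : measurable_fun setT (fun t => (\1_A1 t : R)%:E).
  by apply/measurable_EFinP; exact: measurable_indic.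
transitivity (\int[P]_t ((\1_A1 t)%:E * C))%E; last first.
  rewrite ge0_integralZr// integral_indic// setIT big_sumType/=; congr (_ * _)%E.
  exact: (proj2 (std_normal_family_sub inl_inj Vstd) (fun i => B (inl i)) (fun i => mB _)).
apply: ae_eq_integral => //; first exact: emeasurable_funM.
apply: filterS OO => t OOt _.
have [A1t|A1t] := pselect (A1 t); last first.
  rewrite indicE memNset// mul0e (_ : [set _ | _] = set0) ?measure0//.
  by apply/seteqP; split=> // t' [].
rewrite indicE mem_set// mul1e.
have Vr := std_normal_family_sub inr_inj Vstd.
apply: etrans; last exact: (proj2 (std_normal_family_orth OOt Vr)
  (fun l => B (inr l)) (fun l => mB _)).
by congr (P _); apply/seteqP; split=> t' /= => [[]|].
Qed.

End gaussian_transfer.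

(** * The likelihood, its gradient and its Hessian *)

Section directional_calculus.
Context {R : realType} {k : nat}.
Implicit Types (f g : 'rV[R]_k -> R) (t v : 'rV[R]_k).

(** The rules of this section are stated for explicit functions [fun t => ...]: derivatives are then
    assembled by unification, and the result is compared with the announced value by [ring] or
    [field]. *)
Lemma is_derive_sumr (I : Type) (r : seq I) (f : I -> 'rV[R]_k -> R) t v (df : I -> R) :
  (forall i, is_derive t v (f i) (df i)) ->
  is_derive t v (fun t => \sum_(i <- r) f i t) (\sum_(i <- r) df i).
Proof.
move=> fdf; elim: r => [|i r IH].
  by under eq_fun do rewrite big_nil; rewrite big_nil; exact: is_derive_cst.
under eq_fun do rewrite big_cons; rewrite big_cons.
exact: (is_deriveD (fdf i) IH).
Qed.

Lemma is_derive_add f g t v (df dg : R) :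
  is_derive t v f df -> is_derive t v g dg ->
  is_derive t v (fun t => f t + g t) (df + dg).
Proof. by move=> fdf gdg; exact: is_deriveD. Qed.

Lemma is_derive_mul f g t v (df dg : R) :
  is_derive t v f df -> is_derive t v g dg ->
  is_derive t v (fun t => f t * g t) (df * g t + f t * dg).
Proof.
move=> fdf gdg; apply: is_derive_eq (is_deriveM fdf gdg) _.
by rewrite addrC; congr (_ + _); exact: mulrC.
Qed.

Lemma is_derive_cmul (c : R) f t v (df : R) :
  is_derive t v f df -> is_derive t v (fun t => c * f t) (c * df).
Proof.
move=> fdf; apply: is_derive_eq (is_derive_mul (is_derive_cst c t v) fdf) _.
by rewrite mul0r add0r.
Qed.

Lemma is_derive_inv f t v (df : R) : f t != 0 ->
  is_derive t v f df -> is_derive t v (fun t => (f t)^-1) (- df / f t ^+ 2).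
Proof.
move=> f0 [dfv fdf]; apply: DeriveDef; first exact: derivableV.
by rewrite deriveV// fdf -[LHS]/(_ * _) mulNr mulrC mulNr.
Qed.

Lemma is_derive_affine f t v (a : R) : (forall s : R, f (s *: v + t) = f t + s * a) ->
  is_derive t v f a.
Proof.
move=> fE.
have q : (fun s : R => s^-1 *: ((f \o shift t) (s *: v) - f t)) @ 0^' --> a.
  apply: (@cvg_trans _ (cst a @ (0 : R)^')); last exact: cvg_cst.
  apply: near_eq_cvg.
  near=> s; rewrite /= fE addrAC subrr add0r -[RHS]/(_ * _) mulrA mulVf ?mul1r//.
  by near: s; exact: nbhs_dnbhs_neq.
split; [exact: cvgP q|exact: cvg_lim q].
Unshelve. all: by end_near.
Qed.

Lemma is_derive_ln f t v (df : R) : 0 < f t ->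
  is_derive t v f df -> is_derive t v (fun t => ln (f t)) (df / f t).
Proof.
move=> f0 [/derivable1P dfv fdf].
(* The chain rule is used in one real variable, on the line through t in the direction v. *)
pose phi s := f (s *: v + t).
have lineE (g : 'rV[R]_k -> R) : 'D_v g t = 'D_1 (fun s : R => g (s *: v + t)) 0.
  rewrite /derive; set g1 := fun h => h^-1 *: _; set g2 := fun h => h^-1 *: _.
  suff -> : g1 = g2 by [].
  by apply/funext => s; rewrite /g1 /g2/= addr0 scale0r add0r [_%:A]mulr1.
have phi0 : phi 0 = f t by rewrite /phi scale0r add0r.
have phi_d : is_derive (0 : R) 1 phi df.
  by apply: (@DeriveDef _ _ _ _ _ phi) => //; rewrite -lineE.
have ln_d : is_derive (phi 0) 1 (@ln R) (phi 0)^-1.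
  by rewrite phi0; exact: is_derive1_ln.
have [c1 c2] := is_derive1_comp (f := @ln R) ln_d phi_d.
split; first exact/derivable1P.
by rewrite lineE -[LHS]/('D_1 (@ln R \o phi) 0) c2 phi0 mulrC.
Qed.

End directional_calculus.

(** * The log-likelihood in closed form and its first two derivatives *)

Section profile.
Context {R : realType} {q m : nat}.
Variables (px : 'I_m -> R) (ps : 'I_q.+1 -> 'I_m -> R).
Hypotheses (px_gt0 : forall j, 0 < px j) (ps_ge0 : forall i j, 0 <= ps i j).
Variables (nn : 'I_q.+1 -> R) (Tm : 'I_q.+1 -> 'I_m -> R).
Hypothesis nn_ge0 : forall i, 0 <= nn i.
Implicit Types t u v : 'rV[R]_(m + (q + q)).

(* [par_alpha] and [par_mu] are linear, [par_beta] is affine with this linear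
   part. *)
Definition lin_beta v (i : 'I_q.+1) : R :=
  if unlift ord0 i is Some i' then v 0 (rshift m (rshift q i')) else 0.

Lemma is_derive_par_mu t v j : is_derive t v (fun t => par_mu t j) (par_mu v j).
Proof. by apply: is_derive_affine => r; rewrite /par_mu !mxE addrC. Qed.

Lemma is_derive_par_alpha t v i :
  is_derive t v (fun t => par_alpha t i) (par_alpha v i).
Proof.
apply: is_derive_affine => r; rewrite /par_alpha.
by case: (unlift ord0 i) => [i'|]; [rewrite !mxE addrC|rewrite mulr0 addr0].
Qed.

Lemma is_derive_par_beta t v i :
  is_derive t v (fun t => par_beta t i) (lin_beta v i).
Proof.
apply: is_derive_affine => r; rewrite /par_beta /lin_beta.
by case: (unlift ord0 i) => [i'|]; [rewrite !mxE addrC|rewrite mulr0 addr0].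
Qed.

(** Completing the square in x_j gives the posterior precision [Gf], the posterior mean [Bf / Gf]
    and, up to the squares of the data, the remaining constant [Af]. The sizes [nn] are real
    numbers, so that the same functions serve for n_i, for n_i / n and for the weights w_i. *)
Definition Gf t j := px j + \sum_i nn i * ps i j * (par_beta t i * par_beta t i).
Definition Bf t j := px j * par_mu t j +
  \sum_i ps i j * (par_beta t i * (Tm i j + - nn i * par_alpha t i)).
Definition Af t j := px j * (par_mu t j * par_mu t j) +
  \sum_i ps i j * (nn i * (par_alpha t i * par_alpha t i) + (- 2 * Tm i j) * par_alpha t i).

Definition profile t :=
  - 2^-1 * \sum_j (ln (Gf t j) + (Af t j + -1 * (Bf t j * Bf t j * (Gf t j)^-1))).

Lemma Gf_gt0 t j : 0 < Gf t j.
Proof.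
rewrite ltr_pwDl//; apply: sumr_ge0 => i _.
by apply: mulr_ge0; [exact: mulr_ge0|rewrite -expr2 sqr_ge0].
Qed.

Definition dGf t v j := \sum_i nn i * ps i j * (2 * (par_beta t i * lin_beta v i)).
Definition ddGf u v j := \sum_i nn i * ps i j * (2 * (lin_beta u i * lin_beta v i)).
Definition dBf t v j := px j * par_mu v j +
  \sum_i ps i j * (lin_beta v i * (Tm i j - nn i * par_alpha t i) -
     par_beta t i * (nn i * par_alpha v i)).
Definition ddBf u v j :=
  - \sum_i ps i j * nn i * (lin_beta v i * par_alpha u i + lin_beta u i * par_alpha v i).
Definition dAf t v j := px j * (2 * (par_mu t j * par_mu v j)) +
  \sum_i ps i j * (2 * (nn i * par_alpha t i - Tm i j) * par_alpha v i).
Definition ddAf u v j := px j * (2 * (par_mu u j * par_mu v j)) +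
  \sum_i ps i j * (2 * nn i * par_alpha u i * par_alpha v i).

Lemma is_derive_Gf t v j : is_derive t v (fun t => Gf t j) (dGf t v j).
Proof.
rewrite /Gf; apply: is_derive_eq.
  apply: is_derive_add.
  apply: is_derive_sumr => i; apply: is_derive_cmul.
  by apply: is_derive_mul; exact: is_derive_par_beta.
by rewrite add0r; apply: eq_bigr => i _; ring.
Qed.

Lemma is_derive_dGf t u v j : is_derive t u (fun t => dGf t v j) (ddGf u v j).
Proof.
rewrite /dGf; apply: is_derive_eq.
  apply: is_derive_sumr => i; do 2!apply: is_derive_cmul.
  by apply: is_derive_mul; exact: is_derive_par_beta.
by apply: eq_bigr => i _; rewrite mulr0 addr0.
Qed.

Lemma is_derive_Bf t v j : is_derive t v (fun t => Bf t j) (dBf t v j).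
Proof.
rewrite /Bf; apply: is_derive_eq.
  apply: is_derive_add; first by apply: is_derive_cmul; exact: is_derive_par_mu.
  apply: is_derive_sumr => i; apply: is_derive_cmul.
  apply: is_derive_mul; first exact: is_derive_par_beta.
  apply: is_derive_add.
  by apply: is_derive_cmul; exact: is_derive_par_alpha.
by congr (_ + _); apply: eq_bigr => i _; ring.
Qed.

Lemma is_derive_dBf t u v j : is_derive t u (fun t => dBf t v j) (ddBf u v j).
Proof.
rewrite (_ : (fun t => dBf t v j) = fun t => px j * par_mu v j +
   \sum_i ps i j * (lin_beta v i * (Tm i j + - nn i * par_alpha t i) +
     par_beta t i * (- (nn i * par_alpha v i)))).
  apply: is_derive_eq.
    apply: is_derive_add.
    apply: is_derive_sumr => i; apply: is_derive_cmul; apply: is_derive_add.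
      apply: is_derive_cmul; apply: is_derive_add.
      by apply: is_derive_cmul; exact: is_derive_par_alpha.
    by apply: is_derive_mul; exact: is_derive_par_beta.
  by rewrite add0r /ddBf -sumrN; apply: eq_bigr => i _; ring.
apply/funext => t'; congr (_ + _); apply: eq_bigr => i _.
by rewrite mulrN mulNr.
Qed.

Lemma is_derive_Af t v j : is_derive t v (fun t => Af t j) (dAf t v j).
Proof.
rewrite /Af; apply: is_derive_eq.
  apply: is_derive_add.
    by apply: is_derive_cmul; apply: is_derive_mul; exact: is_derive_par_mu.
  apply: is_derive_sumr => i; apply: is_derive_cmul; apply: is_derive_add.
    by apply: is_derive_cmul; apply: is_derive_mul; exact: is_derive_par_alpha.
  by apply: is_derive_cmul; exact: is_derive_par_alpha.
by congr (_ + _); [ring|apply: eq_bigr => i _; ring].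
Qed.

Lemma is_derive_dAf t u v j : is_derive t u (fun t => dAf t v j) (ddAf u v j).
Proof.
rewrite (_ : (fun t => dAf t v j) = fun t => px j * (2 * (par_mu t j * par_mu v j)) +
   \sum_i ps i j * ((2 * nn i * par_alpha v i) * par_alpha t i + - (2 * Tm i j * par_alpha v i))).
  apply: is_derive_eq.
    apply: is_derive_add.
      do 2!apply: is_derive_cmul.
      by apply: is_derive_mul; exact: is_derive_par_mu.
    apply: is_derive_sumr => i; apply: is_derive_cmul; apply: is_derive_add.
      by apply: is_derive_cmul; exact: is_derive_par_alpha.
  by congr (_ + _); [ring|apply: eq_bigr => i _; ring].
apply/funext => t'; congr (_ + _); apply: eq_bigr => i _; ring.
Qed.

Definition dprofile t v := - 2^-1 * \sum_j (dGf t v j * (Gf t j)^-1 + (dAf t v j +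
   -1 * (2 * (Bf t j * dBf t v j) * (Gf t j)^-1 -
         Bf t j * Bf t j * (dGf t v j * ((Gf t j)^-1 * (Gf t j)^-1))))).

Lemma is_derive_profile t v : is_derive t v profile (dprofile t v).
Proof.
apply: is_derive_cmul; apply: is_derive_sumr => j; have G0 := Gf_gt0 t j.
have G0' : Gf t j != 0 by rewrite gt_eqF.
apply: is_derive_eq.
  apply: is_derive_add; first by apply: is_derive_ln => //; exact: is_derive_Gf.
  apply: is_derive_add; first exact: is_derive_Af.
  apply: is_derive_cmul; apply: is_derive_mul.
    by apply: is_derive_mul; exact: is_derive_Bf.
  by apply: is_derive_inv => //; exact: is_derive_Gf.
by rewrite /=; field.
Qed.

(* The weight [e] of the contribution of [ln (Gf t j)] is 1 in the second
   derivative, and 1/n once everything else is divided by n. *)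
Definition ddprofile (e : R) t u v := - 2^-1 * \sum_j (
  e * (ddGf u v j / Gf t j - dGf t v j * dGf t u j / Gf t j ^+ 2) + (ddAf u v j -
   (2 * (dBf t u j * dBf t v j + Bf t j * ddBf u v j) / Gf t j
    - 2 * Bf t j * dBf t v j * dGf t u j / Gf t j ^+ 2
    - (2 * Bf t j * dBf t u j * dGf t v j + Bf t j ^+ 2 * ddGf u v j) / Gf t j ^+ 2
    + 2 * Bf t j ^+ 2 * dGf t v j * dGf t u j / Gf t j ^+ 3))).

Lemma is_derive_dprofile t u v :
  is_derive t u (fun t => dprofile t v) (ddprofile 1 t u v).
Proof.
apply: is_derive_cmul; apply: is_derive_sumr => j; have G0 := Gf_gt0 t j.
have G0' : Gf t j != 0 by rewrite gt_eqF.
have dG w := is_derive_Gf t w j; have dB w := is_derive_Bf t w j.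
have ddG w := is_derive_dGf t u w j; have ddB w := is_derive_dBf t u w j.
have dGi : is_derive t u (fun t => (Gf t j)^-1) _ := is_derive_inv G0' (dG u).
rewrite (_ : (fun t0 => _) = fun t0 => dGf t0 v j * (Gf t0 j)^-1 + (dAf t0 v j +
   -1 * (2 * (Bf t0 j * dBf t0 v j) * (Gf t0 j)^-1 +
         -1 * (Bf t0 j * Bf t0 j * (dGf t0 v j * ((Gf t0 j)^-1 * (Gf t0 j)^-1)))))); last first.
  by apply/funext => t'; congr (_ + (_ + -1 * _)); rewrite mulN1r.
have d1 := is_derive_mul (ddG v) dGi.
have d2 := is_derive_mul (is_derive_cmul 2 (is_derive_mul (dB u) (ddB v))) dGi.
have d3 := is_derive_mul (is_derive_mul (dB u) (dB u))
  (is_derive_mul (ddG v) (is_derive_mul dGi dGi)).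
have d4 := is_derive_cmul (-1) (is_derive_add d2 (is_derive_cmul (-1) d3)).
apply: is_derive_eq (is_derive_add d1 (is_derive_add (is_derive_dAf t u v j) d4)) _.
by rewrite /=; field.
Qed.

End profile.

(** * Integrating out the unobserved variables *)

Section gaussian_marginal.
Context {R : realType}.

(** Completing the square in x: prior times likelihood is a factor free of x times the posterior
    density, with precision G and mean B / G. *)
Lemma normal_pdf_prod (I : finType) (P : pred I) (mu tau : R) (a b sg y : I -> R)
    (G B : R) : 0 < tau -> (forall o, 0 < sg o) ->
  G = (tau ^+ 2)^-1 + \sum_(o | P o) b o ^+ 2 / sg o ^+ 2 ->
  B = mu / tau ^+ 2 + \sum_(o | P o) b o * (y o - a o) / sg o ^+ 2 ->
  forall x : R,
  normal_pdf mu tau x * \prod_(o | P o) normal_pdf (a o + b o * x) (sg o) (y o) =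
  normal_peak tau * (\prod_(o | P o) normal_peak (sg o)) *
  Num.sqrt (pi *+ 2) * (Num.sqrt G)^-1 *
  expR (- 2^-1 * (mu ^+ 2 / tau ^+ 2 + \sum_(o | P o) (y o - a o) ^+ 2 / sg o ^+ 2
                  - B ^+ 2 / G)) *
  normal_pdf (B / G) (Num.sqrt G)^-1 x.
Proof.
move=> tau0 sg0 GE BE x.
have G0 : 0 < G.
  rewrite GE ltr_pwDl ?invr_gt0 ?exprn_gt0//; apply: sumr_ge0 => o _.
  by rewrite divr_ge0 ?sqr_ge0.
have sG0 : 0 < Num.sqrt G by rewrite sqrtr_gt0.
have pi2 : 0 < Num.sqrt (pi *+ 2 : R) by rewrite sqrtr_gt0 pmulrn_lgt0// pi_gt0.
have peakG : normal_peak (Num.sqrt G)^-1 = Num.sqrt G * (Num.sqrt (pi *+ 2))^-1.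
  rewrite /normal_peak exprVn sqr_sqrtr ?ltW// -mulrnAr sqrtrM ?invr_ge0 ?ltW//.
  by rewrite sqrtrV ?ltW// invfM invrK.
rewrite !normal_pdfE ?gt_eqF ?invr_gt0// peakG.
under eq_bigr => o _ do rewrite normal_pdfE ?gt_eqF//.
rewrite big_split/= /normal_fun -expR_sum.
set E := expR (- 2^-1 * _); set F := expR (- (x - B / G) ^+ 2 / _).
set e := expR (- (x - mu) ^+ 2 / _); set f := expR (\sum_(o | P o) _).
suff ef : e * f = E * F.
  rewrite mulrACA ef; field; by rewrite !gt_eqF.
rewrite /e /f /E /F -!expRD; congr expR.
have -> : (Num.sqrt G)^-1 ^+ 2 = G^-1 by rewrite exprVn sqr_sqrtr// ltW.
have -> : \sum_(o | P o) (- (y o - (a o + b o * x)) ^+ 2 / (sg o ^+ 2 *+ 2)) =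
  - 2^-1 * \sum_(o | P o) (y o - a o) ^+ 2 / sg o ^+ 2
  + x * \sum_(o | P o) b o * (y o - a o) / sg o ^+ 2
  - 2^-1 * x ^+ 2 * \sum_(o | P o) b o ^+ 2 / sg o ^+ 2.
  rewrite !mulr_sumr -big_split/= -sumrB; apply: eq_bigr => o _.
  by field; rewrite gt_eqF.
have -> : \sum_(o | P o) b o * (y o - a o) / sg o ^+ 2 = B - mu / tau ^+ 2.
  by rewrite BE addrC addKr.
have -> : \sum_(o | P o) b o ^+ 2 / sg o ^+ 2 = G - (tau ^+ 2)^-1.
  by rewrite GE addrC addKr.
by field; rewrite !gt_eqF.
Qed.

(** The free factor c carries the induction: it absorbs the density of the outer variable while the
    inner ones are integrated. *)
Lemma integral_Rn_normal k (c : R) (C a b : 'I_k -> R) :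
  integral_Rn (fun v : 'I_k -> R => c * \prod_j (C j * normal_pdf (a j) (b j) (v j)))
  = c * \prod_j C j.
Proof.
elim: k c C a b => [|k IH] c C a b; first by rewrite /= !big_ord0.
rewrite [RHS](_ : _ = \int[lebesgue_measure]_t
   (c * C ord0 * (\prod_j C (lift ord0 j)) * normal_pdf (a ord0) (b ord0) t)).
  rewrite /=; apply: eq_Rintegral => t _.
  rewrite (_ : (fun v : 'I_k -> R => _) = fun v =>
    c * C ord0 * normal_pdf (a ord0) (b ord0) t *
    \prod_j (C (lift ord0 j) * normal_pdf (a (lift ord0 j)) (b (lift ord0 j)) (v j))).
    by rewrite IH; ring.
  apply/funext => v; rewrite big_ord_recl /vcons unlift_none mulrA mulrA.
  by congr (_ * _); apply: eq_bigr => j _; rewrite liftK.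
rewrite RintegralZl//; last exact: integrable_normal_pdf.
by rewrite /Rintegral integral_normal_pdf/= mulr1 big_ord_recl mulrA.
Qed.

End gaussian_marginal.

Section likelihood.
Context {R : realType} {q m : nat}.
Variables (sx : 'I_m -> R) (s : 'I_q.+1 -> 'I_m -> R).
Hypotheses (sx_gt0 : forall j, 0 < sx j) (s_gt0 : forall i j, 0 < s i j).
Variable (N : 'I_q.+1 -> nat).
Implicit Types (y : obs m N -> R) (t u v : 'rV[R]_(m + (q + q))).

Lemma big_obs_level (idx : R) (op : Monoid.com_law idx) (j : 'I_m) (F : obs m N -> R) :
  \big[op/idx]_(o | level o == j) F o =
  \big[op/idx]_i \big[op/idx]_(k < N i)
     F (Tagged (fun i => ('I_m * 'I_(N i))%type) (j, k)).
Proof.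
transitivity (\big[op/idx]_i \big[op/idx]_(p : 'I_m * 'I_(N i) | p.1 == j)
     F (Tagged (fun i => ('I_m * 'I_(N i))%type) p)).
  rewrite (@sig_big_dep _ _ _ _ (fun i => ('I_m * 'I_(N i))%type : finType) xpredT
    (fun i (p : 'I_m * 'I_(N i)) => p.1 == j)
    (fun i p => F (Tagged (fun i => ('I_m * 'I_(N i))%type) p))).
  by apply: eq_big => [[i p]|[i p] _].
apply: eq_bigr => i _.
transitivity (\big[op/idx]_(j' | j' == j) \big[op/idx]_(k < N i)
     F (Tagged (fun i => ('I_m * 'I_(N i))%type) (j', k))).
  by rewrite pair_big; apply: eq_big => [[j' k]|[j' k] _]//=; rewrite andbT.
by rewrite big_pred1_eq.
Qed.

Definition xprec (j : 'I_m) : R := (sx j ^+ 2)^-1.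
Definition eprec (i : 'I_q.+1) (j : 'I_m) : R := (s i j ^+ 2)^-1.

Lemma xprec_gt0 j : 0 < xprec j. Proof. by rewrite invr_gt0 exprn_gt0. Qed.

Lemma eprec_gt0 i j : 0 < eprec i j. Proof. by rewrite invr_gt0 exprn_gt0. Qed.

Lemma eprec_ge0 i j : 0 <= eprec i j. Proof. exact/ltW/eprec_gt0. Qed.

Definition sizes (i : 'I_q.+1) : R := (N i)%:R.
Definition totals y (i : 'I_q.+1) (j : 'I_m) : R :=
  \sum_(k < N i) y (Tagged (fun i => ('I_m * 'I_(N i))%type) (j, k)).

Lemma sizes_ge0 i : 0 <= sizes i. Proof. exact: ler0n. Qed.

(** The posterior densities integrate to 1, which leaves one explicit factor [C j] for each level.
    The normal peaks and the squares of the data are free of the parameter and go into c. *)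
Lemma loglik_profile y : exists c, forall t,
  loglik sx s y t = c + profile xprec eprec sizes (totals y) t.
Proof.
pose K (j : 'I_m) := normal_peak (sx j) *
  (\prod_(o : obs m N | level o == j) normal_peak (s (lab o) (level o))) *
  Num.sqrt (pi *+ 2).
have K0 j : 0 < K j.
  apply: mulr_gt0; last by rewrite sqrtr_gt0 pmulrn_lgt0// pi_gt0.
  apply: mulr_gt0; first by rewrite normal_peak_gt0 ?gt_eqF.
  by apply: prodr_gt0 => o _; rewrite normal_peak_gt0 ?gt_eqF.
pose c1 (j : 'I_m) := \sum_(o : obs m N | level o == j) y o ^+ 2 / s (lab o) (level o) ^+ 2.
exists (\sum_j (ln (K j) - 2^-1 * c1 j)) => t.
pose G := Gf xprec eprec sizes t; pose B := Bf xprec eprec sizes (totals y) t.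
have G0 j : 0 < G j by exact: (Gf_gt0 xprec_gt0 eprec_ge0 sizes_ge0).
pose E j := Af xprec eprec sizes (totals y) t j + c1 j - B j ^+ 2 / G j.
pose C j := K j * (Num.sqrt (G j))^-1 * expR (- 2^-1 * E j).
have -> : loglik sx s y t = ln (\prod_j C j).
  rewrite /loglik /marginal_density; congr ln.
  rewrite -[RHS]mul1r -(integral_Rn_normal 1 C (fun j => B j / G j) (fun j => (Num.sqrt (G j))^-1)).
  congr integral_Rn; apply/funext => v; rewrite mul1r /joint_density.
  (* The observations are grouped by level, since those of level j involve x_j only. *)
  rewrite (partition_big (fun o : obs m N => level o) xpredT)//= -big_split/=.
  apply: eq_bigr => j _.
  rewrite (eq_bigr (fun o => normal_pdf (par_alpha t (lab o) + par_beta t (lab o) * v j)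
    (s (lab o) (level o)) (y o))); last by move=> o /eqP ->.
  have EE : par_mu t j ^+ 2 / sx j ^+ 2 +
      \sum_(o : obs m N | level o == j) (y o - par_alpha t (lab o)) ^+ 2 / s (lab o) (level o) ^+ 2
      = Af xprec eprec sizes (totals y) t j + c1 j.
    rewrite /Af /c1 -addrA /xprec (mulrC (_ ^-1)) -expr2; congr (_ + _).
    rewrite !big_obs_level -big_split/=; apply: eq_bigr => i _.
    rewrite /lab /level/=.
    transitivity (\sum_(k < N i) ((- 2 * par_alpha t i / s i j ^+ 2) *
      y (Tagged (fun i => ('I_m * 'I_(N i))%type) (j, k)) +
      (par_alpha t i ^+ 2 / s i j ^+ 2 +
       y (Tagged (fun i => ('I_m * 'I_(N i))%type) (j, k)) ^+ 2 / s i j ^+ 2))).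
      by apply: eq_bigr => k _; ring.
    rewrite big_split/= -mulr_sumr big_split/= sumr_const card_ord -mulr_natl.
    by rewrite -/(totals y i j) /sizes /eprec; ring.
  rewrite (@normal_pdf_prod _ _ (fun o => level o == j) (par_mu t j) (sx j)
    (fun o => par_alpha t (lab o)) (fun o => par_beta t (lab o))
    (fun o => s (lab o) (level o)) y (G j) (B j))//.
  - by rewrite EE.
  - rewrite /G /Gf; congr (_ + _); rewrite big_obs_level; apply: eq_bigr => i _.
    by rewrite /lab /level/= sumr_const card_ord -mulr_natl /sizes /eprec; ring.
  - rewrite /B /Bf /xprec (mulrC (_ ^-1)); congr (_ + _); rewrite big_obs_level; apply: eq_bigr => i _.
    rewrite /lab /level/=; apply/esym.
    transitivity (\sum_(k < N i) ((par_beta t i / s i j ^+ 2) *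
      y (Tagged (fun i => ('I_m * 'I_(N i))%type) (j, k)) -
      par_beta t i * par_alpha t i / s i j ^+ 2)).
      by apply: eq_bigr => k _; ring.
    rewrite sumrB -mulr_sumr sumr_const card_ord -mulr_natl.
    by rewrite -/(totals y i j) /sizes /eprec; ring.
have C0 j : 0 < C j.
  apply: mulr_gt0 (expR_gt0 _); apply: mulr_gt0 => //.
  by rewrite invr_gt0 sqrtr_gt0.
have -> : ln (\prod_j C j) = \sum_j ln (C j).
  suff [] : 0 < \prod_j C j /\ ln (\prod_j C j) = \sum_j ln (C j) by [].
  elim/big_rec2 : _ => [|j a b _ [b0 <-]]; first by rewrite ln1.
  by rewrite mulr_gt0//; split=> //; rewrite lnM ?posrE.
rewrite /profile mulr_sumr -big_split/=; apply: eq_bigr => j _.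
rewrite /C lnM ?posrE ?expR_gt0 ?expRK//; last first.
  by apply: mulr_gt0 => //; rewrite invr_gt0 sqrtr_gt0.
rewrite lnM ?posrE ?invr_gt0 ?sqrtr_gt0// lnV ?posrE ?sqrtr_gt0//.
have -> : ln (Num.sqrt (G j)) = 2^-1 * ln (G j).
  have -> : ln (G j) = ln (Num.sqrt (G j)) + ln (Num.sqrt (G j)).
    by rewrite -lnM ?posrE ?sqrtr_gt0// -expr2 sqr_sqrtr// ltW.
  by field.
by rewrite /E -/(G j) -/(B j); ring.
Qed.

Lemma scoreE y t h :
  score sx s y t 0 h = dprofile xprec eprec sizes (totals y) t (delta_mx 0 h).
Proof.
have [c logE] := loglik_profile y.
rewrite /score mxE /partial_derivative.
rewrite (_ : loglik sx s y = fun t => c + profile xprec eprec sizes (totals y) t); last first.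
  by apply/funext.
rewrite -[RHS]add0r; apply: derive_val; apply: is_derive_add.
exact: (is_derive_profile xprec_gt0 eprec_ge0 (totals y) sizes_ge0).
Qed.

Lemma observed_informationE y t h l :
  observed_information sx s y t h l =
  - ddprofile xprec eprec sizes (totals y) 1 t (delta_mx 0 h) (delta_mx 0 l).
Proof.
rewrite /observed_information mxE mxE /partial_derivative; congr (- _).
rewrite (_ : 'D_(delta_mx 0 l) (loglik sx s y) =
  fun t => dprofile xprec eprec sizes (totals y) t (delta_mx 0 l)); last first.
  by apply/funext => t'; have := scoreE y t' l; rewrite /score mxE.
apply: derive_val.
exact: (is_derive_dprofile xprec_gt0 eprec_ge0 (totals y) sizes_ge0).
Qed.

End likelihood.

(** * The limit information matrix *)

Section information.
Context {R : realType} {q m : nat}.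
Variables (s : 'I_q.+1 -> 'I_m -> R) (w : 'I_q.+1 -> R).
Hypotheses (s_gt0 : forall i j, 0 < s i j) (w_gt0 : forall i, 0 < w i).
Implicit Types (theta : 'rV[R]_(m + (q + q))) (x : 'I_m -> R).

Lemma Ssum_gt0 theta j : 0 < Ssum s w theta j.
Proof.
rewrite /Ssum big_ord_recl ltr_pwDl//.
  rewrite /par_beta unlift_none expr1n mulr1 divr_gt0// exprn_gt0//.
apply: sumr_ge0 => i _; apply: divr_ge0; last exact: sqr_ge0.
by apply: mulr_ge0; [exact: ltW|exact: sqr_ge0].
Qed.

(** For the weights w_i / s_ij^2, this is the inner product of D with the slopes beta at level j,
    and [Ssum] is the squared norm of beta. Up to the factor sqrt(w) / s, [score_coef] is thus the
    residual of D after projection on beta: a common shift of x_j cannot be told apart from a change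
    of the means along beta. *)
Definition sens theta (D : 'I_q.+1 -> 'I_m -> R) (j : 'I_m) : R :=
  \sum_i w i * par_beta theta i * D i j / s i j ^+ 2.

(* The coefficient of zeta_lj in the limit of the score, in terms of the
   derivatives D_lj of the means alpha_l + beta_l x_j. *)
Definition score_coef theta (D : 'I_q.+1 -> 'I_m -> R) (lj : 'I_q.+1 * 'I_m) : R :=
  Num.sqrt (w lj.1) / s lj.1 lj.2 *
  (D lj.1 lj.2 - par_beta theta lj.1 * sens theta D lj.2 / Ssum s w theta lj.2).

Definition dmean x (v : 'rV[R]_(m + (q + q))) (i : 'I_q.+1) (j : 'I_m) : R :=
  par_alpha v i + x j * lin_beta v i.

Lemma score_coef_sum (I : finType) theta (c : I -> R) D lj :
  \sum_h c h * score_coef theta (D h) lj =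
  score_coef theta (fun l j => \sum_h c h * D h l j) lj.
Proof.
rewrite /score_coef.
have -> : sens theta (fun l j => \sum_h c h * D h l j) lj.2 =
    \sum_h c h * sens theta (D h) lj.2.
  rewrite /sens; under eq_bigr => i _ do rewrite mulr_sumr mulr_suml.
  rewrite exchange_big; apply: eq_bigr => h _; rewrite mulr_sumr.
  by apply: eq_bigr => i _; ring.
rewrite [X in _ - X / _]mulr_sumr mulr_suml -sumrB mulr_sumr.
by apply: eq_bigr => h _; ring.
Qed.

(** Pythagoras for the projection on beta: the residuals have the inner product of D and D' minus
    that of their projections. *)
Lemma score_coef_gram theta (D D' : 'I_q.+1 -> 'I_m -> R) :
  \sum_lj score_coef theta D lj * score_coef theta D' lj =
  \sum_j (\sum_i w i * D i j * D' i j / s i j ^+ 2 -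
          sens theta D j * sens theta D' j / Ssum s w theta j).
Proof.
rewrite -(pair_bigA _ (fun l j => score_coef theta D (l, j) * score_coef theta D' (l, j)))/=.
rewrite exchange_big; apply: eq_bigr => j _.
have S0 := Ssum_gt0 theta j.
set a := sens theta D j; set b := sens theta D' j; set S := Ssum s w theta j in S0 *.
transitivity (\sum_i (w i * D i j * D' i j / s i j ^+ 2
  - (w i * par_beta theta i * D i j / s i j ^+ 2) * (b / S)
  - (w i * par_beta theta i * D' i j / s i j ^+ 2) * (a / S)
  + (w i * par_beta theta i ^+ 2 / s i j ^+ 2) * (a * b / S ^+ 2))).
  apply: eq_bigr => i _; rewrite /score_coef/= -/a -/b -/S.
  have sq : Num.sqrt (w i) * Num.sqrt (w i) = w i by rewrite -expr2 sqr_sqrtr// ltW.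
  rewrite -[in RHS]sq; field; rewrite !gt_eqF//.
rewrite big_split/= !sumrB -!mulr_suml -/(sens theta D j) -/(sens theta D' j) -/a -/b.
rewrite -/(Ssum s w theta j) -/S; field; by rewrite gt_eqF.
Qed.

Definition unit_dir (h : 'I_(m + (q + q))) : 'rV[R]_(m + (q + q)) := delta_mx 0 h.

Lemma dmean_mu x (j' : 'I_m) i j : dmean x (unit_dir (lshift (q + q) j')) i j = 0.
Proof.
rewrite /dmean /par_alpha /lin_beta /unit_dir; case: (unlift ord0 i) => [i'|].
  by rewrite !mxE !eqxx/= !eq_rlshift mulr0 addr0.
by rewrite mulr0 addr0.
Qed.

Lemma dmean_alpha x (i' : 'I_q) i j :
  dmean x (unit_dir (rshift m (lshift q i'))) i j = (i == lift ord0 i')%:R.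
Proof.
rewrite /dmean /par_alpha /lin_beta /unit_dir.
case: (unliftP ord0 i) => [i1 ->|->].
  rewrite !mxE !eqxx/= !eq_rshift eq_rlshift eq_lshift mulr0 addr0.
  by rewrite (inj_eq lift_inj).
by rewrite mulr0 addr0 (negbTE (neq_lift _ _)).
Qed.

Lemma dmean_beta x (i' : 'I_q) i j :
  dmean x (unit_dir (rshift m (rshift q i'))) i j = x j * (i == lift ord0 i')%:R.
Proof.
rewrite /dmean /par_alpha /lin_beta /unit_dir.
case: (unliftP ord0 i) => [i1 ->|->].
  rewrite !mxE !eqxx/= !eq_rshift eq_lrshift add0r.
  by rewrite (inj_eq lift_inj).
by rewrite (negbTE (neq_lift _ _)) !mulr0 addr0.
Qed.

Lemma sum_delta (F : 'I_q.+1 -> R) (i : 'I_q.+1) :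
  \sum_k F k * (k == i)%:R = F i.
Proof.
rewrite (bigD1 i)//= eqxx mulr1 big1 ?addr0// => k /negbTE ->.
by rewrite mulr0.
Qed.

Lemma Wblock_gram theta x (a b : nat) (i l : 'I_q) :
  \sum_lj score_coef theta (fun k j => x j ^+ a * (k == lift ord0 i)%:R) lj *
          score_coef theta (fun k j => x j ^+ b * (k == lift ord0 l)%:R) lj
  = Wblock s w theta x (a + b) i l.
Proof.
rewrite score_coef_gram /Wblock mxE.
have sensE (c : nat) i' j : sens theta (fun k j => x j ^+ c * (k == lift ord0 i')%:R) j =
    x j ^+ c * (w (lift ord0 i') * par_beta theta (lift ord0 i') / s (lift ord0 i') j ^+ 2).
  rewrite /sens -[RHS](sum_delta (fun k => x j ^+ c * (w k * par_beta theta k / s k j ^+ 2))).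
  by apply: eq_bigr => k _; ring.
under eq_bigr => j _.
  rewrite !sensE.
  rewrite (_ : \sum_(i0 < q.+1) _ = x j ^+ a * x j ^+ b *
    (w (lift ord0 i) * (lift ord0 i == lift ord0 l)%:R / s (lift ord0 i) j ^+ 2)); last first.
    rewrite -[RHS](sum_delta (fun k => x j ^+ a * x j ^+ b * (w k * (k == lift ord0 l)%:R / s k j ^+ 2))).
    by apply: eq_bigr => k _; ring.
  over.
rewrite (inj_eq lift_inj).
case: eqP => [<-|_]; last rewrite -sumrN.
  apply: eq_bigr => j _; rewrite /kappa1 exprD mulr1.
  by field; rewrite !gt_eqF ?Ssum_gt0.
apply: eq_bigr => j _; rewrite /kappa2 exprD mulr0 mul0r mulr0 sub0r.
by field; rewrite !gt_eqF ?Ssum_gt0.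
Qed.

Lemma Wblock_sym theta x a : (Wblock s w theta x a)^T = Wblock s w theta x a.
Proof.
apply/matrixP => i l; rewrite !mxE; case: eqVneq => [->//|il]; congr (- _); apply: eq_bigr => j _; congr (_ * _).
by rewrite /kappa2; congr (_ / _); ring.
Qed.

Lemma Wmx_gram theta x h l :
  Wmx s w theta x h l =
  \sum_lj score_coef theta (dmean x (unit_dir h)) lj *
          score_coef theta (dmean x (unit_dir l)) lj.
Proof.
(* Given x, the means alpha_l + beta_l x_j do not involve mu, whence the zero rows and columns. *)
have zero j' D : \sum_lj score_coef theta (dmean x (unit_dir (lshift (q + q) j'))) lj *
    score_coef theta D lj = 0.
  apply: big1 => lj _; rewrite /score_coef /sens big1 ?dmean_mu => [|i _].
    by rewrite !(mulr0, mul0r, subr0).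
  by rewrite dmean_mu mulr0 mul0r.
have da i' : dmean x (unit_dir (rshift m (lshift q i'))) =
    fun k j => x j ^+ 0 * (k == lift ord0 i')%:R.
  by do 2!apply/funext => ?; rewrite dmean_alpha mul1r.
have db i' : dmean x (unit_dir (rshift m (rshift q i'))) =
    fun k j => x j ^+ 1 * (k == lift ord0 i')%:R.
  by do 2!apply/funext => ?; rewrite dmean_beta.
rewrite /Wmx; case: (split_ordP h) => h' ->.
  by rewrite zero; case: (split_ordP l) => l' ->; rewrite ?block_mxEul ?block_mxEur mxE.
case: (split_ordP l) => l' ->.
  under eq_bigr => lj _ do rewrite mulrC.
  by rewrite zero block_mxEdl mxE.
rewrite block_mxEdr; case: (split_ordP h') => i ->; case: (split_ordP l') => k ->.
- by rewrite block_mxEul !da Wblock_gram.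
- by rewrite block_mxEur da db Wblock_gram.
- by rewrite block_mxEdl Wblock_sym da db Wblock_gram.
- by rewrite block_mxEdr !db Wblock_gram.
Qed.

Definition bias_coef theta x (h : 'I_(q + q)) (lj : 'I_q.+1 * 'I_m) : R :=
  score_coef theta (dmean x (unit_dir (rshift m h))) lj.

Lemma Wtilde_gram theta x h l :
  Wtilde s w theta x h l = \sum_lj bias_coef theta x h lj * bias_coef theta x l lj.
Proof. by rewrite /Wtilde mxE mxE Wmx_gram. Qed.

Lemma Wtilde_sym theta x : (Wtilde s w theta x)^T = Wtilde s w theta x.
Proof.
apply/matrixP => h l; rewrite [LHS]mxE !Wtilde_gram.
by apply: eq_bigr => lj _; rewrite mulrC.
Qed.

(* The quadratic form is a sum of squares; if all vanish, then so do the
   derivatives a_l + b_l x_j of the means, since those of the reference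
   laboratory do, and two distinct levels give a = b = 0. *)
Lemma Wtilde_posdef theta x (j1 j2 : 'I_m) : x j1 != x j2 ->
  posdefmx (Wtilde s w theta x).
Proof.
move=> x12; split=> [|v v0]; first exact: Wtilde_sym.
pose D (l : 'I_q.+1) (j : 'I_m) :=
  \sum_h v h 0 * dmean x (unit_dir (rshift m h)) l j.
have -> : (v^T *m Wtilde s w theta x *m v) 0 0 = \sum_lj score_coef theta D lj ^+ 2.
  transitivity (\sum_lj \sum_h \sum_l v h 0 * bias_coef theta x h lj * (v l 0 * bias_coef theta x l lj)).
    rewrite mxE exchange_big/=; under [RHS]eq_bigr => h _ do rewrite exchange_big/=.
    rewrite exchange_big/=; apply: eq_bigr => l _; rewrite mxE mulr_suml.
    apply: eq_bigr => h _; rewrite mxE Wtilde_gram mulr_sumr mulr_suml.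
    by apply: eq_bigr => lj _; ring.
  apply: eq_bigr => lj _; rewrite expr2 -[X in X * _]score_coef_sum mulr_suml.
  by apply: eq_bigr => h _; rewrite -score_coef_sum mulr_sumr.
rewrite lt_neqAle eq_sym sumr_ge0 ?andbT => [|lj _]; last exact: sqr_ge0.
apply: contra_neq v0 => /eqP; rewrite psumr_eq0 => [/allP co0|lj _]; last exact: sqr_ge0.
have {}co0 l j : score_coef theta D (l, j) = 0.
  by apply/eqP; rewrite -sqrf_eq0; exact: (co0 (l, j) (mem_index_enum _)).
have D0 j : D ord0 j = 0.
  rewrite /D big1// => h _; rewrite /dmean /par_alpha /lin_beta unlift_none.
  by rewrite mulr0 addr0 mulr0.
have coN0 l j : Num.sqrt (w l) / s l j != 0.
  by rewrite mulf_neq0 ?invr_eq0 ?gt_eqF ?sqrtr_gt0.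
(* At the reference laboratory D = 0 and beta = 1, so its vanishing residual forces the projection
   coefficient to be 0; all residuals are then the derivatives themselves. *)
have sens0 j : sens theta D j = 0.
  have /eqP := co0 ord0 j; rewrite mulf_eq0 (negbTE (coN0 _ _))/= D0 sub0r.
  rewrite {1}/par_beta unlift_none mul1r oppr_eq0 mulf_eq0 invr_eq0.
  by rewrite (gt_eqF (Ssum_gt0 _ _)) orbF => /eqP.
have Dl l j : D l j = 0.
  have /eqP := co0 l j; rewrite mulf_eq0 (negbTE (coN0 _ _))/= sens0.
  by rewrite mulr0 mul0r subr0 => /eqP.
have DE i j : D (lift ord0 i) j = v (lshift q i) 0 + x j * v (rshift q i) 0.
  rewrite /D big_split_ord/=; congr (_ + _).
    rewrite (bigD1 i)//= dmean_alpha eqxx mulr1 big1 ?addr0// => k ki.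
    by rewrite dmean_alpha (inj_eq lift_inj) eq_sym (negbTE ki) mulr0.
  rewrite (bigD1 i)//= dmean_beta eqxx mulr1 big1 ?addr0 1?mulrC// => k ki.
  by rewrite dmean_beta (inj_eq lift_inj) eq_sym (negbTE ki) !mulr0.
have vb i : v (rshift q i) 0 = 0.
  have /eqP : (x j1 - x j2) * v (rshift q i) 0 = 0.
    by rewrite mulrBl -[RHS](subrr 0) -{1}(Dl (lift ord0 i) j1) -(Dl (lift ord0 i) j2) !DE; ring.
  by rewrite mulf_eq0 subr_eq0 (negbTE x12) => /eqP.
apply/colP => h; rewrite mxE; case: (split_ordP h) => i -> //.
by have := Dl (lift ord0 i) j1; rewrite DE vb mulr0 addr0.
Qed.

End information.

(** * Measurability *)

Section borel.
Context {R : realType}.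

Lemma measurable_fun_open d (T : measurableType d) (f : T -> R) :
  (forall U : set R, open U -> measurable (f @^-1` U)) -> measurable_fun setT f.
Proof.
move=> fU; apply: (measurability _ (RGenOpens.measurableE R)).
move=> _ [_ [a [b ->] <-]]; rewrite setTI; apply: fU; exact: interval_open.
Qed.

Lemma borel_measurable_continuous d (T : measurableType d) (E : topologicalType)
    (X : T -> E) (f : E -> R) : borel_measurable X -> continuous f ->
  measurable_fun setT (f \o X).
Proof.
move=> mX cf; apply: measurable_fun_open => U oU.
apply: (mX (f @^-1` U)); apply: open_comp => // ? _; exact: cf.
Qed.

(** An open set is the union of the countably many boxes with rational centre and radius 1 / (n + 1)
    that it contains, and the preimage of a box is described entry by entry. *)
Lemma borel_measurable_mx2 d (T : measurableType d) k l k' l'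
    (X : T -> 'M[R]_(k, l)) (Y : T -> 'M[R]_(k', l')) :
  (forall i j, measurable_fun setT (fun t => X t i j)) ->
  (forall i j, measurable_fun setT (fun t => Y t i j)) ->
  borel_measurable (fun t => (X t, Y t)).
Proof.
move=> mX mY U oU.
pose I := ('M[rat]_(k, l) * 'M[rat]_(k', l') * nat)%type.
pose e (p : I) : R := p.2.+1%:R^-1.
pose B (p : I) := [set z : 'M[R]_(k, l) * 'M[R]_(k', l') |
  (forall i j, `|z.1 i j - ratr (p.1.1 i j)| < e p) /\
  (forall i j, `|z.2 i j - ratr (p.1.2 i j)| < e p)].
have e0 p : 0 < e p by rewrite invr_gt0.
have UE : U = \bigcup_(p in [set p : I | B p `<=` U]) B p.
  apply/seteqP; split=> [z Uz|z [p /= BU /BU//]].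
  have /nbhs_ballP[r /= r0 rU] : nbhs z U by exact: open_nbhs_nbhs.
  (* Both z and any other point of the box are within the radius of the rational centre, so twice
     the radius has to be below r. *)
  have [n nr] : exists n : nat, n.+1%:R^-1 + n.+1%:R^-1 < r :> R.
    have r20 : 0 < r / 2 by rewrite divr_gt0.
    exists (Num.truncn (r / 2)^-1); rewrite [ltRHS]splitr.
    have lt1 : (Num.truncn (r / 2)^-1).+1%:R^-1 < r / 2.
      rewrite -[ltRHS]invrK ltf_pV2 ?posrE ?invr_gt0//.
      exact: truncnS_gt.
    by rewrite ltrD.
  have rat_near (x : R) : exists a : rat, `|x - ratr a| < n.+1%:R^-1.
    have n0 : 0 < n.+1%:R^-1 :> R by rewrite invr_gt0.
    have xn : x - n.+1%:R^-1 < x + n.+1%:R^-1 by rewrite ltrD2l gtrN.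
    have [a] := rat_in_itvoo xn.
    rewrite in_itv/= => /andP[a1 a2]; exists a.
    by rewrite ltr_distlC ltrBlDr -ltrBlDr a1 a2.
  pose rt x := projT1 (cid (rat_near x)).
  have rtP x : `|x - ratr (rt x)| < n.+1%:R^-1 by rewrite /rt; case: cid.
  exists (\matrix_(i, j) rt (z.1 i j), \matrix_(i, j) rt (z.2 i j), n) => /=.
    move=> z' [/= B1 B2]; apply: rU; split; split=> // i j.
      rewrite /ball/= -[z.1 i j - _](subrKA (ratr (rt (z.1 i j)))).
      rewrite (le_lt_trans (ler_normD _ _))// (le_lt_trans _ nr)// lerD//.
        exact: ltW.
      by have := B1 i j; rewrite mxE distrC => /ltW.
    rewrite /ball/= -[z.2 i j - _](subrKA (ratr (rt (z.2 i j)))).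
    rewrite (le_lt_trans (ler_normD _ _))// (le_lt_trans _ nr)// lerD//.
      exact: ltW.
    by have := B2 i j; rewrite mxE distrC => /ltW.
  by split=> i j; rewrite mxE.
pose F (p : I) := [set t | B p (X t, Y t) /\ B p `<=` U].
have -> : (fun t => (X t, Y t)) @^-1` U = \bigcup_p F p.
  apply/seteqP; split=> [t /=|t [p _ [/= Bp BU]]]; last exact: BU.
  by rewrite {1}UE => -[p /= BU Bp]; exists p.
apply: countable_bigcupT_measurable; first exact: countableP.
move=> p; have [BU|BU] := pselect (B p `<=` U); last first.
  rewrite (_ : F p = set0)//; apply/seteqP; split=> // t [_ /BU]//.
have mlt (g : T -> R) a : measurable_fun setT g ->
    measurable [set t | `|g t - a| < e p].
  move=> mg.
  have mg' : measurable_fun setT (fun t => `|g t - a|).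
    by apply: measurableT_comp => //; exact: measurable_funB.
  have := measurable_preimage mg' (measurable_itv `]-oo, e p[).
  by rewrite (_ : _ @^-1` _ = [set t | `|g t - a| < e p])//;
     apply/seteqP; split=> t /=; rewrite in_itv.
have -> : F p = [set t | forall i j, `|X t i j - ratr (p.1.1 i j)| < e p] `&`
                [set t | forall i j, `|Y t i j - ratr (p.1.2 i j)| < e p].
  by apply/seteqP; split=> [t [[]]//|t []].
by apply: measurableI; do 2!apply: measurable_forall => ?; exact: mlt.
Qed.

Lemma borel_measurable_mx d (T : measurableType d) k l (X : T -> 'M[R]_(k, l)) :
  (forall i j, measurable_fun setT (fun t => X t i j)) -> borel_measurable X.
Proof.
move=> mX U oU; have := borel_measurable_mx2 mX mX.
move=> /(_ (fst @^-1` U)); apply.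
apply: open_comp => // ? _; exact: cvg_fst.
Qed.

Lemma measurable_funV d (T : measurableType d) (f : T -> R) :
  measurable_fun setT f -> measurable_fun setT (fun t => (f t)^-1).
Proof.
(* 1 / f = f / f^2 and 1 / f^2 = exp (- ln (f^2)); where f vanishes, both sides are 0. *)
move=> mf; rewrite (_ : (fun t => _) = fun t => f t * expR (- ln (f t ^+ 2))).
  apply: measurable_funM => //; apply: measurableT_comp; first exact: measurable_expR.
  apply: measurableT_comp => //; apply: measurableT_comp; first exact: measurable_ln.
  exact: measurable_funX.
apply/funext => t; have [->|f0] := eqVneq (f t) 0; first by rewrite invr0 mul0r.
have f2 : 0 < f t ^+ 2 by rewrite exprn_even_gt0.
by rewrite expRN lnK ?posrE// expr2 invfM mulrA mulfV ?mul1r.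
Qed.

Lemma measurable_prodr d (T : measurableType d) (I : Type) (r : seq I) (f : I -> T -> R) :
  (forall i, measurable_fun setT (f i)) ->
  measurable_fun setT (fun t => \prod_(i <- r) f i t).
Proof.
move=> mf; elim: r => [|i r IH].
  by under eq_fun do rewrite big_nil; exact: measurable_cst.
by under eq_fun do rewrite big_cons; exact: measurable_funM.
Qed.

Lemma measurable_det d (T : measurableType d) k (M : T -> 'M[R]_k) :
  (forall i j, measurable_fun setT (fun t => M t i j)) ->
  measurable_fun setT (fun t => \det (M t)).
Proof.
move=> mM; rewrite /determinant; apply: measurable_sum => g.
by apply: measurable_funM => //; exact: measurable_prodr.
Qed.

Lemma measurable_adj d (T : measurableType d) k (M : T -> 'M[R]_k) :
  (forall i j, measurable_fun setT (fun t => M t i j)) ->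
  forall i j, measurable_fun setT (fun t => \adj (M t) i j).
Proof.
move=> mM i j; under eq_fun do rewrite mxE /cofactor.
apply: measurable_funM => //; apply: measurable_det => i' j'.
by under eq_fun do rewrite !mxE; exact: mM.
Qed.

(** [mxsqrt] is continuous on positive definite matrices and 0 elsewhere. The preimage of U is
    therefore that of an open set, joined by the complement of another such preimage when U contains
    0. *)
Lemma measurable_mxsqrt d (T : measurableType d) k (M : T -> 'M[R]_k) :
  (forall t, (M t)^T = M t) ->
  (forall i j, measurable_fun setT (fun t => M t i j)) ->
  forall i j, measurable_fun setT (fun t => mxsqrt (M t) i j).
Proof.
move=> Msym mM i j; apply: measurable_fun_open => U oU.
(* Positive definite matrices, being symmetric, do not form an open set among all matrices.
   Composition with the symmetrization makes D and D' open and leaves the values of M unchanged. *)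
pose sym (A : 'M[R]_k) := 2^-1 *: (A + A^T).
have symT A : (sym A)^T = sym A.
  by rewrite /sym linearZ/= linearD/= trmxK addrC.
have symM t : sym (M t) = M t.
  by rewrite /sym Msym; apply/matrixP => i' j'; rewrite !mxE; field.
have csym (A : 'M[R]_k) : sym A' @[A' --> A] --> sym A.
  apply/(@cvg_matrixP _ _ _ _ _ (nbhs_filter A)) => i' j'; rewrite /sym !mxE.
  under eq_fun do rewrite !mxE.
  by apply: cvgM; [exact: cvg_cst|apply: cvgD; exact: coord_continuous].
pose D := [set A : 'M[R]_k | posdefmx (sym A) /\ U (mxsqrt (sym A) i j)].
pose D' := [set A : 'M[R]_k | posdefmx (sym A)].
have oD' : open D'.
  rewrite openE => A /= Apos; exact: (near_posdefmx symT Apos (csym A)).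
have oD : open D.
  rewrite openE => A /= [Apos UA].
  have near1 : \forall A' \near A, posdefmx (sym A').
    exact: (near_posdefmx symT Apos (csym A)).
  have sqc : mxsqrt (sym A') @[A' --> A] --> mxsqrt (sym A).
    exact: (cvg_mxsqrt symT Apos (csym A)).
  move/(@cvg_matrixP _ _ _ _ _ (nbhs_filter A)) : sqc => /(_ i j) sqc.
  have near2 : \forall A' \near A, U (mxsqrt (sym A') i j).
    by apply: sqc; exact: open_nbhs_nbhs.
  by apply: filterS2 near1 near2.
have bM := borel_measurable_mx mM.
have mD := bM _ oD; have mD' := bM _ oD'.
have [U0|U0] := pselect (U 0).
  have -> : (fun t => mxsqrt (M t) i j) @^-1` U = M @^-1` D `|` ~` (M @^-1` D').
    apply/seteqP; split=> [t /= Ut|t [[_]|]]; rewrite /D /D'/= ?symM//.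
      by have [|] := pselect (posdefmx (M t)); [left|right].
    by move=> /mxsqrt_junk ->; rewrite mxE.
  by apply: measurableU => //; exact: measurableC.
have -> : (fun t => mxsqrt (M t) i j) @^-1` U = M @^-1` D.
  apply/seteqP; split=> [t /= Ut|t [_]]; rewrite /D/= ?symM//; split=> //.
  by apply: contrapT => /mxsqrt_junk M0; move: Ut; rewrite M0 mxE.
exact: mD.
Qed.

End borel.

(** * Scaling and limits of the score and the information *)

Section score_scaling.
Context {R : realType} {q m : nat}.
Variables (px : 'I_m -> R) (s : 'I_q.+1 -> 'I_m -> R).
Hypotheses (px_ge0 : forall j, 0 <= px j) (s_gt0 : forall i j, 0 < s i j).
Implicit Types (t u v : 'rV[R]_(m + (q + q))) (om : 'I_q.+1 -> R).
Implicit Types (x : 'I_m -> R) (zeta : 'I_q.+1 * 'I_m -> R) (e : R).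
Local Notation ps := (eprec s).

(** In contrast to [Gf_gt0], the prior precisions may vanish, as they do in the limit: the reference
    laboratory, with slope 1, contributes a positive term. *)
Lemma Gf_pos (p : 'I_m -> R) om t j : (forall j, 0 <= p j) -> (forall i, 0 < om i) ->
  0 < Gf p ps om t j.
Proof.
move=> p0 om0; rewrite ltr_wpDl// big_ord_recl ltr_pwDl//.
  by rewrite /par_beta unlift_none !mulr1 mulr_gt0// eprec_gt0.
apply: sumr_ge0 => i _; rewrite mulr_ge0 -?expr2 ?sqr_ge0//.
by rewrite mulr_ge0 ?eprec_ge0// ltW.
Qed.

(** The sum of the errors of the cell (i, j), weighted by their precision and normalized by
    n^(-1/2). *)
Definition noise om zeta (i : 'I_q.+1) (j : 'I_m) : R :=
  Num.sqrt (om i) * zeta (i, j) / s i j.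

(* The sums of the observations, when the noise is expressed through the
   normalized sums zeta of the errors. *)
Definition data_totals (nn : 'I_q.+1 -> R) t x zeta (i : 'I_q.+1) (j : 'I_m) : R :=
  nn i * (par_alpha t i + par_beta t i * x j) + s i j * Num.sqrt (nn i) * zeta (i, j).

Definition noise_mean om t zeta j : R := \sum_i par_beta t i * noise om zeta i j.

(* The posterior mean of x_j given the observations. *)
Definition latent_mean e om t x zeta j : R :=
  x j + (e ^+ 2 * px j * (par_mu t j - x j) + e * noise_mean om t zeta j) /
        Gf (fun j => e ^+ 2 * px j) ps om t j.

(** The normalized score arranged without negative powers of e, hence continuous at e = 0. *)
Definition scaled_score e om t x zeta v : R :=
  \sum_j (- 2^-1 * e * (dGf ps om t v j / Gf (fun j => e ^+ 2 * px j) ps om t j)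
   - e * px j * (par_mu t j - latent_mean e om t x zeta j) * par_mu v j
   + \sum_i (par_alpha v i + latent_mean e om t x zeta j * lin_beta v i) * noise om zeta i j
   - (e * px j * (par_mu t j - x j) + noise_mean om t zeta j) /
       Gf (fun j => e ^+ 2 * px j) ps om t j *
     \sum_i om i * ps i j * par_beta t i *
       (par_alpha v i + latent_mean e om t x zeta j * lin_beta v i)).

(** The data are generated under the same t at which the score is taken, so the negative powers of e
    cancel. All terms are expressed through ra, rb, na, nb, f and g, which leaves an identity of
    rational functions. *)
Lemma dprofile_scaled e om t x zeta v : 0 < e -> (forall i, 0 < om i) ->
  e * dprofile px ps (fun i => om i / e ^+ 2)
        (data_totals (fun i => om i / e ^+ 2) t x zeta) t v =
  scaled_score e om t x zeta v.
Proof.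
move=> e0 om0; rewrite /dprofile mulrA mulr_sumr; apply: eq_bigr => j _.
set p := fun j : 'I_m => e ^+ 2 * px j.
have g0 : 0 < Gf p ps om t j by apply: Gf_pos => // j'; rewrite mulr_ge0// sqr_ge0.
set T := data_totals _ t x zeta.
pose ra := \sum_i om i * ps i j * par_beta t i * par_alpha v i.
pose rb := \sum_i om i * ps i j * par_beta t i * lin_beta v i.
pose na := \sum_i par_alpha v i * noise om zeta i j.
pose nb := \sum_i lin_beta v i * noise om zeta i j.
set g := Gf p ps om t j in g0 *; pose f := noise_mean om t zeta j.
have en0 : e != 0 by rewrite gt_eqF.
have gn0 : g != 0 by rewrite gt_eqF.
have sE i j' : ps i j' * s i j' = (s i j')^-1.
  by rewrite /eprec; field; rewrite gt_eqF.
have sqE i : Num.sqrt (om i / e ^+ 2) = Num.sqrt (om i) / e.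
  by rewrite sqrtrM ?ltW// sqrtrV ?sqr_ge0// sqrtr_sqr gtr0_norm.
have TE i : ps i j * (T i j - om i / e ^+ 2 * par_alpha t i) =
    (om i * ps i j * par_beta t i * x j + e * noise om zeta i j) / e ^+ 2.
  rewrite /T /data_totals sqE /noise -sE; field; by rewrite en0.
have gE : Gf px ps (fun i => om i / e ^+ 2) t j = g / e ^+ 2.
  rewrite /g /Gf mulrDl mulr_suml; congr (_ + _); first by rewrite /p; field.
  by apply: eq_bigr => i _; field.
have gB : \sum_i om i * ps i j * par_beta t i * par_beta t i = g - p j.
  rewrite /g /Gf addrC addKr; apply: eq_bigr => i _; ring.
have dgE : dGf ps om t v j = 2 * rb.
  by rewrite /dGf /rb mulr_sumr; apply: eq_bigr => i _; ring.
have dGE : dGf ps (fun i => om i / e ^+ 2) t v j = 2 * rb / e ^+ 2.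
  rewrite -dgE /dGf mulr_suml; apply: eq_bigr => i _; by field.
have BE : Bf px ps (fun i => om i / e ^+ 2) T t j =
    (p j * par_mu t j + x j * (g - p j) + e * f) / e ^+ 2.
  rewrite /Bf -gB /f /noise_mean !mulr_sumr -addrA -big_split/= mulrDl mulr_suml.
  congr (_ + _); first by rewrite /p; field.
  by apply: eq_bigr => i _; rewrite mulrCA mulNr TE; field.
have dBE : dBf px ps (fun i => om i / e ^+ 2) T t v j =
    (p j * par_mu v j + x j * rb + e * nb - ra) / e ^+ 2.
  rewrite /dBf /rb /nb /ra !mulr_sumr -!addrA -sumrB -big_split/= mulrDl mulr_suml.
  congr (_ + _); first by rewrite /p; field.
  apply: eq_bigr => i _; rewrite mulrBr mulrCA TE; field; by rewrite en0.
have dAE : dAf px ps (fun i => om i / e ^+ 2) T t v j =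
    2 * (p j * par_mu t j * par_mu v j - x j * ra - e * na) / e ^+ 2.
  rewrite /dAf /ra /na !mulr_sumr -addrA -opprD -big_split/=.
  set H := \sum_(i < _) (_ + _).
  have -> : 2 * (p j * par_mu t j * par_mu v j - H) / e ^+ 2 =
    2 * (p j * par_mu t j * par_mu v j) / e ^+ 2 + (- 2 / e ^+ 2) * H by ring.
  rewrite /H mulr_sumr; congr (_ + _); first by rewrite /p; field.
  apply: eq_bigr => i _.
  have -> : ps i j * (2 * (om i / e ^+ 2 * par_alpha t i - T i j) * par_alpha v i) =
    - 2 * (ps i j * (T i j - om i / e ^+ 2 * par_alpha t i)) * par_alpha v i by ring.
  by rewrite TE; field.
set xi := latent_mean e om t x zeta j.
have xiE : xi = x j + (p j * (par_mu t j - x j) + e * f) / g by [].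
have -> : \sum_i (par_alpha v i + xi * lin_beta v i) * noise om zeta i j = na + xi * nb.
  by rewrite /na /nb mulr_sumr -big_split/=; apply: eq_bigr => i _; ring.
have -> : \sum_i om i * ps i j * par_beta t i * (par_alpha v i + xi * lin_beta v i)
    = ra + xi * rb.
  by rewrite /ra /rb mulr_sumr -big_split/=; apply: eq_bigr => i _; ring.
rewrite gE dGE BE dBE dAE dgE -/f xiE /p; field.
by rewrite ?en0 ?gn0.
Qed.

(** G, A and B are homogeneous of degree 1 in (px, nn, T), hence so is A - B^2 / G, while the second
    derivative of ln G has degree 0 and keeps c as its weight. *)
Lemma ddprofile_scale (c : R) (nn : 'I_q.+1 -> R) (T : 'I_q.+1 -> 'I_m -> R) t u v :
  0 < c -> (forall i, 0 < nn i) ->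
  c * ddprofile px ps nn T 1 t u v =
  ddprofile (fun j => c * px j) ps (fun i => c * nn i) (fun i j => c * T i j) c t u v.
Proof.
move=> c0 nn0; rewrite /ddprofile mulrCA mulr_sumr; congr (_ * _).
apply: eq_bigr => j _.
have g0 : Gf px ps nn t j != 0 by rewrite gt_eqF// Gf_pos.
have -> : Gf (fun j => c * px j) ps (fun i => c * nn i) t j = c * Gf px ps nn t j.
  by rewrite /Gf mulrDr mulr_sumr; congr (_ + _); apply: eq_bigr => i _; ring.
have dGE w : dGf ps (fun i => c * nn i) t w j = c * dGf ps nn t w j.
  by rewrite /dGf mulr_sumr; apply: eq_bigr => i _; ring.
have -> : ddGf ps (fun i => c * nn i) u v j = c * ddGf ps nn u v j.
  by rewrite /ddGf mulr_sumr; apply: eq_bigr => i _; ring.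
have -> : Bf (fun j => c * px j) ps (fun i => c * nn i) (fun i j => c * T i j) t j
    = c * Bf px ps nn T t j.
  by rewrite /Bf mulrDr mulr_sumr mulrA; congr (_ + _); apply: eq_bigr => i _; ring.
have dBE w : dBf (fun j => c * px j) ps (fun i => c * nn i) (fun i j => c * T i j) t w j
    = c * dBf px ps nn T t w j.
  by rewrite /dBf mulrDr mulr_sumr mulrA; congr (_ + _); apply: eq_bigr => i _; ring.
have -> : ddBf ps (fun i => c * nn i) u v j = c * ddBf ps nn u v j.
  by rewrite /ddBf mulrN mulr_sumr; congr (- _); apply: eq_bigr => i _; ring.
have -> : ddAf (fun j => c * px j) ps (fun i => c * nn i) u v j = c * ddAf px ps nn u v j.
  by rewrite /ddAf mulrDr mulr_sumr; congr (_ + _); [ring|apply: eq_bigr => i _; ring].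
rewrite !dGE !dBE; field.
by rewrite ?g0 ?gt_eqF.
Qed.

End score_scaling.

Section limit_values.
Context {R : realType} {q m : nat}.
Variables (px : 'I_m -> R) (s : 'I_q.+1 -> 'I_m -> R) (w : 'I_q.+1 -> R).
Hypotheses (s_gt0 : forall i j, 0 < s i j) (w_gt0 : forall i, 0 < w i).
Implicit Types (theta u v : 'rV[R]_(m + (q + q))) (x : 'I_m -> R).
Local Notation ps := (eprec s).

Lemma Gf_limit (p : 'I_m -> R) theta j : p j = 0 -> Gf p ps w theta j = Ssum s w theta j.
Proof.
by move=> p0; rewrite /Gf p0 add0r; apply: eq_bigr => i _; rewrite /eprec; ring.
Qed.

Lemma scaled_score_limit theta x zeta v :
  scaled_score px s 0 w theta x zeta v =
  \sum_lj score_coef s w theta (dmean x v) lj * zeta lj.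
Proof.
transitivity (\sum_l \sum_j score_coef s w theta (dmean x v) (l, j) * zeta (l, j)); last first.
  by rewrite pair_bigA; apply: eq_bigr => -[].
rewrite exchange_big; apply: eq_bigr => j _.
have S0 := Ssum_gt0 s_gt0 w_gt0 theta j.
rewrite Gf_limit ?expr0n ?mul0r// mulr0 !mul0r subr0 add0r add0r.
have -> : latent_mean px s 0 w theta x zeta j = x j.
  by rewrite /latent_mean expr0n/= !mul0r addr0 mul0r addr0.
transitivity (\sum_i dmean x v i j * noise s w zeta i j -
  noise_mean s w theta zeta j * (sens s w theta (dmean x v) j / Ssum s w theta j)).
  congr (_ - _); rewrite mulrAC -mulrA; congr (_ * (_ / _)).
  by apply: eq_bigr => i _; rewrite /eprec /dmean; ring.
rewrite /noise_mean mulr_suml -sumrB; apply: eq_bigr => i _.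
rewrite /score_coef /noise/=; ring.
Qed.

Lemma ddprofile_limit (T : 'I_q.+1 -> 'I_m -> R) theta x u v :
  (forall i j, T i j = w i * (par_alpha theta i + par_beta theta i * x j)) ->
  - ddprofile (fun=> 0) ps w T 0 theta u v =
  \sum_lj score_coef s w theta (dmean x u) lj * score_coef s w theta (dmean x v) lj.
Proof.
move=> TE; rewrite score_coef_gram// /ddprofile -mulNr opprK mulr_sumr.
apply: eq_bigr => j _; rewrite Gf_limit//.
have S0 := Ssum_gt0 s_gt0 w_gt0 theta j; set S := Ssum s w theta j in S0 *.
pose r (d : 'I_q.+1 -> R) := \sum_i w i * ps i j * par_beta theta i * d i.
pose rho (d d' : 'I_q.+1 -> R) := \sum_i w i * ps i j * d i * d' i.
have sensE z : sens s w theta (dmean x z) j = r (par_alpha z) + x j * r (lin_beta z).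
  rewrite /r mulr_sumr -big_split/=; apply: eq_bigr => i _.
  by rewrite /dmean /eprec; ring.
have -> : \sum_i w i * dmean x u i j * dmean x v i j / s i j ^+ 2 =
  rho (par_alpha u) (par_alpha v) + x j * rho (par_alpha u) (lin_beta v)
  + x j * rho (lin_beta u) (par_alpha v) + x j ^+ 2 * rho (lin_beta u) (lin_beta v).
  rewrite /rho !mulr_sumr -!big_split/=; apply: eq_bigr => i _.
  by rewrite /dmean /eprec; ring.
have dGE z : dGf ps w theta z j = 2 * r (lin_beta z).
  by rewrite /dGf /r mulr_sumr; apply: eq_bigr => i _; ring.
have ddGE : ddGf ps w u v j = 2 * rho (lin_beta u) (lin_beta v).
  by rewrite /ddGf /rho mulr_sumr; apply: eq_bigr => i _; ring.
(* In the limit the posterior mean B / G is the true value x_j. *)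
have BE : Bf (fun=> 0) ps w T theta j = x j * S.
  rewrite /Bf mul0r add0r /S /Ssum mulr_sumr; apply: eq_bigr => i _.
  by rewrite TE /eprec; ring.
have dBE z : dBf (fun=> 0) ps w T theta z j = x j * r (lin_beta z) - r (par_alpha z).
  rewrite /dBf mul0r add0r /r mulr_sumr -sumrB; apply: eq_bigr => i _.
  by rewrite TE; ring.
have ddBE : ddBf ps w u v j = - rho (par_alpha u) (lin_beta v) - rho (lin_beta u) (par_alpha v).
  rewrite /ddBf -opprD /rho -big_split/=; congr (- _); apply: eq_bigr => i _; ring.
have ddAE : ddAf (fun=> 0) ps w u v j = 2 * rho (par_alpha u) (par_alpha v).
  by rewrite /ddAf mul0r add0r /rho mulr_sumr; apply: eq_bigr => i _; ring.
rewrite !sensE BE !dBE ddBE ddAE ddGE !dGE mul0r add0r; field.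
by rewrite gt_eqF.
Qed.

End limit_values.

(** * Limits of the scaled expressions *)

Section cvg_real.
Context {R : realType} (U : Type) (F : set_system U) {FF : Filter F}.
Implicit Types (f : U -> R).

Lemma cvg_pow f (a : R) n : f u @[u --> F] --> a -> f u ^+ n @[u --> F] --> a ^+ n.
Proof.
move=> fa; elim: n => [|n IH].
  by under eq_fun do rewrite expr0; rewrite expr0; exact: cvg_cst.
by under eq_fun do rewrite exprS; rewrite exprS; exact: cvgM.
Qed.

Lemma cvg_sqrt f (a : R) : f u @[u --> F] --> a -> Num.sqrt (f u) @[u --> F] --> Num.sqrt a.
Proof. by move=> fa; apply: (continuous_cvg _ _ fa); exact: sqrt_continuous. Qed.

End cvg_real.

(** Descends through sums, products, powers and roots. Inverses are left to [leaf], as their limits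
    must be nonzero. *)
Ltac cvg_algebra leaf := repeat lazymatch goal with
  | |- cvg_to (nbhs (fmap (fun _ => ?c) _)) _ => exact: cvg_cst
  | |- cvg_to (nbhs (fmap (fun u => Algebra.add (@?a u) (@?b u)) _)) _ => apply: cvgD
  | |- cvg_to (nbhs (fmap (fun u => Algebra.opp (@?a u)) _)) _ => apply: cvgN
  | |- cvg_to (nbhs (fmap (fun u => GRing.mul (@?a u) (@?b u)) _)) _ => apply: cvgM
  | |- cvg_to (nbhs (fmap (fun u => GRing.exp (@?a u) ?n) _)) _ => apply: cvg_pow
  | |- cvg_to (nbhs (fmap (fun u => Num.sqrt (@?a u)) _)) _ => apply: cvg_sqrt
  | |- cvg_to (nbhs (fmap (fun u => bigop _ _ (@?b u)) _)) _ => apply: cvg_sumr => ? ?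
  | |- _ => leaf
  end.

Section limits.
Context {R : realType} {q m : nat}.
Variable s : 'I_q.+1 -> 'I_m -> R.
Local Notation ps := (eprec s).
Context (U : Type) (F : set_system U) {FF : Filter F}.
Variables (t : U -> 'rV[R]_(m + (q + q))) (theta : 'rV[R]_(m + (q + q))).
Hypothesis t_cvg : t u @[u --> F] --> theta.

Lemma cvg_par_mu j : par_mu (t u) j @[u --> F] --> par_mu theta j.
Proof. by move/cvg_matrixP: t_cvg => /(_ 0 (lshift (q + q) j)). Qed.

Lemma cvg_par_alpha i : par_alpha (t u) i @[u --> F] --> par_alpha theta i.
Proof.
rewrite /par_alpha; case: (unlift ord0 i) => [i'|]; last exact: cvg_cst.
by move/cvg_matrixP: t_cvg => /(_ 0 (rshift m (lshift q i'))).
Qed.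

Lemma cvg_par_beta i : par_beta (t u) i @[u --> F] --> par_beta theta i.
Proof.
rewrite /par_beta; case: (unlift ord0 i) => [i'|]; last exact: cvg_cst.
by move/cvg_matrixP: t_cvg => /(_ 0 (rshift m (rshift q i'))).
Qed.

Variables (p : U -> 'I_m -> R) (p0 : 'I_m -> R).
Variables (om : U -> 'I_q.+1 -> R) (w : 'I_q.+1 -> R).
Hypothesis p_cvg : forall j, p u j @[u --> F] --> p0 j.
Hypothesis om_cvg : forall i, om u i @[u --> F] --> w i.

Ltac leaf := first [ exact: p_cvg | exact: om_cvg | exact: cvg_par_mu
  | exact: cvg_par_alpha | exact: cvg_par_beta ].

Lemma cvg_Gf j : Gf (p u) ps (om u) (t u) j @[u --> F] --> Gf p0 ps w theta j.
Proof. by rewrite /Gf; cvg_algebra leaf. Qed.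

Lemma cvg_dGf v j : dGf ps (om u) (t u) v j @[u --> F] --> dGf ps w theta v j.
Proof. by rewrite /dGf; cvg_algebra leaf. Qed.

Section second_derivative.
Variables (T : U -> 'I_q.+1 -> 'I_m -> R) (T0 : 'I_q.+1 -> 'I_m -> R).
Hypothesis T_cvg : forall i j, T u i j @[u --> F] --> T0 i j.
Variables (e : U -> R) (e0 : R).
Hypothesis e_cvg : e u @[u --> F] --> e0.
Hypothesis G0 : forall j, Gf p0 ps w theta j != 0.

Lemma cvg_ddprofile v v' :
  ddprofile (p u) ps (om u) (T u) (e u) (t u) v v' @[u --> F] -->
  ddprofile p0 ps w T0 e0 theta v v'.
Proof.
have cG := cvg_Gf; have cdG := cvg_dGf.
have cddG j : ddGf ps (om u) v v' j @[u --> F] --> ddGf ps w v v' j.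
  by rewrite /ddGf; cvg_algebra leaf.
have cB j : Bf (p u) ps (om u) (T u) (t u) j @[u --> F] --> Bf p0 ps w T0 theta j.
  by rewrite /Bf; cvg_algebra ltac:(first [exact: T_cvg | leaf]).
have cdB z j : dBf (p u) ps (om u) (T u) (t u) z j @[u --> F] --> dBf p0 ps w T0 theta z j.
  by rewrite /dBf; cvg_algebra ltac:(first [exact: T_cvg | leaf]).
have cddB j : ddBf ps (om u) v v' j @[u --> F] --> ddBf ps w v v' j.
  by rewrite /ddBf; cvg_algebra leaf.
have cddA j : ddAf (p u) ps (om u) v v' j @[u --> F] --> ddAf p0 ps w v v' j.
  by rewrite /ddAf; cvg_algebra leaf.
have cGi j n : (Gf (p u) ps (om u) (t u) j ^+ n)^-1 @[u --> F] --> (Gf p0 ps w theta j ^+ n)^-1.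
  by apply: cvgV; [exact: expf_neq0|exact: cvg_pow].
have cGi1 j : (Gf (p u) ps (om u) (t u) j)^-1 @[u --> F] --> (Gf p0 ps w theta j)^-1.
  by apply: cvgV.
rewrite /ddprofile; apply: cvgM; first exact: cvg_cst.
apply: cvg_sumr => j _; cvg_algebra ltac:(idtac; lazymatch goal with
  | |- cvg_to (nbhs (fmap (fun u => Gf _ _ _ _ _) _)) _ => exact: cG
  | |- cvg_to (nbhs (fmap (fun u => dGf _ _ _ _ _) _)) _ => exact: cdG
  | |- cvg_to (nbhs (fmap (fun u => ddGf _ _ _ _ _) _)) _ => exact: cddG
  | |- cvg_to (nbhs (fmap (fun u => Bf _ _ _ _ _ _) _)) _ => exact: cB
  | |- cvg_to (nbhs (fmap (fun u => dBf _ _ _ _ _ _ _) _)) _ => exact: cdB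
  | |- cvg_to (nbhs (fmap (fun u => ddBf _ _ _ _ _) _)) _ => exact: cddB
  | |- cvg_to (nbhs (fmap (fun u => ddAf _ _ _ _ _ _) _)) _ => exact: cddA
  | |- cvg_to (nbhs (fmap (fun u => GRing.inv _) _)) _ => first [exact: cGi1 | exact: cGi]
  | |- _ => exact: e_cvg end).
Qed.
End second_derivative.

End limits.

Section score_limit.
Context {R : realType} {q m : nat}.
Variables (px : 'I_m -> R) (s : 'I_q.+1 -> 'I_m -> R).
Local Notation ps := (eprec s).
Context (U : Type) (F : set_system U) {FF : Filter F}.
Variables (t : U -> 'rV[R]_(m + (q + q))) (theta : 'rV[R]_(m + (q + q))).
Hypothesis t_cvg : t u @[u --> F] --> theta.
Variables (om : U -> 'I_q.+1 -> R) (w : 'I_q.+1 -> R).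
Hypothesis om_cvg : forall i, om u i @[u --> F] --> w i.
Variables (e : U -> R) (e0 : R).
Hypothesis e_cvg : e u @[u --> F] --> e0.
Variables (x : U -> 'I_m -> R) (x0 : 'I_m -> R).
Hypothesis x_cvg : forall j, x u j @[u --> F] --> x0 j.
Variables (zeta : U -> 'I_q.+1 * 'I_m -> R) (zeta0 : 'I_q.+1 * 'I_m -> R).
Hypothesis zeta_cvg : forall k, zeta u k @[u --> F] --> zeta0 k.
Hypothesis G0 : forall j, Gf (fun j => e0 ^+ 2 * px j) ps w theta j != 0.

Lemma cvg_scaled_score v :
  scaled_score px s (e u) (om u) (t u) (x u) (zeta u) v @[u --> F] -->
  scaled_score px s e0 w theta x0 zeta0 v.
Proof.
have cp j : e u ^+ 2 * px j @[u --> F] --> e0 ^+ 2 * px j.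
  by apply: cvgM; [exact: cvg_pow|exact: cvg_cst].
have cG j : Gf (fun j => e u ^+ 2 * px j) ps (om u) (t u) j @[u --> F] -->
    Gf (fun j => e0 ^+ 2 * px j) ps w theta j.
  exact: (cvg_Gf t_cvg cp om_cvg).
have cdG j : dGf ps (om u) (t u) v j @[u --> F] --> dGf ps w theta v j.
  exact: cvg_dGf.
have cGi j : (Gf (fun j => e u ^+ 2 * px j) ps (om u) (t u) j)^-1 @[u --> F] -->
    (Gf (fun j => e0 ^+ 2 * px j) ps w theta j)^-1 by apply: cvgV.
have cn i j : noise s (om u) (zeta u) i j @[u --> F] --> noise s w zeta0 i j.
  rewrite /noise; apply: cvgM; last exact: cvg_cst.
  by apply: cvgM; [exact: cvg_sqrt|exact: zeta_cvg].
have cnm j : noise_mean s (om u) (t u) (zeta u) j @[u --> F] --> noise_mean s w theta zeta0 j.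
  by rewrite /noise_mean; apply: cvg_sumr => i _; apply: cvgM; [exact: cvg_par_beta|].
have cl j : latent_mean px s (e u) (om u) (t u) (x u) (zeta u) j @[u --> F] -->
    latent_mean px s e0 w theta x0 zeta0 j.
  rewrite /latent_mean; cvg_algebra ltac:(first [exact: x_cvg | exact: cvg_par_mu
    | exact: cGi | exact: cnm | exact: e_cvg]).
rewrite /scaled_score; cvg_algebra ltac:(first [exact: x_cvg | exact: cvg_par_mu
  | exact: cvg_par_beta | exact: om_cvg | exact: cl | exact: cGi | exact: cdG
  | exact: cn | exact: cnm | exact: e_cvg]).
Qed.

End score_limit.

(** * Standardized unobserved variables and cell sums *)

Section noise_family.
Context {R : realType} {q m : nat}.
Variables (sx : 'I_m -> R) (s : 'I_q.+1 -> 'I_m -> R).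
Hypotheses (sx_gt0 : forall j, 0 < sx j) (s_gt0 : forall i j, 0 < s i j).
Variables (N : 'I_q.+1 -> nat) (N_gt0 : forall i, (0 < N i)%N).

Lemma sum_obs_cell (i : 'I_q.+1) (j : 'I_m) (F : obs m N -> R) :
  \sum_(o : obs m N | (lab o == i) && (level o == j)) F o =
  \sum_(k < N i) F (Tagged (fun i => ('I_m * 'I_(N i))%type) (j, k)).
Proof.
rewrite (eq_bigl (fun o : obs m N => (level o == j) && (lab o == i))); last first.
  by move=> o; rewrite andbC.
rewrite big_mkcondr big_obs_level/= (bigD1 i)//= [X in _ + X]big1 ?addr0 => [|i' i'i].
  by apply: eq_bigr => k _; rewrite /lab/= eqxx.
by rewrite big1// => k _; rewrite /lab/= (negPf i'i).
Qed.

(** The rows are the coordinate vectors of the x_j and, for each cell, the indicator of its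
    replicates divided by sqrt(n_i). Distinct rows have disjoint supports, so the rows are
    orthonormal once n_i > 0; they send the standardized variables to [std_noise]. *)
Definition cell_average (l : 'I_m + 'I_q.+1 * 'I_m) (k : 'I_m + obs m N) : R :=
  match l, k with
  | inl j, inl j' => (j == j')%:R
  | inr (i, j), inr o =>
      if (lab o == i) && (level o == j) then (Num.sqrt (N i)%:R)^-1 else 0
  | _, _ => 0
  end.

Lemma cell_average_orth l l' :
  \sum_k cell_average l k * cell_average l' k = (l == l')%:R.
Proof.
rewrite big_sumType/=; case: l l' => [j|[i j]] [j'|[i' j']]/=.
- rewrite [X in _ + X]big1 ?addr0 => [|o _]; last by rewrite mul0r.
  rewrite (bigD1 j)//= eqxx mul1r big1 ?addr0 => [|k /negPf kj].
    by rewrite (inj_eq (@inl_inj _ _)) eq_sym.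
  by rewrite (eq_sym j) kj mul0r.
- by rewrite !big1 ?addr0// => k _; rewrite ?mul0r ?mulr0.
- by rewrite !big1 ?addr0// => k _; rewrite ?mul0r ?mulr0.
rewrite [X in X + _]big1 ?add0r => [|k _]; last by rewrite mul0r.
rewrite (inj_eq (@inr_inj _ _)); have [[<- <-]|ne] := eqVneq (i, j) (i', j').
  under eq_bigr => o _.
    rewrite (_ : _ * _ = if (lab o == i) && (level o == j) then (N i)%:R^-1 else 0); last first.
      case: ifP => _; last by rewrite mul0r.
      by rewrite -invfM -expr2 sqr_sqrtr// ler0n.
    over.
  rewrite -big_mkcond sum_obs_cell sumr_const card_ord -[LHS]mulr_natl divff//.
  by rewrite pnatr_eq0 -lt0n.
rewrite big1// => o _; case: ifP => [/andP[/eqP io /eqP jo]|_]; last by rewrite mul0r.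
case: ifP => [/andP[/eqP io' /eqP jo']|_]; last by rewrite mulr0.
by move: ne; rewrite -io -jo -io' -jo' eqxx.
Qed.

Context (theta : 'rV[R]_(m + (q + q))) d (T : measurableType d) (P : probability T R).
Variables (x : 'I_m -> {RV P >-> R}) (e : obs m N -> {RV P >-> R}).

Definition std_latent (j : 'I_m) (t : T) : R := (x j t - par_mu theta j) / sx j.

Definition std_error (ij : 'I_q.+1 * 'I_m) (t : T) : R :=
  \sum_(k < N ij.1) e (Tagged (fun i => ('I_m * 'I_(N i))%type) (ij.2, k)) t /
    s ij.1 ij.2 / Num.sqrt (N ij.1)%:R.

Definition std_noise (l : 'I_m + 'I_q.+1 * 'I_m) : T -> R :=
  match l with inl j => std_latent j | inr ij => std_error ij end.

Lemma std_noise_law : model_law sx s theta x e -> std_normal_family P std_noise.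
Proof.
case=> xlaw elaw ind.
pose X k : {RV P >-> R} := match k with inl j => x j | inr o => e o end.
have -> : std_noise = fun l t => \sum_k cell_average l k *
    ((X k t - match k with inl j => par_mu theta j | inr _ => 0 end) /
     match k with inl j => sx j | inr o => s (lab o) (level o) end).
  apply/funext => -[j|[i j]]; apply/funext => t; rewrite big_sumType/=.
    rewrite [X in _ = _ + X]big1 ?addr0 => [|o _]; last by rewrite mul0r.
    rewrite (bigD1 j)//= eqxx mul1r big1 ?addr0// => k /negPf kj.
    by rewrite (eq_sym j) kj mul0r.
  rewrite [X in _ = X + _]big1 ?add0r => [|k _]; last by rewrite mul0r.
  rewrite (eq_bigr (fun o : obs m N => if (lab o == i) && (level o == j) then
     e o t / s i j / Num.sqrt (N i)%:R else 0)); last first.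
    move=> o _; case: ifP => [/andP[/eqP -> /eqP ->]|_]; last by rewrite mul0r.
    by rewrite subr0 mulrC.
  by rewrite -big_mkcond sum_obs_cell.
apply: std_normal_family_orth; first exact: cell_average_orth.
apply: std_normal_family_standardize.
- by case.
- by case.
- move=> B mB; rewrite -(_ : [set t | forall k, B k ((match k with inl j => x j : T -> R
      | inr o => e o : T -> R end) t)] = [set t | forall k, B k (X k t)]); last first.
    by apply/seteqP; split=> t Bt k; have := Bt k; case: k.
  by rewrite ind//; apply: eq_bigr => -[].
Qed.

Lemma totals_std_noise t i j :
  totals (observation theta (fun j => x j t) (fun o => e o t)) i j =
  data_totals s (sizes N) theta (fun j => par_mu theta j + sx j * std_latent j t)
    (std_error^~ t) i j.
Proof.
rewrite /totals /observation /data_totals /lab /level/= big_split/= sumr_const card_ord.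
rewrite -(mulr_natl _ (N i)) /std_latent /std_error /sizes/=; congr (_ + _).
  by congr (_ * (_ + _ * _)); field; rewrite gt_eqF.
rewrite mulr_sumr; apply: eq_bigr => k _.
have r0 : Num.sqrt (N i)%:R != 0 :> R by rewrite gt_eqF// sqrtr_gt0 ltr0n.
by field; rewrite r0 gt_eqF.
Qed.

End noise_family.

Section statistics.
Context {R : realType} {q m : nat}.
Variables (px : 'I_m -> R) (s : 'I_q.+1 -> 'I_m -> R).
Hypothesis s_gt0 : forall i j, 0 < s i j.
Local Notation k := (m + (q + q))%N.
Implicit Types (t h : 'rV[R]_k) (om : 'I_q.+1 -> R) (e : R).
Implicit Types (x : 'I_m -> R) (zeta : 'I_q.+1 * 'I_m -> R).

Definition scaled_totals e om t x zeta (i : 'I_q.+1) (j : 'I_m) : R :=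
  om i * (par_alpha t i + par_beta t i * x j) +
  e * (s i j * Num.sqrt (om i) * zeta (i, j)).

(* With e = n^(-1/2) and om i = n_i / n these are the normalized score at t
   and the normalized observed information at h; e = 0 gives their limits. *)
Definition scaled_stat e om t h x zeta : 'rV[R]_k * 'M[R]_k :=
  (\row_a scaled_score px s e om t x zeta (unit_dir a),
   \matrix_(a, b) - ddprofile (fun j => e ^+ 2 * px j) (eprec s) om
     (scaled_totals e om t x zeta) (e ^+ 2) h (unit_dir a) (unit_dir b)).

Definition limit_stat om theta x zeta : 'rV[R]_k * 'M[R]_k :=
  (\row_a \sum_lj score_coef s om theta (dmean x (unit_dir a)) lj * zeta lj,
   Wmx s om theta x).

Lemma scaled_stat0 w theta x zeta : (forall i, 0 < w i) ->
  scaled_stat 0 w theta theta x zeta = limit_stat w theta x zeta.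
Proof.
move=> w0; congr pair.
  by apply/rowP => a; rewrite !mxE scaled_score_limit.
apply/matrixP => a b; rewrite mxE Wmx_gram//.
rewrite -(@ddprofile_limit _ _ _ s w s_gt0 w0 (scaled_totals 0 w theta x zeta)) => [|i j].
  by congr (- _); rewrite expr0n/=; congr ddprofile; apply/funext => j; rewrite mul0r.
by rewrite /scaled_totals mul0r addr0.
Qed.

(** The filter is arbitrary so that n, h and the noise can vary jointly. The arguments t and h are
    separate because the score is taken at theta^n and the information at h^n. *)
Lemma cvg_scaled_stat (U : Type) (F : set_system U) {FF : Filter F}
    (t h : U -> 'rV[R]_k) (theta : 'rV[R]_k) (om : U -> 'I_q.+1 -> R)
    (w : 'I_q.+1 -> R) (e : U -> R) (x : U -> 'I_m -> R) x0
    (zeta : U -> 'I_q.+1 * 'I_m -> R) zeta0 :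
  (forall i, 0 < w i) -> t u @[u --> F] --> theta -> h u @[u --> F] --> theta ->
  (forall i, om u i @[u --> F] --> w i) -> e u @[u --> F] --> 0 ->
  (forall j, x u j @[u --> F] --> x0 j) ->
  (forall lj, zeta u lj @[u --> F] --> zeta0 lj) ->
  scaled_stat (e u) (om u) (t u) (h u) (x u) (zeta u) @[u --> F] -->
  limit_stat w theta x0 zeta0.
Proof.
move=> w0 tF hF omF eF xF zF; rewrite -scaled_stat0//.
have G0 j : Gf (fun j => 0 ^+ 2 * px j) (eprec s) w theta j != 0.
  by rewrite gt_eqF// Gf_pos// => j'; rewrite expr0n mul0r.
rewrite /scaled_stat.
apply: (@cvg_pair _ _ _ F (nbhs (scaled_stat 0 w theta theta x0 zeta0).1)
  (nbhs (scaled_stat 0 w theta theta x0 zeta0).2)); apply/cvg_matrixP => a b.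
  under eq_fun do rewrite mxE; rewrite mxE.
  exact: (cvg_scaled_score tF omF eF xF zF G0).
under eq_fun do rewrite mxE; rewrite mxE; apply: cvgN.
have pF j : e u ^+ 2 * px j @[u --> F] --> 0 ^+ 2 * px j.
  by apply: cvgM; [exact: cvg_pow|exact: cvg_cst].
have TF i j : scaled_totals (e u) (om u) (t u) (x u) (zeta u) i j @[u --> F] -->
    scaled_totals 0 w theta x0 zeta0 i j.
  apply: cvgD.
    apply: cvgM; first exact: omF.
    apply: cvgD; first exact: cvg_par_alpha.
    by apply: cvgM; [exact: cvg_par_beta|exact: xF].
  apply: cvgM; first exact: eF.
  apply: cvgM; last exact: zF.
  by apply: cvgM; [exact: cvg_cst|exact: cvg_sqrt].
have e2F : e u ^+ 2 @[u --> F] --> (0 : R) ^+ 2 by exact: cvg_pow.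
exact: (cvg_ddprofile hF pF omF TF e2F G0).
Qed.

End statistics.

Section observed_statistics.
Context {R : realType} {q m : nat}.
Variables (sx : 'I_m -> R) (s : 'I_q.+1 -> 'I_m -> R).
Hypotheses (sx_gt0 : forall j, 0 < sx j) (s_gt0 : forall i j, 0 < s i j).
Variables (N : 'I_q.+1 -> nat) (N_gt0 : forall i, (0 < N i)%N).
Local Notation n := ((total_size N)%:R : R).

Lemma total_size_gt0 : 0 < n.
Proof. by rewrite ltr0n /total_size big_ord_recl ltn_addr. Qed.

(** Score and information depend on the data through [totals], so the representation by x and zeta
    is asked of these alone. It refers to t, the true parameter, while h is arbitrary. *)
Lemma normalized_stat (y : obs m N -> R) t h x zeta :
  totals y = data_totals s (sizes N) t x zeta ->
  ((Num.sqrt n)^-1 *: score sx s y t, n^-1 *: observed_information sx s y h) =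
  scaled_stat (xprec sx) s (Num.sqrt n)^-1 (fun i => (N i)%:R / n) t h x zeta.
Proof.
move=> yE; have n0 := total_size_gt0; set r := (Num.sqrt n)^-1.
have r0 : 0 < r by rewrite invr_gt0 sqrtr_gt0.
have r2 : r ^+ 2 = n^-1 by rewrite exprVn sqr_sqrtr// ltW.
have om0 i : 0 < (N i)%:R / n by rewrite divr_gt0// ltr0n.
have sizesE : sizes N = fun i => (N i)%:R / n / r ^+ 2.
  by apply/funext => i; rewrite r2 invrK divfK// gt_eqF.
have px0 j : 0 <= xprec sx j by rewrite ltW// xprec_gt0.
congr pair.
  apply/rowP => a; rewrite !mxE -(dprofile_scaled px0)//.
  by rewrite -sizesE -yE -scoreE// mxE.
apply/matrixP => a b; rewrite [LHS]mxE observed_informationE// mulrN [RHS]mxE.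
congr (- _); rewrite -r2 ddprofile_scale ?exprn_gt0// => [|i]; last by rewrite ltr0n.
rewrite yE; congr ddprofile.
  by apply/funext => i; rewrite r2 mulrC.
apply/funext => i; apply/funext => j; rewrite /data_totals /scaled_totals /sizes.
have sqE : Num.sqrt (N i)%:R = Num.sqrt ((N i)%:R / n) / r :> R.
  rewrite sqrtrM ?ler0n// sqrtrV ?ltW// -/r -mulrA.
  by rewrite divff ?mulr1// gt_eqF.
rewrite r2 sqE mulrDr; congr (_ + _); first by ring.
move: (Num.sqrt _) => S; rewrite -r2; clearbody r.
by rewrite expr2; field; rewrite gt_eqF.
Qed.

End observed_statistics.

(** * Convergence in distribution *)

Section uniform_on_boxes.
Context {R : realType} (K : finType) (U : Type) (F : set_system U) {FF : Filter F}.
Context {E : topologicalType}.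
Local Notation Z := (prod_topology (fun _ : K => R)).

(** Joint convergence at each point becomes uniform on the box, which is compact by Tychonoff's
    theorem. The abstract index u can carry n together with a value of h. *)
Lemma near_box (G : U -> (K -> R) -> E) (Phi : (K -> R) -> E) (f : E -> R) (M eps : R) :
  (forall z0 : Z, G p.1 p.2 @[p --> (F, nbhs z0)] --> Phi z0) ->
  (forall z0 : Z, Phi z @[z --> z0] --> Phi z0) ->
  continuous f -> 0 < eps ->
  \forall u \near F, forall z, (forall k, `|z k| <= M) ->
    `|f (G u z) - f (Phi z)| < eps.
Proof.
move=> cG cPhi cf eps0.
pose A := [set z : Z | forall k, `[- M, M]%classic (z k)].
have /compact_near_coveringP cA : compact A.
  exact: (@tychonoff K (fun=> R) (fun=> `[- M, M]%classic) (fun=> @segment_compact R _ _)).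
have e2 : 0 < eps / 2 by rewrite divr_gt0.
suff : \forall u \near F, A `<=` [set z | `|f (G u z) - f (Phi z)| < eps].
  apply: filterS => u Au z zM; apply: Au => k.
  by rewrite /= in_itv/= -ler_norml.
apply: (cA _ F (fun u z => `|f (G u z) - f (Phi z)| < eps)) => // z0 _.
have near_f : forall (X : Type) (FX : set_system X), Filter FX -> forall g : X -> E,
    g x @[x --> FX] --> Phi z0 ->
    \forall x \near FX, `|f (Phi z0) - f (g x)| < eps / 2.
  move=> X FX FFX g gX; have : f (g x) @[x --> FX] --> f (Phi z0).
    exact: (continuous_cvg _ (cf _) gX).
  by move/cvgrPdist_lt; apply.
have [[B1 B2] /= [FB1 NB2] B12] := near_f _ _ _ _ (cG z0).
have NB3 : nbhs z0 [set z : Z | `|f (Phi z0) - f (Phi z)| < eps / 2].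
  exact: (near_f Z _ (nbhs_filter z0) Phi (cPhi z0)).
exists (B2 `&` [set z : Z | `|f (Phi z0) - f (Phi z)| < eps / 2], B1).
  split; last exact: FB1.
  exact: (filterI NB2 NB3).
move=> [z u]/= [[Bz fz] Bu]; have fG := B12 (u, z) (conj Bu Bz).
rewrite (_ : _ - _ = (f (Phi z0) - f (Phi z)) - (f (Phi z0) - f (G u z))); last by ring.
apply: (le_lt_trans (ler_normB _ _)).
by rewrite [ltRHS]splitr ltrD.
Qed.

End uniform_on_boxes.

Section expectations.
Context {R : realType} d (T : measurableType d) (P : probability T R).
Implicit Types (X : T -> R).

Lemma probability_bounded_integrable X M : measurable_fun setT X ->
  (forall t, `|X t| <= M) -> P.-integrable setT (EFin \o X).
Proof.
move=> mX XM; apply: measurable_bounded_integrable => //.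
  exact: (le_lt_trans (probability_le1 P measurableT) (ltry _)).
exists M; split; rewrite ?num_real// => y My t _ /=.
exact: (le_trans (XM t) (ltW My)).
Qed.

Lemma expectation_Rintegral X M : measurable_fun setT X ->
  (forall t, `|X t| <= M) -> 'E_P[X]%E = (\int[P]_t X t)%:E.
Proof.
move=> mX XM; rewrite unlock fineK//.
by apply: integrable_fin_num => //; exact: probability_bounded_integrable mX XM.
Qed.

(** The integrands differ by at most eps on A and 2 M off it. A is meant to be the event that the
    noise lies in a box. *)
Lemma Rintegral_close X X' (A : set T) M eps : measurable A ->
  measurable_fun setT X -> measurable_fun setT X' ->
  (forall t, `|X t| <= M) -> (forall t, `|X' t| <= M) -> 0 <= eps ->
  (forall t, A t -> `|X t - X' t| <= eps) ->
  `|\int[P]_t X t - \int[P]_t X' t| <= eps + 2 * M * (1 - fine (P A)).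
Proof.
move=> mA mX mX' XM X'M eps0 close.
have iX := probability_bounded_integrable mX XM.
have iX' := probability_bounded_integrable mX' X'M.
have mD : measurable_fun setT (fun t => `|X t - X' t|).
  by apply: measurableT_comp => //; exact: measurable_funB.
have DM t : `|(`|X t - X' t|)| <= M + M.
  by rewrite normr_id (le_trans (ler_normB _ _))// lerD.
have iD := probability_bounded_integrable mD DM.
rewrite -RintegralB//; apply: (le_trans (le_normr_Rintegral _ _)) => //.
  by apply: (@probability_bounded_integrable (fun t => X t - X' t) (M + M));
    [exact: measurable_funB|move=> t; rewrite -[leLHS]normr_id].
pose Z t : R := eps + 2 * M * \1_(~` A) t.
have mI : measurable_fun setT (\1_(~` A) : T -> R).
  by apply: measurable_indic; exact: measurableC.
have I1 t : `|(\1_(~` A) t : R)| <= 1.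
  by rewrite indicE; case: (t \in _); rewrite ?normr1 ?normr0.
have iI := probability_bounded_integrable mI I1.
have PA : \int[P]_t (\1_(~` A) t : R) = 1 - fine (P A).
  rewrite /Rintegral integral_indic//; last exact: measurableC.
  rewrite setIT; apply: etrans (congr1 fine (probability_setC P mA)) _.
  by rewrite fineB// fin_num_measure.
rewrite (_ : _ + _ = \int[P]_t Z t); last first.
  rewrite RintegralD//=; last 2 first.
  - by apply: (@probability_bounded_integrable _ `|eps|).
  - apply: (@probability_bounded_integrable _ `|2 * M|) => [|t].
      exact: measurable_funM.
    by rewrite normrM ler_piMr.
  rewrite Rintegral_cst// RintegralZl// PA; congr (_ + _).
  by rewrite -[LHS]mulr1; congr (_ * _); apply/esym; exact: (congr1 fine (probability_setT P)).
apply: le_Rintegral => // [|t _].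
  apply: (@probability_bounded_integrable _ (`|eps| + `|2 * M|)) => [|t].
    by apply: measurable_funD => //; exact: measurable_funM.
  by rewrite (le_trans (ler_normD _ _))// lerD2l normrM ler_piMr.
rewrite /Z indicE; have [At|nAt] := pselect (A t).
  rewrite (_ : (t \in ~` A) = false) ?mulr0 ?addr0; first exact: close.
  by apply/negbTE; rewrite notin_setE/=; apply.
rewrite (_ : (t \in ~` A) = true) ?mulr1; last exact: mem_set.
apply: (le_trans (ler_normB _ _)); rewrite -[leLHS]add0r lerD//.
by rewrite mulr_natl mulr2n lerD.
Qed.

End expectations.

Section tightness.
Context {R : realType}.

(** One M serves all families on all sample spaces: the probability of a box is a power of the
    normal probability of [-n, n], with the fixed exponent #|K|. *)
Lemma std_normal_family_tight (K : finType) (delta : R) : 0 < delta ->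
  exists M : R, forall d (T : measurableType d) (P : probability T R) (V : K -> T -> R),
    std_normal_family P V ->
    1 - fine (P [set t | forall k, `|V k t| <= M]) < delta.
Proof.
move=> delta0; pose B n : set R := `[- n%:R, n%:R]%classic.
pose g n : R := fine (normal_prob 0 1 (B n)).
have mB n : measurable (B n) by exact: measurable_itv.
have g1 : g n @[n --> \oo] --> (1 : R).
  apply: fine_cvg; rewrite -(probability_setT (@normal_prob R 0 1)).
  have -> : [set: measurableTypeR R] = \bigcup_n B n.
    apply/seteqP; split=> // r _; exists (Num.truncn `|r|).+1 => //.
    by rewrite /B/= in_itv/= -ler_norml ltW// truncnS_gt.
  apply: nondecreasing_cvg_mu => //; first exact: bigcupT_measurable.
  move=> n n' nn'; apply/subsetPset => r; rewrite /B/= !in_itv/= -!ler_norml => /le_trans.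
  by apply; rewrite ler_nat.
have : \forall n \near \oo, `|1 - g n ^+ #|K| | < delta.
  have : g n ^+ #|K| @[n --> \oo] --> (1 : R) ^+ #|K| by exact: cvg_pow.
  by rewrite expr1n => /cvgrPdist_lt; apply.
case=> n _ /(_ n (leqnn n)) gn; exists n%:R => d T P V [_ VP].
suff -> : fine (P [set t | forall k, `|V k t| <= n%:R]) = g n ^+ #|K|.
  exact: le_lt_trans (ler_norm _) gn.
have -> : [set t | forall k, `|V k t| <= n%:R] = [set t | forall k, B n (V k t)].
  by apply/seteqP; split=> t Vt k; have := Vt k; rewrite /B/= in_itv/= ler_norml.
rewrite (VP (fun=> B n))// -prodr_const.
rewrite (_ : (\prod_k _)%E = (\prod_(k in K) g n)%:E)//.
rewrite (big_morph EFin EFinM erefl); apply: eq_bigr => k _.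
by apply/esym/fineK; exact: (fin_num_measure (normal_prob 0 1) _ (mB n)).
Qed.

End tightness.

Section nondegeneracy.
Context {R : realType} d (T : measurableType d) (P : probability T R).

(** Divided by the norm of a, the combination is one standard normal variable, by the rotation lemma
    with a single row; its law has a density and charges no point. *)
Lemma std_normal_family_linear_neq (K : finType) (V : K -> T -> R) (a : K -> R) (c : R) :
  std_normal_family P V -> 0 < \sum_k a k ^+ 2 ->
  {ae P, forall t, \sum_k a k * V k t != c}.
Proof.
move=> Vstd a0; set r := Num.sqrt (\sum_k a k ^+ 2).
have r0 : 0 < r by rewrite sqrtr_gt0.
have [mU UP] : std_normal_family P (fun (_ : unit) t => \sum_k (a k / r) * V k t).
  apply: (std_normal_family_orth (O := fun _ k => a k / r)) => // -[] [].
  rewrite (eq_bigr (fun k => a k ^+ 2 / r ^+ 2)) => [|k _]; last first.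
    by rewrite -expr2 expr_div_n.
  by rewrite -mulr_suml sqr_sqrtr ?ltW// divff// gt_eqF.
exists [set t | forall i : unit, [set c / r]%classic (\sum_k (a k / r) * V k t)]; split.
- by apply: measurable_forall => i; apply: (measurable_preimage (mU i)).
- rewrite (UP (fun=> [set c / r]%classic))// (bigD1 tt)//=.
  have -> : normal_prob 0 1 [set c / r] = 0%E :> \bar R.
    have := @normal_prob_dominates R 0 1; move/null_content_dominatesP; apply => //.
    exact: lebesgue_measure_set1.
  by rewrite mul0e.
- move=> t /= nE _; have /eqP <- : \sum_k a k * V k t == c by apply/negPn/negP.
  by rewrite mulr_suml; apply: eq_bigr => k _; rewrite mulrAC.
Qed.

End nondegeneracy.

(** * Whitening of the limit score *)

Section limit_transformation.
Context {R : realType} {q m : nat}.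
Variables (s : 'I_q.+1 -> 'I_m -> R) (w : 'I_q.+1 -> R).
Hypotheses (s_gt0 : forall i j, 0 < s i j) (w_gt0 : forall i, 0 < w i).
Variable (theta : 'rV[R]_(m + (q + q))).
Implicit Types (x : 'I_m -> R) (zeta : 'I_q.+1 * 'I_m -> R).
Local Notation C x := (mxsqrt (Wtilde s w theta x)).

(* Written with the adjugate, the inverse of the square root of W~ is visibly
   measurable. *)
Definition whitening x (l : 'I_(q + q)) (lj : 'I_q.+1 * 'I_m) : R :=
  \sum_h (\det (C x))^-1 * \adj (C x) l h * bias_coef s w theta x h lj.

Lemma whiteningE x l lj : posdefmx (Wtilde s w theta x) ->
  whitening x l lj = (invmx (C x) *m \col_h bias_coef s w theta x h lj) l 0.
Proof.
move=> /mxsqrtP [/posdefmx_unit uC _]; rewrite [RHS]mxE; apply: eq_bigr => h _.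
by rewrite /invmx uC !mxE.
Qed.

(** C^-1 W~ C^-1 = 1 for C = W~^(1/2), and W~ is the sum of b b^T over the cells, b being the vector
    of [bias_coef]. *)
Lemma whitening_orth x : posdefmx (Wtilde s w theta x) -> forall l l',
  \sum_lj whitening x l lj * whitening x l' lj = (l == l')%:R.
Proof.
move=> pW l l'; have [[Csym pC] CC] := mxsqrtP pW.
have uC : C x \in unitmx by exact: posdefmx_unit.
pose b lj : 'cV[R]_(q + q) := \col_h bias_coef s w theta x h lj.
have gram : \sum_lj b lj *m (b lj)^T = Wtilde s w theta x.
  apply/matrixP => h h'; rewrite summxE Wtilde_gram//; apply: eq_bigr => lj _.
  by rewrite mxE big_ord1 !mxE.
transitivity ((invmx (C x) *m (\sum_lj b lj *m (b lj)^T) *m (invmx (C x))^T) l l').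
  rewrite mulmx_sumr mulmx_suml summxE; apply: eq_bigr => lj _.
  rewrite !whiteningE// -!mulmxA -trmx_mul mulmxA.
  by rewrite [RHS]mxE big_ord1 [X in _ = _ * X]mxE.
by rewrite gram -[X in invmx _ *m X]CC trmx_inv Csym mulmxA mulVmx// mul1mx mulmxV// mxE.
Qed.

Lemma whitening_sqrt x zeta : posdefmx (Wtilde s w theta x) ->
  limit_stat s w theta x zeta =
  (Hvec s w theta x (fun l => \sum_lj whitening x l lj * zeta lj), Wmx s w theta x).
Proof.
move=> pW; have [[Csym pC] CC] := mxsqrtP pW.
have uC : C x \in unitmx by exact: posdefmx_unit.
congr pair; apply/rowP => a; rewrite mxE; case: (split_ordP a) => [j ->|h ->].
  rewrite row_mxEl mxE big1// => lj _; rewrite /score_coef /sens.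
  rewrite big1 => [|i _]; last by rewrite dmean_mu mulr0 mul0r.
  by rewrite dmean_mu mulr0 mul0r subr0 mulr0 mul0r.
rewrite row_mxEr mxE; apply/esym.
transitivity ((C x *m (invmx (C x) *m \sum_lj zeta lj *: \col_h bias_coef s w theta x h lj)) h 0).
  congr (fun_of_matrix (_ *m _) h 0); apply/colP => l.
  rewrite mxE mulmx_sumr summxE; apply: eq_bigr => lj _.
  by rewrite whiteningE// -scalemxAr [RHS]mxE mulrC.
rewrite mulKVmx// summxE; apply: eq_bigr => lj _.
by rewrite !mxE mulrC.
Qed.

Context d (T : measurableType d) (xT : T -> 'I_m -> R).
Hypothesis mx : forall j, measurable_fun setT (fun t => xT t j).

Lemma measurable_score_coef (D : T -> 'I_q.+1 -> 'I_m -> R) lj :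
  (forall i j, measurable_fun setT (fun t => D t i j)) ->
  measurable_fun setT (fun t => score_coef s w theta (D t) lj).
Proof.
move=> mD; apply: measurable_funM => //; apply: measurable_funB => //.
apply: measurable_funM => //; apply: measurable_funM => //.
by apply: measurable_sum => i; apply: measurable_funM => //; exact: measurable_funM.
Qed.

Lemma measurable_bias_coef h lj :
  measurable_fun setT (fun t => bias_coef s w theta (xT t) h lj).
Proof.
apply: measurable_score_coef => i j; apply: measurable_funD => //.
exact: measurable_funM.
Qed.

Lemma measurable_Wmx h l : measurable_fun setT (fun t => Wmx s w theta (xT t) h l).
Proof.
under eq_fun do rewrite Wmx_gram//.
apply: measurable_sum => lj; apply: measurable_funM; apply: measurable_score_coef => i j;
  by apply: measurable_funD => //; exact: measurable_funM.
Qed.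

Lemma measurable_sqrt_Wtilde h l : measurable_fun setT (fun t => C (xT t) h l).
Proof.
apply: measurable_mxsqrt => [t|i j]; first exact: Wtilde_sym.
by under eq_fun do rewrite mxE mxE; exact: measurable_Wmx.
Qed.

Lemma measurable_whitening l lj : measurable_fun setT (fun t => whitening (xT t) l lj).
Proof.
apply: measurable_sum => h; apply: measurable_funM; last exact: measurable_bias_coef.
have mC := measurable_sqrt_Wtilde.
apply: measurable_funM; last exact: measurable_adj.
by apply: measurable_funV; exact: measurable_det.
Qed.

Lemma measurable_Hvec (z : T -> 'I_(q + q) -> R) a :
  (forall l, measurable_fun setT (fun t => z t l)) ->
  measurable_fun setT (fun t => Hvec s w theta (xT t) (z t) 0 a).
Proof.
move=> mz; case: (split_ordP a) => [j ->|h ->].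
  by under eq_fun do rewrite row_mxEl mxE; exact: measurable_cst.
under eq_fun do rewrite row_mxEr mxE mxE.
apply: measurable_sum => l; under eq_fun do rewrite [X in _ * X]mxE.
by apply: measurable_funM => //; exact: measurable_sqrt_Wtilde.
Qed.

End limit_transformation.

Ltac measurable_algebra leaf := repeat lazymatch goal with
  | |- measurable_fun _ (fun _ => ?c) => exact: measurable_cst
  | |- measurable_fun _ (fun u => Algebra.add (@?a u) (@?b u)) => apply: measurable_funD
  | |- measurable_fun _ (fun u => Algebra.opp (@?a u)) => apply: measurable_funN
  | |- measurable_fun _ (fun u => GRing.mul (@?a u) (@?b u)) => apply: measurable_funM
  | |- measurable_fun _ (fun u => GRing.inv (@?a u)) => apply: measurable_funV
  | |- measurable_fun _ (fun u => GRing.exp (@?a u) ?n) => apply: measurable_funX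
  | |- measurable_fun _ (fun u => bigop _ _ (@?b u)) => apply: measurable_sum => ?
  | |- _ => leaf
  end.

Section measurable_statistics.
Context {R : realType} {q m : nat}.
Variables (sx : 'I_m -> R) (s : 'I_q.+1 -> 'I_m -> R).
Hypotheses (sx_gt0 : forall j, 0 < sx j) (s_gt0 : forall i j, 0 < s i j).
Variable (N : 'I_q.+1 -> nat).
Context d (T : measurableType d).
Variables (Y : T -> obs m N -> R) (h : T -> 'rV[R]_(m + (q + q))).
Hypothesis mY : forall o, measurable_fun setT (fun t => Y t o).
Hypothesis mh : forall a, measurable_fun setT (fun t => h t 0 a).

Let mmu j : measurable_fun setT (fun t => par_mu (h t) j).
Proof. exact: mh. Qed.

Let malpha i : measurable_fun setT (fun t => par_alpha (h t) i).
Proof. by rewrite /par_alpha; case: (unlift ord0 i) => // i'; exact: measurable_cst. Qed.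

Let mbeta i : measurable_fun setT (fun t => par_beta (h t) i).
Proof. by rewrite /par_beta; case: (unlift ord0 i) => // i'; exact: measurable_cst. Qed.

Let mtotals i j : measurable_fun setT (fun t => totals (Y t) i j).
Proof. by apply: measurable_sum => k. Qed.

Ltac leaf := first [exact: mtotals | exact: mmu | exact: malpha | exact: mbeta].

Let mG px j : measurable_fun setT (fun t => Gf px (eprec s) (sizes N) (h t) j).
Proof. by rewrite /Gf; measurable_algebra leaf. Qed.

Let mdG v j : measurable_fun setT (fun t => dGf (eprec s) (sizes N) (h t) v j).
Proof. by rewrite /dGf; measurable_algebra leaf. Qed.

Let mB px j :
  measurable_fun setT (fun t => Bf px (eprec s) (sizes N) (totals (Y t)) (h t) j).
Proof. by rewrite /Bf; measurable_algebra leaf. Qed.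

Let mdB px v j :
  measurable_fun setT (fun t => dBf px (eprec s) (sizes N) (totals (Y t)) (h t) v j).
Proof. by rewrite /dBf; measurable_algebra leaf. Qed.

Let mdA px v j :
  measurable_fun setT (fun t => dAf px (eprec s) (sizes N) (totals (Y t)) (h t) v j).
Proof. by rewrite /dAf; measurable_algebra leaf. Qed.

Ltac leaf2 := idtac; lazymatch goal with
  | |- measurable_fun _ (fun u => Gf _ _ _ _ _) => exact: mG
  | |- measurable_fun _ (fun u => dGf _ _ _ _ _) => exact: mdG
  | |- measurable_fun _ (fun u => Bf _ _ _ _ _ _) => exact: mB
  | |- measurable_fun _ (fun u => dBf _ _ _ _ _ _ _) => exact: mdB
  | |- measurable_fun _ (fun u => dAf _ _ _ _ _ _ _) => exact: mdA
  | |- _ => exact: measurable_cst end.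

(** Measurability is required for every n, even if some laboratory has no replicate yet. It is read
    off the formulas in the totals, which hold for all sizes. *)
Lemma measurable_score a : measurable_fun setT (fun t => score sx s (Y t) (h t) 0 a).
Proof.
rewrite (funext (fun t => scoreE sx_gt0 s_gt0 (Y t) (h t) a)).
by rewrite /dprofile; measurable_algebra leaf2.
Qed.

Lemma measurable_observed_information a b :
  measurable_fun setT (fun t => observed_information sx s (Y t) (h t) a b).
Proof.
rewrite (funext (fun t => observed_informationE sx_gt0 s_gt0 (Y t) (h t) a b)).
by rewrite /ddprofile; measurable_algebra leaf2.
Qed.

End measurable_statistics.

Section asymptotics.
Context {R : realType} (K : finType) (E : topologicalType).
Context (d : nat -> measure_display) (T : forall nu, measurableType (d nu)).
Variables (P : forall nu, probability (T nu) R).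

(** The expectation of f (Phi (V nu)) is the same number l on all sample spaces. The distance to it
    is split over a box, where f (X nu) is eventually uniformly close, and its complement; tightness
    fixes the box before nu. *)
Lemma cvg_expectation_std_normal (V : forall nu, K -> T nu -> R)
    (X : forall nu, T nu -> E) (Phi : (K -> R) -> E) (f : E -> R) (l B : R) :
  (forall x, `|f x| <= B) ->
  (forall nu, measurable_fun setT (fun t => f (X nu t))) ->
  measurable_fun setT (fun tau => f (Phi (untuple tau))) ->
  (\forall nu \near \oo, std_normal_family (P nu) (V nu)) ->
  (forall nu, std_normal_family (P nu) (V nu) ->
     \int[P nu]_t f (Phi (V nu ^~ t)) = l) ->
  (forall M eps, 0 < eps -> \forall nu \near \oo, forall t,
     (forall k, `|V nu k t| <= M) ->
     `|f (X nu t) - f (Phi (V nu ^~ t))| < eps) ->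
  'E_(P nu)[fun t => f (X nu t)]%E @[nu --> \oo] --> l%:E.
Proof.
move=> fB mfX mPhi Vstd intPhi close.
rewrite (funext (fun nu => expectation_Rintegral (P nu) (mfX nu) (fun t => fB _))).
apply: cvg_EFin; first by near=> nu.
apply/cvgrPdist_lt => eps eps0.
have B0 : 0 <= B by exact: le_trans (normr_ge0 _) (fB (Phi (fun=> 0))).
have e2 : 0 < eps / 2 by rewrite divr_gt0.
(* Off the box the integrands differ by at most 2 B, so a complement of this mass costs less than
   eps / 2; the 1 covers B = 0. *)
have d0 : 0 < eps / 2 / (2 * B + 1) by rewrite divr_gt0// ltr_wpDl// mulr_ge0.
have [M tight] := std_normal_family_tight K d0.
near=> nu => /=.
have nuStd : std_normal_family (P nu) (V nu) by near: nu.
have cl : forall t, (forall k, `|V nu k t| <= M) ->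
    `|f (X nu t) - f (Phi (V nu ^~ t))| < eps / 2.
  by near: nu; exact: close.
have [mV _] := nuStd; have PA := tight _ _ _ _ nuStd.
rewrite distrC -(intPhi nu nuStd).
pose A := [set t | forall k, `|V nu k t| <= M].
have mA : measurable A.
  have -> : A = [set t | forall k, `[- M, M]%classic (V nu k t)].
    by apply/seteqP; split=> t At k; have := At k; rewrite /= in_itv/= ler_norml.
  by apply: measurable_forall => k; exact: (measurable_preimage (mV k)).
have mPhiV : measurable_fun setT (fun t => f (Phi (V nu ^~ t))).
  exact: (measurable_family_comp (f := fun v => f (Phi v))).
apply: (@le_lt_trans _ _ (eps / 2 + 2 * B * (1 - fine (P nu A)))).
  apply: Rintegral_close => //; first exact: ltW.
  by move=> t At; apply: ltW; exact: cl.
rewrite [ltRHS]splitr ltrD2l (@le_lt_trans _ _ ((2 * B) * (eps / 2 / (2 * B + 1))))//.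
  by rewrite ler_wpM2l ?mulr_ge0// ltW.
rewrite mulrCA gtr_pMr// ltr_pdivrMr ?mul1r ?ltrDl//.
by rewrite ltr_wpDl// mulr_ge0.
Unshelve. all: by end_near. Qed.

End asymptotics.

(** * The law of the limit statistic *)

Section limit_law.
Context {R : realType} {q m : nat} (m_gt1 : (2 <= m)%N).
Variables (sx : 'I_m -> R) (s : 'I_q.+1 -> 'I_m -> R) (w : 'I_q.+1 -> R).
Hypotheses (sx_gt0 : forall j, 0 < sx j) (s_gt0 : forall i j, 0 < s i j).
Hypothesis w_gt0 : forall i, 0 < w i.
Variable (theta : 'rV[R]_(m + (q + q))).

Definition latent (t : 'rV[R]_(m + (q + q))) (xi : 'I_m -> R) (j : 'I_m) : R :=
  par_mu t j + sx j * xi j.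

Lemma measurable_latent d (T : measurableType d) (xi : T -> 'I_m -> R) j :
  measurable_fun setT (fun t => xi t j) ->
  measurable_fun setT (fun t => latent theta (xi t) j).
Proof. by move=> mxi; apply: measurable_funD => //; exact: measurable_funM. Qed.

(** Two levels suffice: the difference of their x_j is a nonconstant affine function of the noise,
    hence almost surely nonzero. *)
Lemma Wtilde_posdef_ae d (T : measurableType d) (P : probability T R)
    (J : finType) (V : 'I_m + J -> T -> R) : std_normal_family P V ->
  {ae P, forall t,
    posdefmx (Wtilde s w theta (latent theta (fun j => V (inl j) t)))}.
Proof.
move=> /(std_normal_family_sub (@inl_inj _ J)) Vstd.
pose j0 := Ordinal (ltnW m_gt1); pose j1 := Ordinal m_gt1.
pose a j := sx j * ((j == j0)%:R - (j == j1)%:R).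
have aE (F : 'I_m -> R) : \sum_j a j * F j = sx j0 * F j0 - sx j1 * F j1.
  transitivity (\sum_j (sx j * F j * (j == j0)%:R) - \sum_j (sx j * F j * (j == j1)%:R)).
    by rewrite -sumrB; apply: eq_bigr => j _; rewrite /a; ring.
  have sel i : \sum_j (sx j * F j * (j == i)%:R) = sx i * F i.
    by rewrite (bigD1 i)//= eqxx mulr1 big1 ?addr0// => j /negPf ->; rewrite mulr0.
  by rewrite !sel.
have a0 : 0 < \sum_k a k ^+ 2.
  under eq_bigr do rewrite expr2; rewrite aE /a !eqxx/= subr0 sub0r.
  by rewrite mulr1 mulrN1 mulrN opprK addr_gt0 ?mulr_gt0.
have := std_normal_family_linear_neq (par_mu theta j1 - par_mu theta j0) Vstd a0.
apply: filterS => t; rewrite aE => ne; apply: (@Wtilde_posdef _ _ _ _ _ s_gt0 w_gt0 _ _ j0 j1).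
apply: contra_neq ne; rewrite /latent => /eqP; rewrite -subr_eq0 => /eqP xE.
by apply/eqP; rewrite -subr_eq0; apply/eqP; rewrite -[RHS]xE; ring.
Qed.

(** By the random rotation, xi and the whitened noise form a standard normal family V0, with the law
    of V' although V' lives on another space. Almost surely [limit_stat] is the same function of V0
    as the right-hand integrand is of V'. *)
Lemma limit_stat_law d (T : measurableType d) (P : probability T R)
    (V : 'I_m + 'I_q.+1 * 'I_m -> T -> R)
    d' (T' : measurableType d') (P' : probability T' R)
    (V' : 'I_m + 'I_(q + q) -> T' -> R)
    (f : 'rV[R]_(m + (q + q)) * 'M[R]_(m + (q + q)) -> R) (B : R) :
  std_normal_family P V -> std_normal_family P' V' ->
  continuous f -> (forall x, `|f x| <= B) ->
  \int[P]_t f (limit_stat s w theta (latent theta (fun j => V (inl j) t))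
                 (fun lj => V (inr lj) t)) =
  \int[P']_t f (Hvec s w theta (latent theta (fun j => V' (inl j) t))
                  (fun l => V' (inr l) t),
                Wmx s w theta (latent theta (fun j => V' (inl j) t))).
Proof.
move=> Vstd V'std cf fB; have [mV _] := Vstd.
pose O xi := whitening s w theta (latent theta xi).
pose V0 (k : 'I_m + 'I_(q + q)) : T -> R := match k with
  | inl j => V (inl j)
  | inr l => fun t => \sum_lj O (fun j => V (inl j) t) l lj * V (inr lj) t end.
have V0std : std_normal_family P V0.
  apply: (std_normal_family_random_orth (O := O)) => // [l lj|].
    apply: measurable_whitening => // j; apply: measurable_latent.
    exact: measurable_untuple.
  apply: filterS (Wtilde_posdef_ae Vstd) => t; exact: whitening_orth.
pose Phi (v : 'I_m + 'I_(q + q) -> R) :=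
  (Hvec s w theta (latent theta (fun j => v (inl j))) (fun l => v (inr l)),
   Wmx s w theta (latent theta (fun j => v (inl j)))).
have mfpair (d1 : measure_display) (T1 : measurableType d1)
    (X1 : T1 -> 'rV[R]_(m + (q + q))) (X2 : T1 -> 'M[R]_(m + (q + q))) :
    (forall i j, measurable_fun setT (fun t => X1 t i j)) ->
    (forall i j, measurable_fun setT (fun t => X2 t i j)) ->
    measurable_fun setT (fun t => f (X1 t, X2 t)).
  by move=> mX1 mX2; exact: (borel_measurable_continuous (borel_measurable_mx2 mX1 mX2)).
have mPhi : measurable_fun setT (fun tau => f (Phi (untuple tau))).
  apply: mfpair => [i j|i j].
    rewrite ord1; apply: measurable_Hvec => // [k|k]; last exact: measurable_untuple.
    by apply: measurable_latent; exact: measurable_untuple.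
  by apply: measurable_Wmx => // k; apply: measurable_latent; exact: measurable_untuple.
have mlatent j : measurable_fun setT (fun t => latent theta (fun j => V (inl j) t) j).
  by apply: measurable_latent.
have boxE A : (forall k, measurable (A k)) ->
    P [set t | forall k, A k (V0 k t)] = P' [set t | forall k, A k (V' k t)].
  by move=> mA; rewrite (proj2 V0std)// (proj2 V'std).
have Pfin : (P setT < +oo)%E by exact: (le_lt_trans (probability_le1 P measurableT) (ltry _)).
have := law_unique_integral (f := fun v => f (Phi v)) (proj1 V0std) (proj1 V'std)
  Pfin boxE mPhi (ex_intro _ B (fun v => fB (Phi v))).
rewrite /Rintegral => <-; congr fine; apply: ae_eq_integral => //.
- apply/measurable_EFinP; apply: mfpair => i j; last exact: measurable_Wmx.
  under eq_fun do rewrite mxE; apply: measurable_sum => lj.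
  apply: measurable_funM => //; apply: measurable_score_coef => i' j'.
  by apply: measurable_funD => //; exact: measurable_funM.
- apply/measurable_EFinP; apply: (measurable_family_comp (f := fun v => f (Phi v))) => //.
  by case: V0std.
- apply: filterS (Wtilde_posdef_ae Vstd) => t pW _; congr EFin; congr f.
  exact: whitening_sqrt.
Qed.

End limit_law.

Section cvg_latent.
Context {R : realType} {q m : nat}.
Variables (px sx : 'I_m -> R) (s : 'I_q.+1 -> 'I_m -> R) (w : 'I_q.+1 -> R).
Hypotheses (s_gt0 : forall i j, 0 < s i j) (w_gt0 : forall i, 0 < w i).

(** The unobserved values are rebuilt from noise of fixed law with the moving parameter, mu_j + sx_j
    xi_j; in this way the x_j under theta^n turn into those under theta. *)
Lemma cvg_scaled_stat_latent (U : Type) (F : set_system U) {FF : Filter F}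
    (t h : U -> 'rV[R]_(m + (q + q))) (theta : 'rV[R]_(m + (q + q)))
    (om : U -> 'I_q.+1 -> R) (e : U -> R)
    (v : U -> 'I_m + 'I_q.+1 * 'I_m -> R) (v0 : 'I_m + 'I_q.+1 * 'I_m -> R) :
  t u @[u --> F] --> theta -> h u @[u --> F] --> theta ->
  (forall i, om u i @[u --> F] --> w i) -> e u @[u --> F] --> 0 ->
  (forall k, v u k @[u --> F] --> v0 k) ->
  scaled_stat px s (e u) (om u) (t u) (h u)
    (latent sx (t u) (fun j => v u (inl j))) (fun lj => v u (inr lj)) @[u --> F] -->
  limit_stat s w theta (latent sx theta (fun j => v0 (inl j))) (fun lj => v0 (inr lj)).
Proof.
move=> tF hF omF eF vF; apply: cvg_scaled_stat => // j.
by apply: cvgD; [exact: cvg_par_mu|apply: cvgM; [exact: cvg_cst|exact: vF]].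
Qed.

End cvg_latent.

(** * Sample sizes and shrinking neighbourhoods of the parameter *)

Section sample_sizes.
Context {R : realType} {q m : nat}.
Variables (N : nat -> 'I_q.+1 -> nat) (theta : 'rV[R]_(m + (q + q))) (c : R).
Hypothesis hN : forall i, N nu i @[nu --> \oo] --> \oo.

Lemma near_sizes_gt0 : \forall nu \near \oo, forall i, (0 < N nu i)%N.
Proof. by apply: filter_forall => i; have /cvgnyPgt := hN i; exact. Qed.

Lemma cvg_rate0 : (Num.sqrt (total_size (N nu))%:R)^-1 @[nu --> \oo] --> (0 : R).
Proof.
apply/cvgrPdist_lt => eps eps0; have /cvgnyPgt large := hN ord0.
near=> nu; rewrite sub0r normrN ger0_norm ?invr_ge0 ?sqrtr_ge0//.
have lt_n : eps ^- 2 < (total_size (N nu))%:R.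
  apply: (lt_le_trans (truncnS_gt _)); rewrite ler_nat /total_size big_ord_recl.
  by apply: leq_trans (leq_addr _ _); near: nu; exact: large.
have n0 : 0 < (total_size (N nu))%:R :> R by rewrite (lt_trans _ lt_n)// invr_gt0 exprn_gt0.
rewrite -[eps]invrK ltf_pV2 ?posrE ?invr_gt0 ?sqrtr_gt0//.
by rewrite -(@ltr_pXn2r _ 2)// ?nnegrE ?invr_ge0 ?sqrtr_ge0 ?(ltW eps0)// sqr_sqrtr ?ltW// exprVn.
Unshelve. all: by end_near. Qed.

(** The bound on n precedes the quantifier over a: it serves theta^n as well as the values of h^n at
    all outcomes at once. *)
Lemma near_ball_shrinks r : 0 < r -> \forall nu \near \oo, forall a : 'rV[R]_(m + (q + q)),
  Num.sqrt (total_size (N nu))%:R * `|a - theta| <= c -> `|theta - a| < r.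
Proof.
move=> r0; have : (Num.sqrt (total_size (N nu))%:R)^-1 * c @[nu --> \oo] --> 0 * c.
  by apply: cvgM; [exact: cvg_rate0|exact: cvg_cst].
rewrite mul0r => /cvgrPdist_lt /(_ _ r0) small.
near=> nu => a ac; have n0 : 0 < Num.sqrt (total_size (N nu))%:R :> R.
  by rewrite sqrtr_gt0; apply: total_size_gt0; near: nu; exact: near_sizes_gt0.
have : `|theta - a| <= (Num.sqrt (total_size (N nu))%:R)^-1 * c.
  by rewrite distrC mulrC ler_pdivlMr// mulrC.
move/le_lt_trans; apply; rewrite (le_lt_trans (ler_norm _))// -normrN -sub0r; near: nu; exact: small.
Unshelve. all: by end_near. Qed.

End sample_sizes.

(** The parameter enters W~ through the slopes beta_i only. *)
Lemma Wtilde_bias (R : realType) (q m : nat) (s : 'I_q.+1 -> 'I_m -> R)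
    (w : 'I_q.+1 -> R) (theta theta' : 'rV[R]_(m + (q + q))) (x : 'I_m -> R) :
  par_bias theta' = par_bias theta -> Wtilde s w theta' x = Wtilde s w theta x.
Proof.
move=> bias; have bE : par_beta theta' = par_beta theta.
  apply/funext => i; rewrite /par_beta; case: (unlift ord0 i) => // i'.
  by have := congr1 (fun b : 'rV_(q + q) => b 0 (rshift q i')) bias; rewrite !mxE.
by rewrite /Wtilde /Wmx /Wblock /kappa1 /kappa2 /Ssum bE.
Qed.

Lemma limit_law_std (R : realType) (q m : nat) (sx : 'I_m -> R)
    (theta : 'rV[R]_(m + (q + q))) d (T : measurableType d) (P : probability T R)
    (x : 'I_m -> {RV P >-> R}) (z : 'I_(q + q) -> {RV P >-> R}) :
  (forall j, 0 < sx j) -> limit_law sx theta x z ->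
  std_normal_family P (fun k : 'I_m + 'I_(q + q) => match k with
    | inl j => fun t => (x j t - par_mu theta j) / sx j
    | inr l => z l : T -> R end).
Proof.
move=> sx0 [xlaw zlaw ind].
pose X k : {RV P >-> R} := match k with inl j => x j | inr l => z l end.
pose mu (k : 'I_m + 'I_(q + q)) := match k with inl j => par_mu theta j | inr _ => 0 end.
pose sd (k : 'I_m + 'I_(q + q)) := match k with inl j => sx j | inr _ => 1 end.
rewrite (_ : (fun k => _) = fun k t => (X k t - mu k) / sd k); last first.
  by apply/funext => -[j|l]; apply/funext => t //; rewrite /= subr0 divr1.
apply: std_normal_family_standardize; [by case|by case|].
move=> B mB; rewrite -(_ : [set t | forall k, B k ((match k with inl j => x j : T -> R
    | inr l => z l : T -> R end) t)] = [set t | forall k, B k (X k t)]); last first.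
  by apply/seteqP; split=> t Bt k; have := Bt k; case: k.
by rewrite ind//; apply: eq_bigr => -[].
Qed.

Theorem theorem3p1 (R : realType) (q m : nat)
  (hp : (2 <= q.+1)%N) (hm : (2 <= m)%N)
  (sx : 'I_m -> R) (s : 'I_q.+1 -> 'I_m -> R) (w : 'I_q.+1 -> R)
  (hsx : forall j, 0 < sx j) (hs : forall i j, 0 < s i j)
  (hw : forall i, 0 < w i)
  (* sample sizes *)
  (N : nat -> 'I_q.+1 -> nat)
  (hN : forall i, N nu i @[nu --> \oo] --> \oo)
  (hNw : forall i,
     (N nu i)%:R / (total_size (N nu))%:R @[nu --> \oo] --> w i)
  (theta : 'rV[R]_(m + (q + q))) (c : R) (hc : 0 < c)
  (thetan : nat -> 'rV[R]_(m + (q + q)))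
  (hthetan : forall nu, Bset (N nu) c theta (thetan nu))
  (* the data under the parameter thetan nu *)
  (d : nat -> measure_display) (T : forall nu, measurableType (d nu))
  (P : forall nu, probability (T nu) R)
  (x : forall nu, 'I_m -> {RV (P nu) >-> R})
  (e : forall nu, obs m (N nu) -> {RV (P nu) >-> R})
  (hdata : forall nu, model_law sx s (thetan nu) (x nu) (e nu))
  (Y : forall nu, T nu -> obs m (N nu) -> R)
  (hY : forall nu t, Y nu t =
     observation (thetan nu) (fun j => x nu j t) (fun o => e nu o t))
  (h : forall nu, T nu -> 'rV[R]_(m + (q + q)))
  (hh : forall nu, Rset c theta (@Y nu) (@h nu))
  (* the limit objects, under theta *)
  (d' : measure_display) (T' : measurableType d') (P' : probability T' R)
  (x' : 'I_m -> {RV P' >-> R}) (z : 'I_(q + q) -> {RV P' >-> R})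
  (hlimit : limit_law sx theta x' z) :
  [/\ cvg_in_distribution P
        (fun nu t =>
           ((Num.sqrt (total_size (N nu))%:R)^-1 *: score sx s (Y nu t) (thetan nu),
            (total_size (N nu))%:R^-1 *:
              observed_information sx s (Y nu t) (h nu t)))
        P'
        (fun t =>
           (Hvec s w theta (fun j => x' j t) (fun k => z k t),
            Wmx s w theta (fun j => x' j t))),
      {ae P', forall t, posdefmx (Wtilde s w theta (fun j => x' j t))}
    & forall (theta' : 'rV[R]_(m + (q + q))) (t t' : T'),
        par_bias theta' = par_bias theta ->
        (forall j, x' j t' = x' j t) ->
        Wtilde s w theta' (fun j => x' j t') =
        Wtilde s w theta (fun j => x' j t)].
Proof.
pose V nu := std_noise sx s (thetan nu) (x nu) (e nu).
pose r nu : R := (Num.sqrt (total_size (N nu))%:R)^-1.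
pose om nu i : R := (N nu i)%:R / (total_size (N nu))%:R.
(* The index u is n together with a candidate value of h^n. *)
pose G (u : nat * 'rV[R]_(m + (q + q))) (v : 'I_m + 'I_q.+1 * 'I_m -> R) :=
  scaled_stat (xprec sx) s (r u.1) (om u.1) (thetan u.1) u.2
    (latent sx (thetan u.1) (fun j => v (inl j))) (fun lj => v (inr lj)).
pose Phi (v : 'I_m + 'I_q.+1 * 'I_m -> R) :=
  limit_stat s w theta (latent sx theta (fun j => v (inl j))) (fun lj => v (inr lj)).
have V'std := limit_law_std hsx hlimit.
have x'E t : latent sx theta (fun j => (x' j t - par_mu theta j) / sx j) = fun j => x' j t.
  by apply/funext => j; rewrite /latent; field; rewrite gt_eqF.
have mY nu o : measurable_fun setT (fun t => Y nu t o).
  rewrite (funext (fun t => congr1 (fun y => y o) (hY nu t))).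
  by apply: measurable_funD => //; apply: measurable_funD => //; exact: measurable_funM.
have mh nu a : measurable_fun setT (fun t => h nu t 0 a).
  have [mh _ _] := hh nu.
  exact: (borel_measurable_continuous (f := fun v : 'rV_(m + (q + q)) => v 0 a) mh
    (@coord_continuous _ _ _ 0 a)).
have bX nu : borel_measurable (fun t =>
    ((Num.sqrt (total_size (N nu))%:R)^-1 *: score sx s (Y nu t) (thetan nu),
     (total_size (N nu))%:R^-1 *: observed_information sx s (Y nu t) (h nu t))).
  apply: borel_measurable_mx2 => i j.
    rewrite ord1; under eq_fun do rewrite mxE; apply: measurable_funM => //.
    by apply: (@measurable_score _ _ _ sx s hsx hs (N nu) _ _ (Y nu) (fun=> thetan nu)).
  under eq_fun do rewrite mxE; apply: measurable_funM => //.
  exact: measurable_observed_information.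
have bX' : borel_measurable (fun t =>
    (Hvec s w theta (fun j => x' j t) (fun k => z k t), Wmx s w theta (fun j => x' j t))).
  apply: borel_measurable_mx2 => i j; last exact: measurable_Wmx.
  by rewrite ord1; apply: measurable_Hvec.
(* This holds only eventually: the normalized cell sums require n_i > 0. *)
have Vstd : \forall nu \near \oo, std_normal_family (P nu) (V nu).
  by apply: filterS (near_sizes_gt0 hN) => nu N0; exact: std_noise_law.
have XE : \forall nu \near \oo, forall t,
    ((Num.sqrt (total_size (N nu))%:R)^-1 *: score sx s (Y nu t) (thetan nu),
     (total_size (N nu))%:R^-1 *: observed_information sx s (Y nu t) (h nu t))
    = G (nu, h nu t) (V nu ^~ t).
  apply: filterS (near_sizes_gt0 hN) => nu N0 t; apply: normalized_stat => //.
  apply/funext => i; apply/funext => j; rewrite hY.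
  exact: totals_std_noise.
have thetan_cvg : thetan nu @[nu --> \oo] --> theta.
  apply/cvgrPdist_lt => eps eps0; apply: filterS (near_ball_shrinks theta c hN eps0) => nu.
  by apply; exact: hthetan.
split.
- split=> // f cf [B fB].
  have mfX' := borel_measurable_continuous bX' cf.
  rewrite (expectation_Rintegral P' mfX' (fun t => fB _)).
  apply: (cvg_expectation_std_normal (V := V) (Phi := Phi) fB _ _ Vstd) => //.
  + by move=> nu; exact: (borel_measurable_continuous (bX nu) cf).
  + apply: (borel_measurable_continuous (X := fun tau => Phi (untuple tau)) _ cf).
    have ml j : measurable_fun setT (fun tau =>
        latent sx theta (fun j => untuple tau (inl j : 'I_m + 'I_q.+1 * 'I_m)) j : R).
      by apply: measurable_latent; exact: measurable_untuple.
    apply: borel_measurable_mx2 => i j; last exact: measurable_Wmx.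
    under eq_fun do rewrite mxE; apply: measurable_sum => lj.
    apply: measurable_funM; last exact: measurable_untuple.
    apply: measurable_score_coef => // i' j'.
    by apply: measurable_funD => //; exact: measurable_funM.
  + move=> nu nuStd; rewrite (limit_stat_law hm hsx hs hw theta nuStd V'std cf fB).
    by congr Rintegral; apply/funext => t /=; rewrite x'E.
  move=> M eps eps0; set F := filter_prod (nbhs \oo) (nbhs theta).
  have FF : Filter F by exact: filter_prod_filter.
  have cG (v0 : prod_topology (fun _ : 'I_m + 'I_q.+1 * 'I_m => R)) :
      G p.1 p.2 @[p --> (F, nbhs v0)] --> Phi v0.
    have p1 : p.1 @[p --> (F, nbhs v0)] --> F by exact: cvg_fst.
    have nu_cvg : p.1.1 @[p --> (F, nbhs v0)] --> \oo by exact: cvg_comp p1 cvg_fst.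
    have v_cvg k : p.2 k @[p --> (F, nbhs v0)] --> v0 k.
      have p2 : p.2 @[p --> (F, nbhs v0)] --> nbhs v0 by exact: cvg_snd.
      by move=> A vA; exact: (p2 _ (@proj_continuous _ (fun=> R) k v0 A vA)).
    have t_cvg : thetan p.1.1 @[p --> (F, nbhs v0)] --> theta by exact: cvg_comp nu_cvg thetan_cvg.
    have h_cvg : p.1.2 @[p --> (F, nbhs v0)] --> theta by exact: cvg_comp p1 cvg_snd.
    have om_cvg i : om p.1.1 i @[p --> (F, nbhs v0)] --> w i by exact: cvg_comp nu_cvg (hNw i).
    have r_cvg : r p.1.1 @[p --> (F, nbhs v0)] --> (0 : R) by exact: cvg_comp nu_cvg (cvg_rate0 hN).
    have FFZ : Filter (nbhs (F, nbhs v0)) by exact: filter_prod_filter.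
    exact: (cvg_scaled_stat_latent (FF := FFZ) (xprec sx) (sx := sx) hs hw t_cvg h_cvg om_cvg r_cvg v_cvg).
  have cPhi (v0 : prod_topology (fun _ : 'I_m + 'I_q.+1 * 'I_m => R)) :
      Phi v @[v --> v0] --> Phi v0.
    have v_cvg k : v k @[v --> v0] --> v0 k := @proj_continuous _ (fun=> R) k v0.
    (* [Phi] is the expression at e = 0, so its continuity is an instance of the same convergence,
       with constant parameters. *)
    rewrite (_ : Phi = fun v => scaled_stat (xprec sx) s 0 w theta theta
      (latent sx theta (fun j => v (inl j))) (fun lj => v (inr lj))); last first.
      by apply/funext => v; rewrite scaled_stat0.
    rewrite [X in _ --> X]scaled_stat0//.
    exact: (cvg_scaled_stat_latent (FF := nbhs_filter v0) (xprec sx) (sx := sx) hs hw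
      (cvg_cst theta) (cvg_cst theta) (fun i => cvg_cst (w i)) (cvg_cst (0 : R)) v_cvg).
  have [[A1 A2]/= [nA1 nA2] A12] := near_box M cG cPhi cf eps0.
  have [b b0 bA2] : exists2 b : R, 0 < b & forall a, `|theta - a| < b -> A2 a.
    by move: nA2 => /nbhs_ballP[b b0 bA]; exists b => // a ab; apply: bA; rewrite -ball_normE.
  (* For large n all values of h^n lie within b of theta, hence in A2, whatever the outcome. *)
  apply: filterS3 nA1 XE (near_ball_shrinks theta c hN b0) => nu A1nu XEnu hb t VM.
  rewrite /= XEnu.
  apply: (A12 (nu, h nu t)) => //; split=> //; apply: bA2; apply: hb.
  by have [_ _] := hh nu; apply.
- by apply: filterS (Wtilde_posdef_ae hm hsx hs hw theta V'std) => t; rewrite x'E.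
- move=> theta' t t' bias xE; rewrite (Wtilde_bias s w _ bias).
  by congr Wtilde; apply/funext => j.
Qed.
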